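(* Let $\alpha\in(0,\infty)$ and $q\in[1,\infty)$ satisfy $2\le\alpha q<2q+1$, let $\mathcal{K}$ be a tame knot class, and let $X=(\mathcal{X}(\mathcal{K}),d_X)$, where $d_X$ is any metric on $\mathcal{X}(\mathcal{K})$ for which there are constants $C_1,C_2>0$ with $$C_1\|f-g\|_{L^1(\mathbb{S}_1,\mathbb{R}^d)}\le d_X(f,g)\le C_2\|f-g\|_{W^{1,\infty}(\mathbb{S}_1,\mathbb{R}^d)}\qquad\text{for all } f,g\in\mathcal{X}(\mathcal{K}).$$ Then $\mathcal{E}_n^{\alpha,q}$ $\Gamma$-converges to $\mathcal{E}^{\alpha,q}$ on $X$ as $n\to\infty$.
   Context: $\mathbb{S}_1=\mathbb{R}/\mathbb{Z}$, with intrinsic distance $|t-s|$. For a tame knot class $\mathcal{K}$ (of closed curves in $\mathbb{R}^d$), $\mathcal{C}(\mathcal{K})$ is the set of simple closed curves $\mathbb{S}_1\to\mathbb{R}^d$ of length $1$ (parametrized by arc-length) belonging to $\mathcal{K}$; $\mathcal{P}_n(\mathcal{K})$ is the set of equilateral polygons with $n$ edges and total length $1$ (parametrized by arc-length) belonging to $\mathcal{K}$; and $$\mathcal{X}(\mathcal{K}):=\left(\mathcal{C}(\mathcal{K})\cap C^1(\mathbb{S}_1,\mathbb{R}^d)\right)\cup\bigcup_{n\in\mathbb{N}}\mathcal{P}_n(\mathcal{K}).$$ For $\gamma\in\mathcal{X}(\mathcal{K})$, $$\mathcal{E}^{\alpha,q}(\gamma):=\frac1\alpha\int_{\mathbb{S}_1}\int_{\mathbb{S}_1}\left(\frac{1}{|\gamma(t)-\gamma(s)|^\alpha}-\frac{1}{|t-s|^\alpha}\right)^q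 ds\,dt\in[0,\infty]$$ (the value is $\infty$ when the integral diverges). For $p_n\in\mathcal{P}_n(\mathcal{K})$ with vertices $p_n(a_1),\dots,p_n(a_n)$, $0\le a_1<\dots<a_n<1$ (indices modulo $n$), $$\mathcal{E}_n^{\alpha,q}(p_n):=\frac1\alpha\sum_{\substack{i,j=1\\ i\ne j}}^n\left(\frac{1}{|p_n(a_j)-p_n(a_i)|^\alpha}-\frac{1}{|a_j-a_i|^\alpha}\right)^q|p_n(a_{i+1})-p_n(a_i)|\,|p_n(a_{j+1})-p_n(a_j)|,$$ and $\mathcal{E}_n^{\alpha,q}:=\infty$ on $\mathcal{X}(\mathcal{K})\setminus\mathcal{P}_n(\mathcal{K})$. $\Gamma$-convergence: functionals $\mathscr{F}_n:X\to\overline{\mathbb{R}}$ on a metric space $X$ $\Gamma$-converge to $\mathscr{F}:X\to\overline{\mathbb{R}}$ if for all $x\in X$: (i) for every sequence $\{x_n\}\subset X$ converging to $x$ in $X$, $\mathscr{F}(x)\le\liminf_{n\to\infty}\mathscr{F}_n(x_n)$; (ii) there exists a sequence $\{x_n\}\subset X$ converging to $x$ in $X$ with $\mathscr{F}(x)\ge\limsup_{n\to\infty}\mathscr{F}_n(x_n)$. *)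

(* Defs.v *)
From HB Require Import structures.
From mathcomp Require Import all_boot all_order all_algebra.
From mathcomp Require Import all_classical all_reals all_analysis.

Set Implicit Arguments.
Unset Strict Implicit.
Unset Printing Implicit Defensive.

Import Order.TTheory GRing.Theory Num.Theory.
Import numFieldNormedType.Exports.

Local Open Scope ring_scope.
Local Open Scope classical_set_scope.

(* A map S_1 = R/Z -> R^d is represented by a 1-periodic map R -> R^d, and
   integration over S_1 by integration over `[0, 1]. *)

Section Euclidean.
Context {R : realType} {d : nat}.
Implicit Types (u v g : R -> 'rV[R]_d) (a b s t : R).

(* The library norm on 'rV[R]_d is the sup norm. It induces the same topology,
   so it is kept for continuity and derivability only. *)
Definition enorm (x : 'rV[R]_d) : R := Num.sqrt (\sum_i x ord0 i ^+ 2).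

Definition circle_dist s t : R := inf [set `|t - s + k%:~R| | k in [set: int]].

Definition curve_length g a b : \bar R :=
  ereal_sup [set (let p := g \o nth b (a :: s) in
                  \sum_(0 <= i < size s) enorm (p i.+1 - p i))%:E
            | s in itv_partition a b].

Definition arc_length_parametrized g :=
  forall s t, 0 <= s -> s <= t -> t <= 1 -> curve_length g s t = (t - s)%:E.

Definition simple_closed_curve g :=
  [/\ periodic g 1, continuous g & {in `[0, 1[ &, injective g}].

Definition C1 g := (forall t, derivable g t 1) /\ continuous (derive1 g).

Definition curve_Lnorm (p : \bar R) u : \bar R :=
  ('N[lebesgue_measure]_p [(fun t => (enorm (u t))%:E) \_ `[0%R, 1%R]])%E.

Definition test_function (phi : R -> R) :=
  periodic phi 1 /\ forall n t, derivable (derive1n n phi) t 1.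

Definition weak_derivative u v :=
  forall i,
  [/\ lebesgue_measure.-integrable `[0, 1] (fun t => (u t ord0 i)%:E),
      lebesgue_measure.-integrable `[0, 1] (fun t => (v t ord0 i)%:E) &
      forall phi, test_function phi ->
        \int[lebesgue_measure]_(t in `[0, 1]) (u t ord0 i * derive1 phi t) =
        - \int[lebesgue_measure]_(t in `[0, 1]) (v t ord0 i * phi t)].

(* A weak derivative is unique almost everywhere, so the infimum is over at
   most one value; it is +oo if there is no weak derivative. *)
Definition W1oo_norm u : \bar R :=
  ereal_inf [set (curve_Lnorm +oo u + curve_Lnorm +oo v)%E
            | v in weak_derivative u].

End Euclidean.

Section Knots.
Context {R : realType} {d : nat}.
Implicit Types (g p : R -> 'rV[R]_d) (A B : set 'rV[R]_d) (a : nat -> R).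
Implicit Types K : set (R -> 'rV[R]_d).

Definition homeomorphism (h : 'rV[R]_d -> 'rV[R]_d) :=
  continuous h /\ exists h', [/\ continuous h', cancel h h' & cancel h' h].

Definition ambient_isotopic A B :=
  exists H : R -> 'rV[R]_d -> 'rV[R]_d,
  [/\ {within `[0, 1] `*` [set: 'rV[R]_d],
         continuous (fun z : R * 'rV[R]_d => H z.1 z.2)},
      forall t, 0 <= t -> t <= 1 -> homeomorphism (H t),
      H 0 = id & H 1 @` A = B].

(* The parameters of the vertices are a 0 < ... < a n.-1 in [0, 1[, extended to
   all indices by a (i + n) = a i + 1, so that vertex indices are modulo n. In
   particular n = 0 is impossible. Consecutive edges may be collinear. *)
Definition polygon_parameters (n : nat) p a :=
  [/\ forall i, a (i + n)%N = a i + 1,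
      forall i, a i < a i.+1,
      0 <= a 0%N, a n.-1 < 1 &
      forall i (x : R), 0 <= x -> x <= 1 ->
        p ((1 - x) * a i + x * a i.+1) = (1 - x) *: p (a i) + x *: p (a i.+1)].

Definition edge_length p a (i : nat) : R := enorm (p (a i.+1) - p (a i)).

Definition equilateral_parameters (n : nat) p a :=
  polygon_parameters n p a /\ forall i j, edge_length p a i = edge_length p a j.

(* A knot class is a class of parametrized simple closed curves whose images
   are ambient isotopic; it is tame if it contains a polygon. *)
Definition tame_knot_class K :=
  exists p, [/\ simple_closed_curve p,
    exists n a, polygon_parameters n p a &
    K = [set g | simple_closed_curve g /\
                 ambient_isotopic (range p) (range g)]].

Definition unit_curves K : set (R -> 'rV[R]_d) :=
  [set g | [/\ simple_closed_curve g, arc_length_parametrized g & K g]].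

Definition polygons K (n : nat) : set (R -> 'rV[R]_d) :=
  [set p | unit_curves K p /\ exists a, equilateral_parameters n p a].

Definition curve_space K : set (R -> 'rV[R]_d) :=
  (unit_curves K `&` C1) `|` \bigcup_n polygons K n.

End Knots.

Section Energies.
Context {R : realType} {d : nat}.
Implicit Types (g p : R -> 'rV[R]_d) (K : set (R -> 'rV[R]_d)).
Implicit Types s t alpha q : R.

Definition energy_density alpha q g s t : R :=
  ((enorm (g t - g s) `^ alpha)^-1 - (circle_dist s t `^ alpha)^-1) `^ q.

(* On the diagonal the density takes an irrelevant finite value, by 0^-1 = 0. *)
Definition energy alpha q g : \bar R :=
  ((alpha^-1)%:E * \int[lebesgue_measure]_(t in `[0%R, 1%R])
     \int[lebesgue_measure]_(s in `[0%R, 1%R])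
       (energy_density alpha q g s t)%:E)%E.

(* For p in polygons K n the parameters are unique: they are spaced by 1 / n,
   and a closed polygon has a corner, which must be a vertex. *)
Definition vertex_parameters (n : nat) p : nat -> R :=
  get [set a | equilateral_parameters n p a].

Definition discrete_energy K alpha q (n : nat) p : \bar R :=
  if p \in polygons K n then
    let a := vertex_parameters n p in
    (alpha^-1 * \sum_(i < n) \sum_(j < n | j != i)
       energy_density alpha q p (a i) (a j)
       * edge_length p a i * edge_length p a j)%:E
  else +oo%E.

End Energies.

Section GammaConvergence.
Context {R : realType} {T : Type}.

Definition is_metric (dist : T -> T -> R) :=
  [/\ forall x y, 0 <= dist x y,
      forall x y, dist x y = 0 <-> x = y,
      forall x y, dist x y = dist y x &
      forall x y z, dist x z <= dist x y + dist y z].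

Definition gamma_converges (dist : T -> T -> R)
    (F_ : nat -> T -> \bar R) (F : T -> \bar R) :=
  forall x,
    (forall x_ : nat -> T, dist (x_ n) x @[n --> \oo] --> (0 : R) ->
       (F x <= limn_einf (fun n => F_ n (x_ n)))%E) /\
    (exists2 x_ : nat -> T, dist (x_ n) x @[n --> \oo] --> (0 : R) &
       (limn_esup (fun n => F_ n (x_ n)) <= F x)%E).

End GammaConvergence.

(* Main.v *)
Require Import Defs.
From HB Require Import structures.
From mathcomp Require Import all_boot all_order all_algebra.
From mathcomp Require Import ring lra zify.
From mathcomp Require Import all_classical all_reals all_analysis.
From mathcomp Require Import measurable_realfun ess_sup_inf.

Set Implicit Arguments.
Unset Strict Implicit.
Unset Printing Implicit Defensive.

Import Order.TTheory GRing.Theory Num.Theory.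
Import numFieldNormedType.Exports.

Local Open Scope classical_set_scope.
Local Open Scope ring_scope.

(** The statement has a lower and an upper part.

    Lower bound (liminf_energy). A polygon with n equal edges, parametrized by
    arc length, has its vertices at parameters spaced by 1 / n, so its discrete
    energy is exactly the integral of a step function, whose values are values of
    the energy density at the lower left corners of the cells of a grid of mesh
    1 / n. The curves are uniformly Lipschitz, so convergence in mean is
    pointwise convergence; hence the step functions converge to the density of
    the limit, and Fatou's lemma applies.

    Upper bound. Only curves of finite energy matter, and these are continuously
    differentiable: a closed polygon has a corner, where the chords are shorter
    than the arcs by a fixed factor, and since alpha * q >= 2 the density is not
    integrable there (polygon_energy_pinfty). Let g be a C1 curve of finite
    energy. Walking along g with a pair of compasses, whose opening r is adjusted
    by the intermediate value theorem so that exactly n steps lead back to the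
    start, gives an equilateral inscribed polygon (inscribed_equilateral), with
    vertices g (t i), which is then rescaled to length 1. As the tangent of g is
    uniformly continuous, the rescaled polygon p converges to g in W^(1, oo)
    (inscribed_close).

    The difference p - g is even Lipschitz with a small constant with respect to
    the chords of g, because chords and arcs of g are comparable. It extends from
    the image of g to a contraction W of the whole space, and id + t W, for t in
    [0, 1], is an ambient isotopy from g to p; so p belongs to the knot class
    (inscribed_polygons).

    It remains to compare energies. The discrete energy of p is at most the sum of
    the densities of g at the pairs (t i, t j), weighted by r ^ 2, again because
    alpha * q >= 2 (inscribed_energy_le). To bound this sum by an integral with a
    dominated integrand, note that prolonging an arc by a length comparable with
    its own cannot decrease the density by more than a constant factor
    (kernel_prolong). Therefore the density at (t i, t j) is put, after a shift of
    an index that does not affect the whole sum, on the cell from whose points the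
    arc between the two vertices is reached by shortening. The resulting step
    functions are dominated by a multiple of the density of g plus a constant,
    which is integrable, and converge to the density almost everywhere
    (step_integral_cvg, limsup_energy). *)

(** * The Euclidean norm *)

Section EuclideanNorm.
Context {R : realType} {d : nat}.
Implicit Types x y z : 'rV[R]_d.

Lemma enorm_ge0 x : 0 <= enorm x.
Proof. exact: sqrtr_ge0. Qed.

Let sumsq_ge0 x : 0 <= \sum_i x ord0 i ^+ 2.
Proof. by apply: sumr_ge0 => i _; exact: sqr_ge0. Qed.

Lemma enorm_sqr x : enorm x ^+ 2 = \sum_i x ord0 i ^+ 2.
Proof. by rewrite sqr_sqrtr. Qed.

Lemma enormZ (c : R) x : enorm (c *: x) = `|c| * enorm x.
Proof.
rewrite /enorm -sqrtr_sqr -sqrtrM ?sqr_ge0// mulr_sumr.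
by congr Num.sqrt; apply: eq_bigr => i _; rewrite mxE exprMn.
Qed.

Lemma enorm0 : enorm (0 : 'rV[R]_d) = 0.
Proof. by rewrite -(scale0r (0 : 'rV[R]_d)) enormZ normr0 mul0r. Qed.

Lemma enormN x : enorm (- x) = enorm x.
Proof. by rewrite -scaleN1r enormZ normrN1 mul1r. Qed.

Lemma enorm_distC x y : enorm (x - y) = enorm (y - x).
Proof. by rewrite -enormN opprB. Qed.

Lemma enorm_coord x i : `|x ord0 i| <= enorm x.
Proof.
rewrite -sqrtr_sqr /enorm ler_sqrt// (bigD1 i)//= lerDl.
by apply: sumr_ge0 => j _; exact: sqr_ge0.
Qed.

Lemma enorm_eq0 x : enorm x = 0 -> x = 0.
Proof.
move=> x0; apply/rowP => i; rewrite !mxE; apply/eqP.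
by rewrite -normr_eq0 eq_le normr_ge0 -x0 enorm_coord.
Qed.

Lemma enorm_gt0 x : x != 0 -> 0 < enorm x.
Proof.
by move=> x0; rewrite lt_neqAle enorm_ge0 andbT eq_sym;
  apply: contraNneq x0 => /enorm_eq0 ->.
Qed.

(** Young's inequality in each coordinate, with the weights for which both sums
   of squares become half of |x| |y|. *)
Lemma cauchy_schwarz x y :
  \sum_i x ord0 i * y ord0 i <= enorm x * enorm y.
Proof.
have [->|x0] := eqVneq x 0.
  by rewrite big1 ?enorm0 ?mul0r// => i _; rewrite mxE mul0r.
have [->|y0] := eqVneq y 0.
  by rewrite big1 ?enorm0 ?mulr0// => i _; rewrite mxE mulr0.
have xp := enorm_gt0 x0; have yp := enorm_gt0 y0.
set a := enorm x in xp *; set b := enorm y in yp *.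
apply: (@le_trans _ _
    (\sum_i 2^-1 * (b / a * x ord0 i ^+ 2 + a / b * y ord0 i ^+ 2))).
  apply: ler_sum => i _; rewrite -subr_ge0.
  have -> : 2^-1 * (b / a * x ord0 i ^+ 2 + a / b * y ord0 i ^+ 2)
      - x ord0 i * y ord0 i
      = (b * x ord0 i - a * y ord0 i) ^+ 2 / (2 * a * b).
    by field; rewrite !gt_eqF.
  by rewrite divr_ge0 ?sqr_ge0 ?mulr_ge0 ?ltW.
rewrite -mulr_sumr big_split/= -!mulr_sumr -!enorm_sqr -/a -/b le_eqVlt.
by apply/orP; left; apply/eqP; field; rewrite !gt_eqF.
Qed.

Lemma enormD x y : enorm (x + y) <= enorm x + enorm y.
Proof.
rewrite -ler_sqr ?nnegrE ?addr_ge0 ?enorm_ge0// sqrrD !enorm_sqr.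
rewrite (eq_bigr (fun i => x ord0 i ^+ 2 + y ord0 i ^+ 2
    + 2 * (x ord0 i * y ord0 i))); last by move=> i _; rewrite mxE; ring.
rewrite big_split -mulr_sumr big_split/=.
by have := cauchy_schwarz x y; lra.
Qed.

Lemma enorm_distD z x y : enorm (x - y) <= enorm (x - z) + enorm (z - y).
Proof. by rewrite -{1}(subrKA z) enormD. Qed.

Lemma enorm_sub_le x y : enorm x - enorm y <= enorm (x - y).
Proof. by rewrite lerBlDr (le_trans _ (enormD _ _))// subrK. Qed.

Lemma enorm_sub_abs x y : `|enorm x - enorm y| <= enorm (x - y).
Proof. by rewrite ler_norml lerNl opprB {1}enorm_distC !enorm_sub_le. Qed.

Lemma enorm_sum (I : Type) (r : seq I) (P : pred I) (F : I -> 'rV[R]_d) :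
  enorm (\sum_(i <- r | P i) F i) <= \sum_(i <- r | P i) enorm (F i).
Proof.
elim/big_ind2: _ => [|a b u v ab uv|i _]; rewrite ?enorm0//.
by rewrite (le_trans (enormD _ _))// lerD.
Qed.

Lemma enorm_le_sum x : enorm x <= \sum_i `|x ord0 i|.
Proof.
rewrite {1}(row_sum_delta x) (le_trans (enorm_sum _ _ _))// ler_sum// => i _.
rewrite enormZ ler_piMr// /enorm (bigD1 i)//= big1 => [|j ji].
  by rewrite mxE !eqxx addr0 expr1n sqrtr1.
by rewrite mxE (negbTE ji) andbF expr0n.
Qed.

Lemma normr_le_enorm x : `|x| <= enorm x.
Proof.
rewrite /Num.Def.normr/= mx_normrE; apply/bigmax_leP => /=; split.
  exact: enorm_ge0.
by move=> [i j] _ /=; rewrite ord1 enorm_coord.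
Qed.

Lemma normr_coord x i : `|x ord0 i| <= `|x|.
Proof.
rewrite [leRHS]/Num.Def.normr/= mx_normrE.
exact: (le_bigmax _ (fun ij : 'I_1 * 'I_d => `|x ij.1 ij.2|) (ord0, i)).
Qed.

Lemma enorm_le_normr x : enorm x <= d%:R * `|x|.
Proof.
rewrite (le_trans (enorm_le_sum x))// (@le_trans _ _ (\sum_(i < d) `|x|))//.
  by apply: ler_sum => i _; exact: normr_coord.
by rewrite sumr_const card_ord mulr_natl.
Qed.

Lemma enorm_le_coord (e : R) x :
  (forall i, `|x ord0 i| <= e) -> enorm x <= d%:R * e.
Proof.
move=> xe; rewrite (le_trans (enorm_le_sum x))//.
rewrite (@le_trans _ _ (\sum_(i < d) e)) ?ler_sum//.
by rewrite sumr_const card_ord mulr_natl.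
Qed.

End EuclideanNorm.

(** * Distance on the circle *)

Section CircleDistance.
Context {R : realType}.
Implicit Types (s t l : R) (k : int).

Let S s t := [set `|t - s + k%:~R| | k in [set: int]].

Let S_inf s t : has_inf (S s t).
Proof. by split; [exists `|t - s + 0%:~R|, 0|exists 0 => _ [k _ <-]]. Qed.

Lemma circle_dist_le k s t : circle_dist s t <= `|t - s + k%:~R|.
Proof. by apply: ge_inf; [exact: (S_inf s t).2|exists k]. Qed.

Lemma le_circle_dist l s t :
  (forall k, l <= `|t - s + k%:~R|) -> l <= circle_dist s t.
Proof.
by move=> lk; apply: lb_le_inf; [exact: (S_inf s t).1|move=> _ [k _ <-]].
Qed.

Lemma circle_dist_ge0 s t : 0 <= circle_dist s t.
Proof. exact: le_circle_dist. Qed.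

Lemma circle_dist_le_norm s t : circle_dist s t <= `|t - s|.
Proof. by rewrite (le_trans (circle_dist_le 0 s t))// addr0. Qed.

Lemma circle_dist_triangle s t s' t' :
  circle_dist s t <= circle_dist s' t' + `|s - s'| + `|t - t'|.
Proof.
rewrite -!lerBlDr; apply: le_circle_dist => k; rewrite !lerBlDr.
rewrite (le_trans (circle_dist_le k s t))//.
have -> : t - s + k%:~R = (t' - s' + k%:~R) + (s' - s) + (t - t') by lra.
rewrite (le_trans (ler_normD _ _))// lerD2r (le_trans (ler_normD _ _))//.
by rewrite (distrC s').
Qed.

Lemma circle_distC s t : circle_dist s t = circle_dist t s.
Proof.
suff H (u v : R) : circle_dist u v <= circle_dist v u.
  by apply/eqP; rewrite eq_le !H.
apply: le_circle_dist => k.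
rewrite (le_trans (circle_dist_le (- k) u v))//.
by rewrite -normrN le_eqVlt; apply/orP; left; apply/eqP; congr `|_|;
  rewrite intrN; lra.
Qed.

Lemma circle_dist_shiftr s t k : circle_dist s (t + k%:~R) = circle_dist s t.
Proof.
apply/eqP; rewrite eq_le; apply/andP; split; apply: le_circle_dist => j.
  rewrite (le_trans (circle_dist_le (j - k) _ _))// le_eqVlt; apply/orP; left.
  by apply/eqP; congr `|_|; rewrite intrB; lra.
rewrite (le_trans (circle_dist_le (j + k) _ _))// le_eqVlt; apply/orP; left.
by apply/eqP; congr `|_|; rewrite intrD; lra.
Qed.

Lemma circle_dist_shiftl s t k : circle_dist (s + k%:~R) t = circle_dist s t.
Proof. by rewrite circle_distC circle_dist_shiftr circle_distC. Qed.

Lemma int_dist_half (x : R) k : 0 <= x <= 2^-1 -> x <= `|x + k%:~R|.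
Proof.
move=> /andP[x0 x1].
have [k0|k0] := leP 0 k.
  have kR : 0 <= k%:~R :> R by rewrite ler0z.
  by rewrite ger0_norm ?addr_ge0// lerDl.
have kR : k%:~R <= -1 :> R by rewrite -[-1]/((-1)%:~R) ler_int; lia.
rewrite ler0_norm; lra.
Qed.

Lemma circle_dist_half s t k :
  0 <= t - s + k%:~R <= 2^-1 -> circle_dist s t = t - s + k%:~R.
Proof.
move=> /andP[l0 l1]; apply/eqP; rewrite eq_le; apply/andP; split.
  by rewrite -[leRHS]ger0_norm// circle_dist_le.
apply: le_circle_dist => j.
have -> : t - s + j%:~R = (t - s + k%:~R) + (j - k)%:~R by rewrite intrB; lra.
by apply: int_dist_half; rewrite l0.
Qed.

(** Lifting the two points suitably turns the distance on the circle into a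
   difference of real numbers, up to exchanging the points. *)
Lemma circle_arc s t :
  (exists k, 0 <= t - s + k%:~R <= 2^-1) \/
  (exists k, 0 <= s - t + k%:~R <= 2^-1).
Proof.
have /andP[f0 f1] := floor_itv (t - s); rewrite intrD1 in f1.
set f := Num.floor _ in f0 f1.
have [h|h] := leP (t - s - f%:~R) 2^-1.
  by left; exists (- f); rewrite intrN; lra.
by right; exists (f + 1); rewrite intrD; lra.
Qed.

Lemma circle_dist_le_half s t : circle_dist s t <= 2^-1.
Proof.
have [[k]|[k]] := circle_arc s t => /[dup] /circle_dist_half.
  by move=> -> /andP[].
by rewrite circle_distC => -> /andP[].
Qed.

End CircleDistance.

(** * The energy density as a function of chord and arc length *)

Section Kernel.
Context {R : realType}.
Variables (alpha q : R).
Hypotheses (alpha_gt0 : 0 < alpha) (q_ge1 : 1 <= q).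
Implicit Types (c l h m u : R).

Let q_ge0 : 0 <= q. Proof. exact: le_trans q_ge1. Qed.
Let q_gt0 : 0 < q. Proof. exact: lt_le_trans q_ge1. Qed.

(** The energy density depends on the curve only through the chord c and the
   arc l, and most estimates below are estimates of this function of two real
   variables. *)
Definition kernel c l : R := ((c `^ alpha)^-1 - (l `^ alpha)^-1) `^ q.

Lemma energy_densityE d (g : R -> 'rV[R]_d) s t :
  energy_density alpha q g s t = kernel (enorm (g t - g s)) (circle_dist s t).
Proof. by []. Qed.

Lemma kernel_ge0 c l : 0 <= kernel c l.
Proof. exact: powR_ge0. Qed.

Lemma invpowR_le c l : 0 < c -> c <= l -> (l `^ alpha)^-1 <= (c `^ alpha)^-1.
Proof.
move=> c0 cl; have l0 := lt_le_trans c0 cl.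
by rewrite lef_pV2 ?posrE ?powR_gt0// ge0_ler_powR ?nnegrE// ltW.
Qed.

Lemma invpowR_sub_ge0 c l :
  0 < c -> c <= l -> 0 <= (c `^ alpha)^-1 - (l `^ alpha)^-1.
Proof. by move=> c0 cl; rewrite subr_ge0 invpowR_le. Qed.

Lemma kernel_mono c l c' l' : 0 < c -> c <= l ->
  (c `^ alpha)^-1 - (l `^ alpha)^-1 <= (c' `^ alpha)^-1 - (l' `^ alpha)^-1 ->
  kernel c l <= kernel c' l'.
Proof.
move=> c0 cl le; have ge0 := invpowR_sub_ge0 c0 cl.
by rewrite /kernel ge0_ler_powR ?nnegrE// (le_trans ge0).
Qed.

Lemma kernel_scale m c l : 0 < m -> 0 < c -> c <= l ->
  kernel (c / m) (l / m) = m `^ (alpha * q) * kernel c l.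
Proof.
move=> m0 c0 cl; have l0 := lt_le_trans c0 cl.
have H u : 0 < u -> ((u / m) `^ alpha)^-1 = m `^ alpha * (u `^ alpha)^-1.
  move=> u0; rewrite powRM ?invr_ge0 ?ltW// invfM mulrC; congr (_ * _).
  by rewrite -powRN -powR_inv1 ?ltW// -powRrM mulrN mulN1r opprK.
rewrite /kernel !H// -mulrBr powRM ?powR_ge0 ?invpowR_sub_ge0//.
by rewrite powRrM.
Qed.

Lemma kernel_le c l : 0 < c -> c <= l -> kernel c l <= c `^ (- (alpha * q)).
Proof.
move=> c0 cl; rewrite -mulNr powRrM powRN.
rewrite ge0_ler_powR ?nnegrE ?invpowR_sub_ge0 ?invr_ge0 ?powR_ge0//.
by rewrite lerBlDr lerDl invr_ge0 powR_ge0.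
Qed.

(** The left-hand side is alpha times the integral of u ^ (- alpha - 1) over
   [c, l]. Shifting both ends by h changes the integrand by the factor
   ((u + h) / u) ^ (- alpha - 1), which is controlled by h / c. Instead of
   comparing integrals, the proof shows that the difference phi of the two
   primitives is nonincreasing. *)
Lemma invpowR_sub_shift c l h m : 0 < c -> c <= l -> 0 <= h -> h <= m * c ->
  (c `^ alpha)^-1 - (l `^ alpha)^-1 <=
  (1 + m) `^ (alpha + 1) *
    (((c + h) `^ alpha)^-1 - ((l + h) `^ alpha)^-1).
Proof.
move=> c0 cl h0 hm.
have m0 : 0 <= m by rewrite -(pmulr_lge0 _ c0) (le_trans h0).
set B := (1 + m) `^ (alpha + 1).
pose phi u := B * (u + h) `^ (- alpha) - u `^ (- alpha).
pose phi' u :=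
  B * (- alpha * (u + h) `^ (- alpha - 1)) - - alpha * u `^ (- alpha - 1).
have dphi u : 0 < u -> is_derive u 1 phi (phi' u).
  move=> u0; have uh0 : 0 < u + h by rewrite ltr_pwDl.
  rewrite /phi /phi'; apply: is_deriveB; last exact: is_derive1_powR.
  apply: (@is_deriveZ _ _ _ (fun u => (u + h) `^ (- alpha)) B).
  have duh : is_derive u 1 (fun u => u + h) 1.
    by rewrite -[X in is_derive _ _ _ X]addr0; apply: is_deriveD.
  have dp : is_derive (u + h) 1 (fun x : R => x `^ (- alpha))
    (- alpha * (u + h) `^ (- alpha - 1)) by exact: is_derive1_powR.
  by rewrite -[X in is_derive _ _ _ X]mulr1; exact: (@is_derive1_comp R (fun x => x `^ (- alpha)) (fun u => u + h) u _ _ dp duh).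
have phi'_le0 u : c <= u -> phi' u <= 0.
  move=> cu; have u0 := lt_le_trans c0 cu.
  have uh0 : 0 < u + h by rewrite ltr_pwDl.
  rewrite /phi' mulrCA -mulrBr mulNr oppr_le0 mulr_ge0 ?(ltW alpha_gt0)//.
  have E v : v `^ (- alpha - 1) = (v `^ (alpha + 1))^-1 by rewrite -opprD powRN.
  rewrite subr_ge0 !E ler_pdivlMr ?powR_gt0// mulrC ler_pdivrMr ?powR_gt0//.
  rewrite /B -powRM ?(ltW u0) ?addr_ge0//.
  have mu : m * c <= m * u by rewrite ler_wpM2l.
  rewrite ge0_ler_powR ?nnegrE ?mulr_ge0 ?addr_ge0 ?(ltW u0) ?(ltW alpha_gt0)//.
  by rewrite mulrDl mul1r lerD2l (le_trans hm).
have [x xcl E] : exists2 x, x \in `[c, l]%R & phi l - phi c = phi' x * (l - c).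
  apply: MVT_segment => // [x|].
    by rewrite in_itv/= => /andP[cx _]; apply: dphi; rewrite (lt_trans c0).
  apply: continuous_in_subspaceT => x; rewrite inE/= in_itv/= => /andP[cx _].
  apply/differentiable_continuous/derivable1_diffP.
  by have [] := dphi x (lt_le_trans c0 cx).
have : phi l <= phi c.
  rewrite -subr_le0 E mulr_le0_ge0 ?subr_ge0// phi'_le0//.
  by move: xcl; rewrite in_itv/= => /andP[].
by rewrite /phi !powRN; lra.
Qed.

(** If an arc is prolonged by a length comparable with its chord, then the
   density of the longer arc dominates that of the shorter one: prolonging by h
   increases the chord by at most h, and the arc by exactly h. *)
Lemma kernel_prolong c l h m c' : 0 < c -> c <= l -> 0 <= h -> h <= m * c ->
  0 < c' -> c' <= c + h ->
  kernel c l <= ((1 + m) `^ (alpha + 1)) `^ q * kernel c' (l + h).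
Proof.
move=> c0 cl h0 hm c'0 c'h; have l0 := lt_le_trans c0 cl.
rewrite /kernel -powRM ?powR_ge0//; last first.
  by rewrite invpowR_sub_ge0// (le_trans c'h)// lerD2r.
rewrite ge0_ler_powR ?nnegrE ?invpowR_sub_ge0//.
  rewrite mulr_ge0 ?powR_ge0// invpowR_sub_ge0// (le_trans c'h)//.
  by rewrite lerD2r.
rewrite (le_trans (invpowR_sub_shift c0 cl h0 hm))// ler_wpM2l ?powR_ge0//.
by rewrite lerD2r invpowR_le.
Qed.

Lemma continuous_powR (a u : R) :
  0 < u -> {for u, continuous (fun x : R => x `^ a)}.
Proof.
move=> u0; apply/differentiable_continuous/derivable1_diffP.
by have [] := is_derive1_powR a u0.
Qed.

Lemma cvg_invpowR (T : Type) (F : set_system T) (FF : Filter F) (f : T -> R) u :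
  0 < u -> f x @[x --> F] --> u ->
  (f x `^ alpha)^-1 @[x --> F] --> (u `^ alpha)^-1.
Proof.
move=> u0 fu; apply: cvgV; first by rewrite gt_eqF ?powR_gt0.
exact: (@continuous_cvg _ _ _ F FF _ _ _ (continuous_powR u0) fu).
Qed.

(** At 0 the continuity comes from y ^ q <= y for 0 <= y <= 1 <= q. *)
Lemma cvg_norm_powR (T : Type) (F : set_system T) (FF : Filter F)
    (f : T -> R) u :
  f x @[x --> F] --> u -> `|f x| `^ q @[x --> F] --> `|u| `^ q.
Proof.
move=> fu; have nfu : `|f x| @[x --> F] --> `|u| by exact: cvg_norm.
have [u0|u0] := eqVneq u 0; last first.
  have up : 0 < `|u| by rewrite normr_gt0.
  exact: (@continuous_cvg _ _ _ F FF _ _ _ (continuous_powR up) nfu).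
move: nfu; rewrite u0 normr0 powR0 ?gt_eqF// => nf0.
apply: (@squeeze_cvgr _ _ _ _ (cst 0) (fun x => `|f x|)) => //;
  last exact: cvg_cst.
have : \forall x \near F, `|0 - `|f x| | <= 1 by move/cvgrPdist_le: nf0; apply.
apply: filterS => x; rewrite sub0r normrN normr_id => fx1.
rewrite powR_ge0/=; have [->|fx0] := eqVneq `|f x| 0.
  by rewrite powR0// gt_eqF.
by rewrite ge1r_powR// fx1 lt_neqAle eq_sym fx0 normr_ge0.
Qed.

(** The base of the power may tend to 0, where a real power is not continuous on
   the negative side; the condition that chords are at most arcs keeps the base
   nonnegative. *)
Lemma cvg_kernel (T : Type) (F : set_system T) (FF : Filter F)
    (c_ l_ : T -> R) c l : 0 < c -> c <= l ->
  (\forall x \near F, 0 < c_ x <= l_ x) ->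
  c_ x @[x --> F] --> c -> l_ x @[x --> F] --> l ->
  kernel (c_ x) (l_ x) @[x --> F] --> kernel c l.
Proof.
move=> c0 cl cl_ cc ll; have l0 := lt_le_trans c0 cl.
have H : `|(c_ x `^ alpha)^-1 - (l_ x `^ alpha)^-1| `^ q @[x --> F] -->
         `|(c `^ alpha)^-1 - (l `^ alpha)^-1| `^ q.
  by apply: cvg_norm_powR; apply: cvgB; exact: cvg_invpowR.
rewrite ger0_norm ?invpowR_sub_ge0// in H.
apply: cvg_trans H; apply: near_eq_cvg; near=> x; rewrite /kernel.
suff /andP[c_0 c_l] : 0 < c_ x <= l_ x by rewrite ger0_norm// invpowR_sub_ge0.
by near: x.
Unshelve. all: by end_near. Qed.

End Kernel.

(** * Lipschitz closed curves and arc length *)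

Section Curves.
Context {R : realType} {d : nat}.
Implicit Types (g p : R -> 'rV[R]_d) (c x y s t : R) (k : int).

Lemma periodicz (T : Type) (f : R -> T) k x :
  (forall x, f (x + 1) = f x) -> f (x + k%:~R) = f x.
Proof.
move=> pf; have H (n : nat) z : f (z + n%:R) = f z.
  elim: n z => [|n IH] z; first by rewrite addr0.
  by rewrite -addn1 natrD addrA pf IH.
case: k => n; first exact: H.
by rewrite NegzE intrN -[in RHS](subrK n.+1%:R x) H.
Qed.

Lemma floor_fract01 x : 0 <= x - (Num.floor x)%:~R < 1.
Proof. by have /andP[] := floor_itv x; rewrite intrD; lra. Qed.

(** A 1-periodic map is determined on the line by its restriction to [0, 1];
   two points of [0, 1] are joined either directly or through the base point. *)
Lemma lipschitz_circle c g : 0 <= c -> periodic g 1 ->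
  (forall s t, 0 <= s -> s <= t -> t <= 1 ->
     enorm (g t - g s) <= c * (t - s)) ->
  forall s t, enorm (g t - g s) <= c * circle_dist s t.
Proof.
move=> c0 pg lip.
have g10 : g 1 = g 0 by rewrite -(pg 0) add0r.
have H s t k : 0 <= s -> s <= 1 -> 0 <= t -> t <= 1 ->
    enorm (g t - g s) <= c * `|t - s + k%:~R|.
  move=> s0 s1 t0 t1; have [k0|k0|->] := ltgtP k 0.
  - have kR : k%:~R <= -1 :> R by rewrite -[-1]/((-1)%:~R) ler_int; lia.
    rewrite (le_trans (enorm_distD (g 1) _ _))//.
    have := lip t 1 t0 t1 (lexx _); rewrite enorm_distC.
    have := lip 0 s (lexx _) s0 s1; rewrite enorm_distC -{1}g10 => h1 h2.
    rewrite (le_trans (lerD h2 h1))// -mulrDr ler_wpM2l//.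
    by rewrite ler0_norm; lra.
  - have kR : 1 <= k%:~R :> R by rewrite -[1]/((1)%:~R) ler_int; lia.
    rewrite (le_trans (enorm_distD (g 1) _ _))//.
    have := lip s 1 s0 s1 (lexx _).
    have := lip 0 t (lexx _) t0 t1; rewrite -{1}g10 => h1 h2.
    rewrite (le_trans (lerD h1 h2))// -mulrDr ler_wpM2l//.
    by rewrite ger0_norm; lra.
  - rewrite addr0; have [st|/ltW ts] := leP s t.
      by rewrite ger0_norm ?subr_ge0// lip.
    by rewrite enorm_distC distrC ger0_norm ?subr_ge0// lip.
have {}H s t k : enorm (g t - g s) <= c * `|t - s + k%:~R|.
  pose r x := x - (Num.floor x)%:~R.
  have gr x : g x = g (r x) by rewrite /r -intrN periodicz.
  have /andP[s0 /ltW s1] := floor_fract01 s.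
  have /andP[t0 /ltW t1] := floor_fract01 t.
  rewrite (gr s) (gr t).
  rewrite (le_trans (H _ _ (Num.floor t - Num.floor s + k) s0 s1 t0 t1))//.
  rewrite ler_wpM2l// le_eqVlt; apply/orP; left; apply/eqP; congr `|_|.
  by rewrite intrD intrB /r; lra.
move=> s t; have [c00|cn0] := eqVneq c 0.
  by rewrite c00 mul0r; have := H s t 0; rewrite c00 mul0r.
have cp : 0 < c by rewrite lt_neqAle eq_sym cn0.
rewrite -ler_pdivrMl//; apply: le_circle_dist => k.
by rewrite ler_pdivrMl.
Qed.


Lemma enorm_lipschitz_continuous c g :
  (forall s t, enorm (g t - g s) <= c * `|t - s|) -> continuous g.
Proof.
move=> lip x; apply/cvgrPdist_le => e e0.
have [c0|c0] := leP c 0.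
  near=> y; rewrite distrC (le_trans (normr_le_enorm _))//.
  by rewrite (le_trans (lip x y))// (le_trans _ (ltW e0))// mulr_le0_ge0.
have ec0 : 0 < e / c by rewrite divr_gt0.
near=> y; rewrite distrC (le_trans (normr_le_enorm _))//.
rewrite (le_trans (lip x y))// -ler_pdivlMl// mulrC distrC.
by near: y; apply: filterS (nbhsx_ballx x _ ec0) => z; exact: ltW.
Unshelve. all: by end_near. Qed.

(** ** Lengths of inscribed polygonal lines *)

Definition chord_sum g (b a : R) (l : seq R) : R :=
  \sum_(0 <= i < size l) enorm (g (nth b (a :: l) i.+1) - g (nth b (a :: l) i)).

Lemma curve_lengthE g a b :
  curve_length g a b =
  ereal_sup [set (chord_sum g b a l)%:E | l in itv_partition a b].
Proof. by []. Qed.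

Lemma chord_sum_cons g b a x l :
  chord_sum g b a (x :: l) = enorm (g x - g a) + chord_sum g b x l.
Proof. by rewrite /chord_sum big_nat_recl. Qed.

Lemma chord_sum_rcons g b c a l : last a l = b ->
  chord_sum g c a (rcons l c) = chord_sum g b a l + enorm (g c - g b).
Proof.
elim: l a => [|x l IH] a /=.
  by move=> ->; rewrite chord_sum_cons /chord_sum !big_nil add0r addr0.
by move=> /IH H; rewrite !chord_sum_cons H addrA.
Qed.

Lemma chord_sum_le c g b a l : itv_partition a b l ->
  (forall x y, a <= x -> x <= y -> y <= b -> enorm (g y - g x) <= c * (y - x)) ->
  chord_sum g b a l <= c * (b - a).
Proof.
elim: l a => [|x l IH] a.
  by move=> /itv_partition_nil -> _; rewrite /chord_sum big_nil subrr mulr0.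
move=> abl lip; have xb := itv_partition_le (itv_partition_cons abl).
have ax : a < x by case: abl => /= /andP[].
rewrite chord_sum_cons (_ : b - a = (x - a) + (b - x)); last by lra.
rewrite mulrDr lerD ?lip ?(ltW ax)//.
apply: IH => [|y z xy yz zb]; first exact: itv_partition_cons abl.
by apply: lip => //; rewrite (le_trans (ltW ax)).
Qed.

Lemma curve_length_le c g a b :
  (forall x y, a <= x -> x <= y -> y <= b -> enorm (g y - g x) <= c * (y - x)) ->
  (curve_length g a b <= (c * (b - a))%:E)%E.
Proof.
move=> lip; rewrite curve_lengthE; apply: ge_ereal_sup => _ [l abl <-].
by rewrite lee_fin chord_sum_le.
Qed.

Lemma enorm_le_curve_length g a b : a <= b ->
  ((enorm (g b - g a))%:E <= curve_length g a b)%E.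
Proof.
rewrite le_eqVlt => /orP[/eqP ->|ab].
  rewrite subrr enorm0 curve_lengthE; apply: ereal_sup_ubound.
  by exists [::]; [split => //=|rewrite /chord_sum big_nil].
rewrite curve_lengthE; apply: ereal_sup_ubound.
exists [:: b]; first exact: itv_partition1.
by rewrite chord_sum_cons /chord_sum big_nil addr0.
Qed.

Lemma arc_length_lipschitz g s t : arc_length_parametrized g ->
  0 <= s -> s <= t -> t <= 1 -> enorm (g t - g s) <= t - s.
Proof.
move=> alg s0 st t1; rewrite -lee_fin -alg//.
exact: enorm_le_curve_length.
Qed.

Lemma arc_length_circle g s t : arc_length_parametrized g -> periodic g 1 ->
  enorm (g t - g s) <= circle_dist s t.
Proof.
move=> alg pg; rewrite -[leRHS]mul1r; apply: lipschitz_circle => //.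
by move=> x y x0 xy y1; rewrite mul1r arc_length_lipschitz.
Qed.

(** A lower bound for the speed: the inscribed polygonal lines of a subarc must
   reach its full length. *)
Lemma arc_length_speed_ge1 c g s t : arc_length_parametrized g ->
  0 <= s -> s < t -> t <= 1 ->
  (forall x y, s <= x -> x <= y -> y <= t -> enorm (g y - g x) <= c * (y - x)) ->
  1 <= c.
Proof.
move=> alg s0 st t1 lip; have := curve_length_le lip.
rewrite alg ?(ltW st)// lee_fin -ler_pdivrMr ?subr_gt0// divff//.
by rewrite gt_eqF ?subr_gt0.
Qed.

(** The polygonal line through s, t and the points of the subdivision between
   them has length t - s, and no polygonal line is longer. *)
Lemma arc_length_piecewise (n : nat) g : (0 < n)%N ->
  (forall x y, enorm (g y - g x) <= `|y - x|) ->
  (forall i x y, (i < n)%N -> i%:R / n%:R <= x -> x <= y ->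
     y <= i.+1%:R / n%:R -> enorm (g y - g x) = y - x) ->
  arc_length_parametrized g.
Proof.
move=> n0 lip loc s t s0 st t1; apply/eqP; rewrite eq_le; apply/andP; split.
  rewrite -[X in (_ <= X%:E)%E]mul1r; apply: curve_length_le => x y _ xy _.
  by rewrite mul1r -[leRHS]ger0_norm ?subr_ge0.
have nR : 0 < n%:R :> R by rewrite ltr0n.
have H m : (m <= n)%N -> forall t, s <= t -> t <= m%:R / n%:R ->
    exists2 l, itv_partition s t l & chord_sum g t s l = t - s.
  elim: m => [|m IH] mn u su um.
    have us : u = s by apply/eqP; rewrite eq_le su andbT (le_trans um)// mul0r.
    by exists [::]; [split => //=; rewrite us|rewrite us /chord_sum big_nil subrr].
  have [su'|us] := eqVneq s u.
    by exists [::]; [split => //=; apply/eqP|rewrite su' /chord_sum big_nil subrr].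
  have {us}su' : s < u by rewrite lt_neqAle us.
  have [ms|sm] := leP (m%:R / n%:R) s.
    exists [:: u]; first exact: itv_partition1.
    by rewrite chord_sum_cons /chord_sum big_nil addr0 (loc m).
  have [um'|mu] := leP u (m%:R / n%:R); first exact: IH (ltnW mn) _ su um'.
  have [l sl E] := IH (ltnW mn) (m%:R / n%:R) (ltW sm) (lexx _).
  have ls : last s l = m%:R / n%:R by case: sl => _ /eqP.
  exists (rcons l u).
    rewrite -cats1; apply: itv_partition_cat sl _; exact: itv_partition1.
  by rewrite (chord_sum_rcons _ _ ls) E (loc m)//; [lra|exact: ltW].
have [|l stl E] := H n (leqnn n) t st; first by rewrite divff ?gt_eqF.
rewrite -E curve_lengthE; apply: ereal_sup_ubound; by exists l.
Qed.

End Curves.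

(** * Equilateral polygons parametrized by arc length *)

Section Polygons.
Context {R : realType} {d : nat}.
Variables (n : nat) (p : R -> 'rV[R]_d).
Hypotheses (p_closed : simple_closed_curve p)
  (p_arc : arc_length_parametrized p).
Implicit Types (a b : nat -> R) (i j k : nat) (x y : R).

Lemma polygon_size_gt0 a : polygon_parameters n p a -> (0 < n)%N.
Proof.
case=> per _ _ _ _; rewrite lt0n; apply/eqP => n0.
by have := per 0%N; rewrite n0 => /eqP; rewrite eq_sym -subr_eq0 addrC addKr
  oner_eq0.
Qed.

Lemma polygon_parameters_mono a i j : polygon_parameters n p a ->
  (i <= j)%N -> a i <= a j.
Proof.
case=> _ inc _ _ _ ij; rewrite -(subnK ij); elim: (j - i)%N => [//|m IH].
by rewrite addSn (le_trans IH)// ltW.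
Qed.

Definition direction a i : 'rV[R]_d := (a i.+1 - a i)^-1 *: (p (a i.+1) - p (a i)).

Lemma polygon_affine a i x y : polygon_parameters n p a ->
  a i <= x -> x <= a i.+1 -> a i <= y -> y <= a i.+1 ->
  p y - p x = (y - x) *: direction a i.
Proof.
case=> _ inc _ _ aff ax xa ay ya.
have di : 0 < a i.+1 - a i by rewrite subr_gt0.
have H z : a i <= z -> z <= a i.+1 ->
    p z = p (a i) + (z - a i) *: direction a i.
  move=> az za; set l := (z - a i) / (a i.+1 - a i).
  have l0 : 0 <= l by rewrite divr_ge0 ?subr_ge0// ltW.
  have l1 : l <= 1 by rewrite ler_pdivrMr// mul1r lerD2r.
  have := aff i l l0 l1.
  have -> : (1 - l) * a i + l * a i.+1 = z.
    by rewrite /l; field; rewrite gt_eqF.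
  move=> ->; rewrite /direction scalerA -/l scalerBr scalerBl scale1r.
  by rewrite addrA addrAC -addrA addrCA addrC -!addrA.
rewrite (H y)// (H x)// opprD addrACA subrr add0r -scalerBl; congr (_ *: _).
by lra.
Qed.

(** On an edge the length of a chord is proportional to the arc, and the factor
   is 1 because of the parametrization by arc length. The edge is cut at the
   parameter 1, beyond which arc length is not specified. *)
Lemma direction_unit a i : equilateral_parameters n p a -> (i < n)%N ->
  enorm (direction a i) = 1.
Proof.
move=> [par _] ilt; have n0 := polygon_size_gt0 par.
have [_ inc a0 a1 _] := par.
have ai0 : 0 <= a i by rewrite (le_trans a0)// (polygon_parameters_mono par).
have ai1 : a i < 1.
  by rewrite (le_lt_trans _ a1)// (polygon_parameters_mono par)// -ltnS prednK.
pose m := Num.min 1 (a i.+1).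
have am : a i < m by rewrite lt_min ai1/=.
have m1 : m <= 1 by rewrite ge_min lexx.
have ma : m <= a i.+1 by rewrite ge_min lexx orbT.
apply/eqP; rewrite eq_le; apply/andP; split.
  have := arc_length_lipschitz p_arc ai0 (ltW am) m1.
  rewrite (polygon_affine (i := i) par) ?(ltW am) ?(ltW (inc i))//.
  by rewrite enormZ ger0_norm ?subr_ge0 ?(ltW am)// ger_pMr ?subr_gt0.
apply: (arc_length_speed_ge1 p_arc ai0 am m1) => x y ax xy ym.
rewrite (polygon_affine (i := i) par)//; last 3 first.
- by rewrite (le_trans xy)// (le_trans ym).
- exact: le_trans xy.
- exact: le_trans ym _.
by rewrite enormZ ger0_norm ?subr_ge0// mulrC.
Qed.

Lemma edge_lengthE a i : equilateral_parameters n p a -> (i < n)%N ->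
  edge_length p a i = a i.+1 - a i.
Proof.
move=> eqa ilt; have [par _] := eqa; have [_ inc _ _ _] := par.
rewrite /edge_length (polygon_affine (i := i) par) ?lexx ?(ltW (inc i))//.
by rewrite enormZ (direction_unit eqa ilt) mulr1 ger0_norm// subr_ge0 ltW.
Qed.

(** The edges have equal lengths, which add up to the length 1. *)
Lemma vertex_spacing a i : equilateral_parameters n p a -> (i <= n)%N ->
  a i = a 0%N + i%:R / n%:R.
Proof.
move=> eqa ilt; have [par eqe] := eqa; have [per inc _ _ _] := par.
have n0 := polygon_size_gt0 par; have nR : n%:R != 0 :> R by rewrite pnatr_eq0 -lt0n.
set e := edge_length p a 0.
have H m : (m <= n)%N -> a m = a 0%N + m%:R * e.
  elim: m => [|m IH] mn; first by rewrite mul0r addr0.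
  have := edge_lengthE eqa mn; rewrite (eqe m 0%N) -/e IH ?(ltnW mn)//.
  by rewrite -natr1; lra.
have ne : n%:R * e = 1.
  by have := H n (leqnn n); have := per 0%N; rewrite add0n => ->; lra.
by rewrite H//; congr (_ + _ * _); rewrite -[LHS](mulKf nR) ne mulr1.
Qed.

Lemma edge_length_inv a i : equilateral_parameters n p a ->
  edge_length p a i = n%:R^-1.
Proof.
move=> eqa; have [par eqe] := eqa; have n0 := polygon_size_gt0 par.
rewrite (eqe i 0%N) edge_lengthE// (vertex_spacing eqa n0) mul1r.
by rewrite addrC addKr.
Qed.

(** A closed polygon is not straight: otherwise it would not return to its
   starting point. *)
Lemma direction_nonconstant a : equilateral_parameters n p a ->
  ~ (forall i, (i < n)%N -> direction a i = direction a 0).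
Proof.
move=> eqa const; have [par _] := eqa; have [per inc _ _ _] := par.
have n0 := polygon_size_gt0 par.
have H m : (m <= n)%N -> p (a m) - p (a 0%N) = (a m - a 0%N) *: direction a 0.
  elim: m => [|m IH] mn; first by rewrite !subrr scale0r.
  rewrite -(subrKA (p (a m))) IH ?(ltnW mn)//.
  rewrite (polygon_affine (i := m) par) ?lexx ?(ltW (inc m))// const//.
  by rewrite -scalerDl subrKA.
have := H n (leqnn n); have := per 0%N; rewrite add0n => ->.
have [pp _ _] := p_closed; rewrite pp subrr addrC addKr scale1r => d0.
by have := direction_unit eqa n0; rewrite -d0 enorm0 => /eqP;
  rewrite eq_sym oner_eq0.
Qed.

Lemma polygon_corner a : equilateral_parameters n p a ->
  exists i, (i.+1 < n)%N /\ direction a i != direction a i.+1.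
Proof.
move=> eqa; apply: contrapT => nocorner; apply: (direction_nonconstant eqa).
elim=> [//|i IH] ilt; rewrite -IH ?(ltnW ilt)//; apply/esym/eqP.
by apply: contrapT => /negP ne; apply: nocorner; exists i.
Qed.

(** Both subdivisions have step 1 / n, so they interlace: a i < b i < a i.+1.
   The edge i of the second one then shares a segment with the edges i and i.+1
   of the first one, which thus have the same direction. *)
Let no_interlacing a b : equilateral_parameters n p a ->
  equilateral_parameters n p b -> a 0%N < b 0%N -> False.
Proof.
move=> eqa eqb ab; have [para _] := eqa; have [parb _] := eqb.
have [pera inca a0 _ _] := para; have [perb incb b0 b1 _] := parb.
have n0 := polygon_size_gt0 para; have nR : 0 < n%:R :> R by rewrite ltr0n.
have b0n : b 0%N < n%:R^-1.
  move: b1; rewrite (vertex_spacing (i := n.-1) eqb) ?leq_pred//.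
  have -> : n.-1%:R = n%:R - 1 :> R by rewrite -subn1 natrB.
  by rewrite mulrBl divff ?gt_eqF// mul1r; lra.
have sp i : (i < n)%N -> a i < b i /\ b i < a i.+1.
  move=> ilt; rewrite (vertex_spacing eqa (ltnW ilt)) (vertex_spacing eqa ilt).
  by rewrite (vertex_spacing eqb (ltnW ilt)) -natr1 mulrDl mul1r; lra.
apply: (direction_nonconstant eqa).
elim=> [//|i IH] ilt; have ilt' := ltnW ilt; rewrite -IH//.
have [ab1 ba1] := sp i ilt'; have [ab2 ba2] := sp i.+1 ilt.
have scaleI (x : R) (u v : 'rV[R]_d) : 0 < x -> x *: u = x *: v -> u = v.
  by move=> x0; apply: scalerI; rewrite gt_eqF.
transitivity (direction b i).
  apply: (@scaleI (b i.+1 - a i.+1)); first by rewrite subr_gt0.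
  rewrite -(polygon_affine (i := i) parb) ?lexx ?(ltW ba1) ?(ltW ab2) ?(ltW (incb i))//.
  by rewrite -(polygon_affine (i := i.+1) para) ?lexx ?(ltW ba2) ?(ltW ab2) ?(ltW (inca _)).
apply: (@scaleI (a i.+1 - b i)); first by rewrite subr_gt0.
rewrite -(polygon_affine (i := i) parb) ?lexx ?(ltW ba1) ?(ltW ab2) ?(ltW (incb i))//.
by rewrite -(polygon_affine (i := i) para) ?lexx ?(ltW ba1) ?(ltW ab1) ?(ltW (inca _)).
Qed.

(** Subdivisions with different starting points interlace, and would make the
   polygon straight. Hence the vertices, and with them the discrete energy, are
   determined by the curve. *)
Lemma vertex_parameters_unique a b i : equilateral_parameters n p a ->
  equilateral_parameters n p b -> (i <= n)%N -> a i = b i.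
Proof.
move=> eqa eqb ilt; rewrite (vertex_spacing eqa ilt) (vertex_spacing eqb ilt).
congr (_ + _); have [ab|ba|//] := ltgtP (a 0%N) (b 0%N).
  by have := no_interlacing eqa eqb ab.
by have := no_interlacing eqb eqa ba.
Qed.

Lemma vertex_parametersP a : equilateral_parameters n p a ->
  equilateral_parameters n p (vertex_parameters n p).
Proof. by move=> eqa; apply: getPex; exists a. Qed.

End Polygons.

Section DiscreteEnergy.
Context {R : realType} {d : nat}.
Implicit Types (p : R -> 'rV[R]_d) (K : set (R -> 'rV[R]_d)) (a : nat -> R).

Lemma discrete_energyE K alpha q n p a : polygons K n p ->
  equilateral_parameters n p a ->
  discrete_energy K alpha q n p = (alpha^-1 * \sum_(i < n) \sum_(j < n | j != i)
    energy_density alpha q p (a i) (a j) * n%:R^-1 * n%:R^-1)%:E.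
Proof.
move=> Kp eqa; rewrite /discrete_energy mem_set//.
have [[pc pa _] _] := Kp; have eqv := vertex_parametersP eqa.
congr (_ * _)%:E; apply: eq_bigr => i _; apply: eq_bigr => j _.
rewrite !(edge_length_inv pa _ eqv).
by rewrite !(vertex_parameters_unique pc pa eqv eqa (ltnW (ltn_ord _))).
Qed.

Lemma discrete_energy_pinfty K alpha q n p : ~ polygons K n p ->
  discrete_energy K alpha q n p = +oo%E.
Proof. by move=> Kp; rewrite /discrete_energy memNset. Qed.

End DiscreteEnergy.

(** * Double integrals over the unit square *)

Section Square.
Context {R : realType}.
Local Notation mu := (@lebesgue_measure R).
Local Notation mu2 := (mu \x mu)%E.
Implicit Types (f : R * R -> R) (t : nat -> R) (n : nat) (c : nat -> nat -> R).

Definition unit_itv (b0 b1 : bool) : set R :=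
  [set` Interval (BSide b0 0) (BSide b1 1)].

(** The unit square, with or without its sides; the integrals agree, and the
   convenient choice of sides depends on the grids at hand. *)
Definition square b0 b1 : set (R * R) := unit_itv b0 b1 `*` unit_itv b0 b1.

Lemma measurable_square b0 b1 : measurable (square b0 b1).
Proof. by apply: measurableX; exact: measurable_itv. Qed.

Let integral_unit_itv b0 b1 (F : R -> \bar R) : measurable_fun setT F ->
  (\int[mu]_(x in unit_itv b0 b1) F x = \int[mu]_(x in `[0%R, 1%R]) F x)%E.
Proof.
move=> mF; have mF' : measurable_fun (`]0%R, 1%R[%classic : set R) F by exact: measurable_funTS.
have E e0 e1 := @integral_itv_bndoo R 0 1 F e0 e1 mF'.
by rewrite /unit_itv (E b0 b1) (E true false).
Qed.

(** Tonelli, and the sides of the square are null sets. *)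
Lemma integral_square f b0 b1 : measurable_fun setT f ->
  (forall z, 0 <= f z) ->
  (\int[mu]_(t in `[0%R, 1%R]) \int[mu]_(s in `[0%R, 1%R]) (f (t, s))%:E =
   \int[mu2]_(z in square b0 b1) (f z)%:E)%E.
Proof.
move=> mf f0; pose I := unit_itv b0 b1.
have mI : measurable I by exact: measurable_itv.
rewrite [RHS]integral_mkcond fubini_tonelli1; last 2 first.
- apply/(measurable_restrictT _ (measurable_square b0 b1)).
  by apply: measurable_funTS; exact/measurable_EFinP.
- by apply: erestrict_ge0 => z sz; rewrite lee_fin.
transitivity (\int[mu]_(x in I) \int[mu]_(y in I) (f (x, y))%:E)%E; last first.
  rewrite integral_mkcond; apply: eq_integral => x _; rewrite patchE /fubini_F/=.
  case: ifPn => xI.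
    rewrite integral_mkcond; apply: eq_integral => y _; rewrite !patchE.
    by rewrite /square in_setX/= xI.
  rewrite integral0_eq// => y _.
  by rewrite patchE /square in_setX/= (negbTE xI).
have mfx x : measurable_fun setT (fun y => (f (x, y))%:E).
  apply/measurable_EFinP.
  exact: (measurableT_comp mf (pair1_measurable x)).
have inner x : (\int[mu]_(y in `[0%R, 1%R]) (f (x, y))%:E =
    \int[mu]_(y in I) (f (x, y))%:E)%E.
  by rewrite /I integral_unit_itv.
under eq_integral do rewrite inner.
have mF : measurable_fun setT (fun x => \int[mu]_(y in I) (f (x, y))%:E)%E.
  have mTI : measurable ([set: R] `*` I) by exact: measurableX.
  have mg : measurable_fun setT ((EFin \o f) \_ ([set: R] `*` I)).
    apply/(measurable_restrictT _ mTI).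
    by apply: measurable_funTS; exact/measurable_EFinP.
  have := measurable_fun_fubini_tonelli_F (m2 := mu) _ mg _.
  rewrite (_ : fubini_F _ _ = fun x => \int[mu]_(y in I) (f (x, y))%:E)%E.
    by apply; apply: erestrict_ge0 => z sz; rewrite lee_fin.
  apply/funext => x; rewrite /fubini_F [RHS]integral_mkcond.
  by apply: eq_integral => y _; rewrite !patchE in_setX/= in_setT.
by rewrite /I integral_unit_itv.
Qed.

(** ** Step functions on a grid *)

Definition cell t i : set R := `[t i, t i.+1[%classic.

Definition step n t c (z : R * R) : R :=
  \sum_(i < n) \sum_(j < n) c i j * \1_(cell t i `*` cell t j) z.

Lemma measurable_cell2 t i j : measurable (cell t i `*` cell t j).
Proof. by apply: measurableX; exact: measurable_itv. Qed.

Lemma measurable_step n t c : measurable_fun setT (step n t c).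
Proof.
apply: measurable_sum => i; apply: measurable_sum => j.
by apply: measurable_funM => //; apply: measurable_indic; exact: measurable_cell2.
Qed.

Lemma cell_unique t i j x : (forall i j, (i <= j)%N -> t i <= t j) ->
  cell t i x -> cell t j x -> i = j.
Proof.
move=> mono; rewrite /cell /= !in_itv/= => /andP[i1 i2] /andP[j1 j2].
apply/eqP; rewrite eqn_leq; apply/andP; split; rewrite leqNgt; apply/negP.
  by move=> /mono; rewrite leNgt (le_lt_trans i1).
by move=> /mono; rewrite leNgt (le_lt_trans j1).
Qed.

Lemma stepE n t c i j z : (forall i j, (i <= j)%N -> t i <= t j) ->
  (i < n)%N -> (j < n)%N -> cell t i z.1 -> cell t j z.2 ->
  step n t c z = c i j.
Proof.
move=> mono lti ltj zi zj; rewrite /step (bigD1 (Ordinal lti))//=.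
rewrite (bigD1 (Ordinal ltj))//= indicE mem_set//= mulr1 !big1 ?addr0//.
  move=> k; rewrite -val_eqE/= => ki; rewrite big1// => l _.
  rewrite indicE memNset ?mulr0// => -[/= zk _].
  by move: ki; rewrite (cell_unique mono zk zi) eqxx.
move=> k; rewrite -val_eqE/= => ki.
rewrite indicE memNset ?mulr0// => -[/= _ zk].
by move: ki; rewrite (cell_unique mono zk zj) eqxx.
Qed.

Lemma cell_exists t n x : t 0%N <= x -> x < t n ->
  exists2 i, (i < n)%N & cell t i x.
Proof.
move=> x0; elim: n => [|n IH] xn; first by move: xn; rewrite ltNge x0.
have [/IH[i lti xi]|nx] := ltP x (t n); first by exists i => //; exact: ltnW.
by exists n => //; rewrite /cell /= in_itv/= nx.
Qed.

Lemma step_cases n t c z :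
  (exists i j, [/\ (i < n)%N, (j < n)%N, cell t i z.1 & cell t j z.2]) \/
  step n t c z = 0.
Proof.
have [h|h] := pselect (exists i j, [/\ (i < n)%N, (j < n)%N, cell t i z.1 &
  cell t j z.2]); [by left|right].
rewrite /step big1// => i _; rewrite big1// => j _.
rewrite indicE memNset ?mulr0// => -[zi zj]; apply: h.
by exists i, j; split.
Qed.

Lemma step_ge0 n t c z : (forall i j, 0 <= c i j) -> 0 <= step n t c z.
Proof.
move=> c0; apply: sumr_ge0 => i _; apply: sumr_ge0 => j _.
by rewrite mulr_ge0.
Qed.

Lemma integral_step n t c (D : set (R * R)) : measurable D ->
  (forall i, t i <= t i.+1) -> (forall i j, 0 <= c i j) ->
  (forall i j, (i < n)%N -> (j < n)%N -> cell t i `*` cell t j `<=` D) ->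
  (\int[mu2]_(z in D) (step n t c z)%:E)%E =
  (\sum_(i < n) \sum_(j < n) c i j * (t i.+1 - t i) * (t j.+1 - t j))%:E.
Proof.
move=> mD tm c0 sub.
under eq_integral do rewrite /step -sumEFin.
rewrite ge0_integral_sum//; last 2 first.
- move=> i; apply/measurable_EFinP; apply: measurable_sum => j.
  by apply: measurable_funM => //; apply: measurable_indic; exact: measurable_cell2.
- by move=> i z _; rewrite lee_fin; apply: sumr_ge0 => j _; rewrite mulr_ge0.
rewrite -sumEFin; apply: eq_bigr => i _.
under eq_integral do rewrite -sumEFin.
rewrite ge0_integral_sum//; last 2 first.
- move=> j; apply/measurable_EFinP.
  by apply: measurable_funM => //; apply: measurable_indic; exact: measurable_cell2.
- by move=> j z _; rewrite lee_fin mulr_ge0.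
rewrite -sumEFin; apply: eq_bigr => j _.
under eq_integral do rewrite EFinM.
rewrite ge0_integralZl_EFin//; last first.
  by apply/measurable_EFinP; apply: measurable_indic; exact: measurable_cell2.
rewrite integral_indic//; last exact: measurable_cell2.
rewrite setIidl; last exact: sub.
have E : (mu2 (cell t i `*` cell t j) = mu (cell t i) * mu (cell t j))%E.
  by apply: product_measure1E; exact: measurable_itv.
have len k : mu (cell t k) = (t k.+1 - t k)%:E.
  rewrite /cell lebesgue_measure_itv/= lte_fin; case: ifPn => //.
  rewrite -leNgt => tk; congr EFin; apply/esym/eqP.
  by rewrite subr_eq0 eq_le tk tm.
by rewrite -mulrA !EFinM -!len; congr (_ * _)%E; exact: E.
Qed.

End Square.

(** * The energy as a double integral *)

Section EnergyIntegral.
Context {R : realType} {d : nat}.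
Local Notation mu := (@lebesgue_measure R).
Local Notation mu2 := (mu \x mu)%E.
Implicit Types g : R -> 'rV[R]_d.

Lemma circle_dist_continuous : continuous (@circle_dist R 0).
Proof.
move=> x; apply/cvgrPdist_le => e e0; near=> y.
have : `|x - y| <= e.
  by near: y; apply: filterS (nbhsx_ballx x _ e0) => z; exact: ltW.
apply: le_trans; rewrite ler_norml.
have := circle_dist_triangle 0 x 0 y; have := circle_dist_triangle 0 y 0 x.
by rewrite subrr normr0 !addr0 (distrC y x); lra.
Unshelve. all: by end_near. Qed.

Lemma circle_dist_sub (s t : R) : circle_dist s t = circle_dist 0 (t - s).
Proof. by rewrite /circle_dist subr0. Qed.

Lemma continuous_coord g i : continuous g -> continuous (fun x => g x ord0 i).
Proof.
move=> cg x; have := @coord_continuous R 1 d ord0 i (g x).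
exact: (continuous_comp (cg x)).
Qed.

Lemma measurable_chord g : continuous g ->
  measurable_fun setT (fun z : R * R => enorm (g z.1 - g z.2)).
Proof.
move=> cg.
apply: (@measurableT_comp _ _ _ _ _ _ (@Num.sqrt R)).
  by apply: continuous_measurable_fun; exact: sqrt_continuous.
apply: measurable_sum => i; apply: measurable_funX.
rewrite (_ : (fun _ => _) =
    (fun z => g z.1 ord0 i) \- (fun z => g z.2 ord0 i)); last first.
  by apply/funext => z /=; rewrite !mxE.
have mgi := continuous_measurable_fun (@continuous_coord g i cg).
apply: measurable_funB.
  exact: (measurableT_comp mgi measurable_fst).
exact: (measurableT_comp mgi measurable_snd).
Qed.

Lemma measurable_energy_density alpha q g : continuous g ->
  measurable_fun setT (fun z : R * R => energy_density alpha q g z.2 z.1).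
Proof.
move=> cg; apply: (@measurableT_comp _ _ _ _ _ _ (fun x : R => x `^ q)).
  exact: measurable_powR.
apply: measurable_funB.
  under eq_fun do rewrite -powRN.
  apply: (@measurableT_comp _ _ _ _ _ _ (fun x : R => x `^ (- alpha))).
    exact: measurable_powR.
  exact: measurable_chord.
under eq_fun do rewrite -powRN circle_dist_sub.
apply: (@measurableT_comp _ _ _ _ _ _ (fun x : R => x `^ (- alpha))).
  exact: measurable_powR.
apply: (@measurableT_comp _ _ _ _ _ _ (@circle_dist R 0)).
  by apply: continuous_measurable_fun; exact: circle_dist_continuous.
exact: (measurable_funB measurable_fst measurable_snd).
Qed.

(** As an integral over the plane the energy is accessible to the convergence
   theorems, and can be compared with the integrals of step functions. *)
Lemma energyE b0 b1 alpha q g : continuous g -> energy alpha q g =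
  (alpha^-1%:E * \int[mu2]_(z in square b0 b1)
     (energy_density alpha q g z.2 z.1)%:E)%E.
Proof.
move=> cg; rewrite /energy -(@integral_square R
  (fun z => energy_density alpha q g z.2 z.1))//.
- exact: measurable_energy_density.
- by move=> z; exact: powR_ge0.
Qed.

End EnergyIntegral.

(** * The lower bound *)

Section LowerUpperLimits.
Context {R : realType}.
Implicit Types u v : (\bar R)^nat.
Local Open Scope ereal_scope.

Lemma le_limn_einf u v : (forall n, u n <= v n) -> limn_einf u <= limn_einf v.
Proof.
move=> uv; rewrite !limn_einf_lim; apply: lee_lim; [exact: is_cvg_einfs..|].
apply: nearW => n; apply: le_ereal_inf_tmp => _ [m /= nm <-].
by rewrite (le_trans _ (uv m))//; apply: ereal_inf_lbound; exists m.
Qed.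

Lemma limn_esup_le_near u v l : (\forall n \near \oo, u n <= v n) ->
  v @ \oo --> l -> limn_esup u <= l.
Proof.
move=> uv /cvg_limn_einf_sup[_ <-].
rewrite /limn_esup !limf_esupE; apply: le_ereal_inf_tmp => _ [V FV <-].
apply: (@le_trans _ _ (ereal_sup (u @` (V `&` [set n | u n <= v n])))).
  by apply: ereal_inf_lbound; exists (V `&` [set n | u n <= v n]) => //;
    exact: filterI.
apply: ge_ereal_sup => _ [n [Vn uvn] <-]; rewrite (le_trans uvn)//.
by apply: ereal_sup_ubound; exists n.
Qed.

End LowerUpperLimits.

Lemma near_inv_lt {R : realType} (e : R) : 0 < e ->
  \forall n \near \oo, n%:R^-1 < e.
Proof.
move=> e0; exists (Num.truncn e^-1).+1 => // n /= Nn.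
have n0 : 0 < n%:R :> R by rewrite ltr0n (leq_trans _ Nn).
rewrite invf_plt ?posrE// (lt_le_trans (truncnS_gt _))// ler_nat.
exact: leq_trans Nn.
Qed.

Section LowerBound.
Context {R : realType} {d : nat}.
Local Notation mu := (@lebesgue_measure R).
Local Notation mu2 := (mu \x mu)%E.
Implicit Types (g : R -> 'rV[R]_d).
Variables (alpha q : R).
Hypotheses (alpha_gt0 : 0 < alpha) (q_ge1 : 1 <= q).

Lemma energy_densityC g s t :
  energy_density alpha q g s t = energy_density alpha q g t s.
Proof. by rewrite /energy_density enorm_distC circle_distC. Qed.

Lemma energy_density_diag g s : energy_density alpha q g s s = 0.
Proof.
rewrite /energy_density subrr enorm0 (_ : circle_dist s s = 0).
  by rewrite subrr powR0// gt_eqF// (lt_le_trans _ q_ge1).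
apply/eqP; rewrite eq_le circle_dist_ge0 andbT.
by rewrite (le_trans (circle_dist_le_norm _ _))// subrr normr0.
Qed.

Lemma energy_density_ge0 g s t : 0 <= energy_density alpha q g s t.
Proof. exact: powR_ge0. Qed.

(** The value of the step function on the cell (i, j) is the density at the
   lower left corner; the cells on the diagonal contribute nothing. *)
Lemma discrete_energy_step (K : set (R -> 'rV[R]_d)) n p a : polygons K n p ->
  equilateral_parameters n p a ->
  discrete_energy K alpha q n p = (\int[mu2]_z (alpha^-1 *
    step n a (fun i j => energy_density alpha q p (a i) (a j)) z)%:E)%E.
Proof.
move=> Kp eqa; have [[pc pa _] _] := Kp; have [par _] := eqa.
under eq_integral do rewrite EFinM.
rewrite ge0_integralZl_EFin//; last 3 first.
- by move=> z _; rewrite lee_fin step_ge0// => i j; exact: energy_density_ge0.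
- by apply/measurable_EFinP; exact: measurable_step.
- by rewrite invr_ge0 ltW.
rewrite (discrete_energyE alpha q Kp eqa) integral_step//; last 2 first.
- by move=> i; case: par => _ /(_ i)/ltW.
- by move=> i j; exact: energy_density_ge0.
rewrite -EFinM; congr (_ * _)%:E; apply: eq_bigr => i _.
rewrite [RHS](bigD1 i)//= energy_density_diag !mul0r add0r.
apply: eq_bigr => j _; rewrite -!(edge_lengthE pa eqa (ltn_ord _)).
by rewrite !(edge_length_inv pa _ eqa).
Qed.

Variables (K : set (R -> 'rV[R]_d)) (x : R -> 'rV[R]_d) (x_ : nat -> R -> 'rV[R]_d).
Hypotheses (x_closed : simple_closed_curve x) (x_arc : arc_length_parametrized x).
Hypothesis x_cvg : forall t, 0 < t < 1 -> enorm (x_ n t - x t) @[n --> \oo] --> (0 : R).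

Let e (z : R * R) := energy_density alpha q x z.2 z.1.

(** If x_ n is not a polygon with n edges, then its discrete energy is infinite,
   and any finite nonnegative integrand may stand in for it; the limit e itself
   keeps the pointwise convergence. *)
Let f n (z : R * R) := if `[< polygons K n (x_ n) >] then
  let a := vertex_parameters n (x_ n) in
  step n a (fun i j => energy_density alpha q (x_ n) (a i) (a j)) z else e z.

(** In both cases of the definition, f n (t, s) is the density of some curve y.1,
   which is x_ n or x, at two parameters near t and s. *)
Let f_sample n t s : 0 < t < 1 -> 0 < s < 1 -> n%:R^-1 < t -> n%:R^-1 < s ->
  exists y : (R -> 'rV[R]_d) * (R * R),
  [/\ (y.1 = x_ n /\ arc_length_parametrized y.1 /\ periodic y.1 1) \/ y.1 = x,
      `|y.2.1 - t| <= n%:R^-1, `|y.2.2 - s| <= n%:R^-1,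
      (t = s -> y.2.1 = y.2.2) &
      f n (t, s) = energy_density alpha q y.1 y.2.1 y.2.2].
Proof.
move=> /andP[t0 t1] /andP[s0 s1] nt ns; rewrite /f; case: asboolP => [Pn|nPn]; last first.
  exists (x, (t, s)); rewrite !subrr normr0 /e/= energy_densityC; split=> //; by right.
have [[pc pa _] [a0 eqa0]] := Pn; have := vertex_parametersP eqa0.
move=> {a0 eqa0}; set a := vertex_parameters _ _ => eqa; have [par _] := eqa.
have n0 := polygon_size_gt0 par; have [per inc a0 a1 _] := par.
have a0n : a 0%N < n%:R^-1.
  move: a1; rewrite (vertex_spacing (i := n.-1) pa eqa) ?leq_pred//.
  have -> : n.-1%:R = n%:R - 1 :> R by rewrite -subn1 natrB.
  by rewrite mulrBl divff ?pnatr_eq0 -?lt0n// mul1r; lra.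
have H u : 0 < u < 1 -> n%:R^-1 < u ->
    exists2 i, (i < n)%N & cell a i u.
  move=> /andP[u0 u1] nu; apply: cell_exists.
    by rewrite (le_trans (ltW a0n)) ?ltW.
  by have := per 0%N; rewrite add0n => ->; lra.
have near i u : (i < n)%N -> cell a i u -> `|a i - u| <= n%:R^-1.
  move=> lti; rewrite /cell /= in_itv/= => /andP[au ua].
  rewrite distrC ger0_norm ?subr_ge0// lerBlDr.
  have := edge_length_inv pa i eqa; rewrite (edge_lengthE pa eqa lti) => <-.
  by rewrite subrK ltW.
have mono i j : (i <= j)%N -> a i <= a j.
  exact: polygon_parameters_mono par.
have [i lti ti] : exists2 i, (i < n)%N & cell a i t by apply: H => //; rewrite t0.
have [j ltj sj] : exists2 j, (j < n)%N & cell a j s by apply: H => //; rewrite s0.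
exists (x_ n, (a i, a j)); split => /=; [|exact: near|exact: near| |].
- by left; split => //; split => //; case: pc.
- by move=> ts; rewrite ts in ti; rewrite (cell_unique mono ti sj).
- exact: stepE.
Qed.

(** Off the diagonal the chords and the arcs at the sampling parameters tend to
   those of x at s and t, and the density is a continuous function of both. On the
   diagonal the sampling parameters coincide. *)
Let f_cvg z : square false true z -> f n z @[n --> \oo] --> e z.
Proof.
case: z => t s [/=]; rewrite /unit_itv/= !in_itv/= => t01 s01.
have [t0 t1] := andP t01; have [s0 s1] := andP s01.
have [px _ xinj] := x_closed.
pose P n (y : (R -> 'rV[R]_d) * (R * R)) :=
  [/\ (y.1 = x_ n /\ arc_length_parametrized y.1 /\ periodic y.1 1) \/ y.1 = x,
      `|y.2.1 - t| <= n%:R^-1, `|y.2.2 - s| <= n%:R^-1,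
      (t = s -> y.2.1 = y.2.2) &
      f n (t, s) = energy_density alpha q y.1 y.2.1 y.2.2].
have /choice[y Py] n : exists y, n%:R^-1 < t -> n%:R^-1 < s -> P n y.
  have [nt|nt] := ltP (n%:R^-1) t; last by exists (x, (t, s)).
  have [ns|ns] := ltP (n%:R^-1) s; last by exists (x, (t, s)).
  by have [y Py] := f_sample t01 s01 nt ns; exists y.
have {}Py : \forall n \near \oo, P n (y n).
  by near=> n; apply: Py; near: n; exact: near_inv_lt.
have -> : e (t, s) = energy_density alpha q x t s by rewrite energy_densityC.
have H : f n (t, s) @[n --> \oo] --> energy_density alpha q x t s <->
    energy_density alpha q (y n).1 (y n).2.1 (y n).2.2 @[n --> \oo] -->
    energy_density alpha q x t s.
  by split; apply: cvg_trans; apply: near_eq_cvg; near=> n;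
    (have [_ _ _ _ //] : P n (y n)); near: n.
apply/H => {H}; have [ts|ts] := eqVneq t s.
  rewrite ts energy_density_diag; apply: cvg_near_cst.
  near=> n; have [_ _ _ /(_ ts) -> _] : P n (y n) by near: n.
  exact: energy_density_diag.
have xts : x t != x s.
  apply: contra_neq ts; apply: xinj; rewrite inE/= in_itv/=.
    by rewrite (ltW t0).
  by rewrite (ltW s0).
have lipx u v := arc_length_circle u v x_arc px.
have lipy : \forall n \near \oo,
    forall u v, enorm ((y n).1 v - (y n).1 u) <= circle_dist u v.
  near=> n; move=> u v.
  have [[[_ [ay py]]|->] _ _ _ _] : P n (y n) by near: n.
    exact: arc_length_circle.
  exact: lipx.
(* The sampled curve at the sampling points converges to the limit curve. *)
have pt u (A : nat -> R) : 0 < u < 1 ->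
    (\forall n \near \oo, `|A n - u| <= n%:R^-1) ->
    forall eps, 0 < eps -> \forall n \near \oo,
      `|A n - u| <= eps /\ enorm ((y n).1 (A n) - x u) <= eps.
  move=> u01 Au eps eps0; have eps2 : 0 < eps / 2 by rewrite divr_gt0.
  near=> n.
  have n2 : n%:R^-1 <= eps / 2 by near: n; apply: filterS (near_inv_lt eps2) => m /ltW.
  have An : `|A n - u| <= n%:R^-1 by near: n.
  split; first by lra.
  rewrite (le_trans (enorm_distD ((y n).1 u) _ _))// (splitr eps) lerD//.
    have ly : forall u v, enorm ((y n).1 v - (y n).1 u) <= circle_dist u v by near: n.
    rewrite (le_trans (ly _ _))// (le_trans (circle_dist_le_norm _ _))//.
    exact: le_trans An n2.
  have [[[-> _]|->] _ _ _ _] : P n (y n) by near: n.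
    near: n; have /cvgrPdist_le /(_ _ eps2) := x_cvg u01.
    by apply: filterS => m; rewrite sub0r normrN ger0_norm ?enorm_ge0.
  by rewrite subrr enorm0 ltW.
have ptA : forall eps, 0 < eps -> \forall n \near \oo,
    `|(y n).2.1 - t| <= eps /\ enorm ((y n).1 (y n).2.1 - x t) <= eps.
  by apply: pt => //; apply: filterS Py => n [].
have ptB : forall eps, 0 < eps -> \forall n \near \oo,
    `|(y n).2.2 - s| <= eps /\ enorm ((y n).1 (y n).2.2 - x s) <= eps.
  by apply: pt => //; apply: filterS Py => n [].
have cvgc : enorm ((y n).1 (y n).2.2 - (y n).1 (y n).2.1) @[n --> \oo] -->
    enorm (x s - x t).
  apply/cvgrPdist_le => eps eps0; have eps2 : 0 < eps / 2 by rewrite divr_gt0.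
  near=> n.
  have [_ hA] : `|(y n).2.1 - t| <= eps / 2 /\
    enorm ((y n).1 (y n).2.1 - x t) <= eps / 2 by near: n; exact: ptA.
  have [_ hB] : `|(y n).2.2 - s| <= eps / 2 /\
    enorm ((y n).1 (y n).2.2 - x s) <= eps / 2 by near: n; exact: ptB.
  rewrite (le_trans (enorm_sub_abs _ _))//.
  rewrite (_ : _ - _ = (x s - (y n).1 (y n).2.2) + ((y n).1 (y n).2.1 - x t)).
    rewrite (le_trans (enormD _ _))// (splitr eps) lerD//.
    by rewrite enorm_distC.
  by apply/rowP => i; rewrite !mxE; lra.
have cvgl : circle_dist (y n).2.1 (y n).2.2 @[n --> \oo] --> circle_dist t s.
  apply/cvgrPdist_le => eps eps0; have eps2 : 0 < eps / 2 by rewrite divr_gt0.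
  near=> n.
  have [hA _] : `|(y n).2.1 - t| <= eps / 2 /\
    enorm ((y n).1 (y n).2.1 - x t) <= eps / 2 by near: n; exact: ptA.
  have [hB _] : `|(y n).2.2 - s| <= eps / 2 /\
    enorm ((y n).1 (y n).2.2 - x s) <= eps / 2 by near: n; exact: ptB.
  have h1 := circle_dist_triangle t s (y n).2.1 (y n).2.2.
  have h2 := circle_dist_triangle (y n).2.1 (y n).2.2 t s.
  by rewrite ler_norml; move: h1 h2 hA hB; rewrite (distrC t) (distrC s); lra.
have c0 : 0 < enorm (x s - x t) by rewrite enorm_gt0// subr_eq0 eq_sym.
apply: (cvg_kernel alpha_gt0 q_ge1 _ c0 _ _ cvgc cvgl); first exact: lipx.
near=> n; apply/andP; split.
  near: n; have /cvgrPdist_lt /(_ _ c0) := cvgc.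
  by apply: filterS => n; rewrite ltr_norml; lra.
suff H : forall u v, enorm ((y n).1 v - (y n).1 u) <= circle_dist u v by [].
by near: n.
Unshelve. all: by end_near. Qed.

(** Fatou's lemma for the step functions f n. The sides of the
   square are left out, because a grid starts at a vertex parameter between 0
   and 1 / n, and covers a given point only if that point is positive and n is
   large. *)
Lemma liminf_energy : (energy alpha q x <=
  limn_einf (fun n => discrete_energy K alpha q n (x_ n)))%E.
Proof.
have [px cx _] := x_closed.
pose F n z := (alpha^-1 * f n z)%:E.
have me : measurable_fun setT e by exact: measurable_energy_density.
have mf n : measurable_fun setT (f n).
  by rewrite /f; case: asboolP => _ //; exact: measurable_step.
have mF n D : measurable_fun D (F n).
  apply: measurable_funTS; apply/measurable_EFinP.
  exact: measurable_funM.
have f0 n z : 0 <= f n z.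
  rewrite /f; case: asboolP => _; last exact: energy_density_ge0.
  by apply: step_ge0 => i j; exact: energy_density_ge0.
have F0 n z : (0 <= F n z)%E.
  by rewrite lee_fin mulr_ge0// invr_ge0 ltW.
have mO := @measurable_square R false true.
have -> : energy alpha q x =
    (\int[mu2]_(z in square false true) limn_einf (F^~ z))%E.
  rewrite (energyE false true)// -ge0_integralZl_EFin//; last 3 first.
  - by move=> z _; rewrite lee_fin energy_density_ge0.
  - by apply: measurable_funTS; exact/measurable_EFinP.
  - by rewrite invr_ge0 ltW.
  apply: eq_integral => z; rewrite inE => Oz; apply/esym.
  apply: (cvg_limn_einf_sup _).1; rewrite -EFinM.
  apply: cvg_EFin; first by apply: nearW.
  apply: cvgMr; exact: f_cvg.
rewrite (le_trans (fatou mu2 mO (fun n => mF n _) (fun n z _ => F0 n z)))//.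
apply: le_limn_einf => n.
have [Pn|nPn] := pselect (polygons K n (x_ n)); last first.
  by rewrite discrete_energy_pinfty// leey.
have [_ [a0 /vertex_parametersP eqa]] := Pn.
rewrite (discrete_energy_step Pn eqa).
rewrite /F /f asboolT//.
apply: ge0_subset_integral => //.
  apply/measurable_EFinP; apply: measurable_funM => //; exact: measurable_step.
by move=> z _; have := F0 n z; rewrite /F /f asboolT.
Qed.

End LowerBound.

Section PointwiseLimit.
Context {R : realType} {d : nat}.
Local Notation mu := (@lebesgue_measure R).
Implicit Types u : R -> 'rV[R]_d.

Lemma continuous_enorm u : continuous u -> continuous (fun t => enorm (u t)).
Proof.
move=> cu x; apply/cvgrPdist_le => e e0.
have e1 : 0 < e / d.+1%:R by rewrite divr_gt0.
have /cvgrPdist_le /(_ _ e1) := cu x; apply: filterS => y xy.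
rewrite (le_trans (enorm_sub_abs _ _))// (le_trans (enorm_le_normr _))//.
rewrite (@le_trans _ _ (d.+1%:R * `|u x - u y|))//.
  by rewrite ler_wpM2r// ler_nat.
by rewrite mulrC -ler_pdivlMr// ltr0n.
Qed.

Lemma measurable_enorm u D : continuous u -> measurable_fun D (fun t => enorm (u t)).
Proof.
move=> cu; apply: measurable_funTS; apply: continuous_measurable_fun.
exact: continuous_enorm.
Qed.

(** If u t were at least e, then u would be at least e / 2 on [t, t + delta],
   since it varies by at most 2 * delta <= e / 2 there. *)
Lemma enorm_lt_Lnorm1 u t e delta : 0 <= t -> t + delta <= 1 ->
  0 < delta -> 4 * delta <= e ->
  (forall x y, enorm (u y - u x) <= 2 * `|y - x|) ->
  (curve_Lnorm 1 u < (e / 2 * delta)%:E)%E -> enorm (u t) < e.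
Proof.
move=> t0 t1 d0 de lip; apply: contraTT; rewrite -!leNgt => ut.
have cu : continuous u by exact: enorm_lipschitz_continuous lip.
have e0 : 0 < e by lra.
rewrite /curve_Lnorm Lnorm1.
pose I : set R := `[t, t + delta]%classic.
have mI : measurable I by exact: measurable_itv.
have mU : measurable (`[0%R, 1%R]%classic : set R) by exact: measurable_itv.
have -> : ((e / 2 * delta)%:E = \int[mu]_x
    ((cst (e / 2)%:E) \_ I) x)%E.
  have E : mu I = delta%:E.
    by rewrite lebesgue_measure_itv/= lte_fin ltrDl d0 -EFinB addrAC subrr add0r.
  rewrite -integral_mkcond integral_cst// EFinM; congr (_ * _)%E; exact/esym/E.
apply: ge0_le_integral => //.
- move=> x _; apply: erestrict_ge0 => y _.
  by rewrite lee_fin divr_ge0// ltW.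
- by apply/(measurable_restrictT _ mI); exact: measurable_cst.
- apply: measurableT_comp; first exact: abse_measurable.
  apply/(measurable_restrictT _ mU); apply/measurable_EFinP.
  exact: measurable_enorm.
move=> x _; rewrite !patchE; case: ifPn => [|_]; last exact: abse_ge0.
rewrite inE /I/= in_itv/= => /andP[tx xt].
rewrite mem_set/=; last by rewrite in_itv/=; apply/andP; split; lra.
rewrite lee_fin ger0_norm ?enorm_ge0//.
have := lip x t; have := enorm_sub_le (u t) (u x).
by rewrite ler0_norm; lra.
Qed.

End PointwiseLimit.

(** * Polygons have infinite energy *)

Section PolygonEnergy.
Context {R : realType} {d : nat}.
Local Notation mu := (@lebesgue_measure R).
Local Notation mu2 := (mu \x mu)%E.
Variables (alpha q : R).
Hypotheses (alpha_gt0 : 0 < alpha) (q_ge1 : 1 <= q) (alq_ge2 : 2 <= alpha * q).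

(** The parallelogram law gives |v + w| ^ 2 = 4 - |v - w| ^ 2. *)
Lemma enormD_unit_lt2 (v w : 'rV[R]_d) : enorm v = 1 -> enorm w = 1 ->
  v != w -> enorm (v + w) < 2.
Proof.
move=> v1 w1 vw.
have P : enorm (v + w) ^+ 2 + enorm (v - w) ^+ 2 = 4.
  have -> : 4 = 2 * enorm v ^+ 2 + 2 * enorm w ^+ 2 by rewrite v1 w1; lra.
  rewrite !enorm_sqr !mulr_sumr -!big_split/=.
  by apply: eq_bigr => i _; rewrite !mxE; ring.
have : 0 < enorm (v - w) ^+ 2 by rewrite exprn_gt0// enorm_gt0// subr_eq0.
have E4 : (2 : R) ^+ 2 = 4 by ring.
by move=> vw0; rewrite -ltr_sqr ?nnegrE ?enorm_ge0// E4; lra.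
Qed.

(** The vectors v and w are the directions of the edges at a corner, and A, B
   the distances of the ends of the chord from the corner, both of order m. The
   common part m (v + w) of the chord is shorter than the arc 2 m by the defect
   m (2 - |v + w|), and A + B <= 4 m. *)
Lemma corner_chord (v w : 'rV[R]_d) m A B : enorm v = 1 -> enorm w = 1 ->
  0 < m -> m <= A <= 2 * m -> m <= B <= 2 * m ->
  enorm (A *: w + B *: v) <= (1 - (2 - enorm (v + w)) / 4) * (A + B).
Proof.
move=> v1 w1 m0 /andP[mA Am] /andP[mB Bm].
have -> : A *: w + B *: v = m *: (v + w) + ((A - m) *: w + (B - m) *: v).
  by apply/rowP => i; rewrite !mxE; ring.
have vw2 : enorm (v + w) <= 2 by rewrite (le_trans (enormD _ _))// v1 w1.
rewrite (le_trans (enormD _ _))//.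
have := enormD ((A - m) *: w) ((B - m) *: v).
rewrite !enormZ v1 w1 !ger0_norm ?subr_ge0// ?(ltW m0)// !mulr1 => h.
apply: (@le_trans _ _ (A + B - m * (2 - enorm (v + w)))); first by lra.
have : 0 <= (4 * m - (A + B)) * (2 - enorm (v + w)).
  by rewrite mulr_ge0 ?subr_ge0//; lra.
lra.
Qed.

(** By homogeneity the density is at least a multiple of l ^ (- alpha * q), hence
   of l ^ (- 2); the latter is the borderline of non-integrability at a corner. *)
Lemma kernel_corner_ge rho c l : 0 < rho -> rho < 1 -> 0 < c -> 0 < l -> l <= 1 ->
  c <= rho * l -> kernel alpha q rho 1 / l ^+ 2 <= kernel alpha q c l.
Proof.
move=> r0 r1 c0 l0 l1 cr.
have H : kernel alpha q (rho * l) l = (l^-1) `^ (alpha * q) * kernel alpha q rho 1.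
  have li0 : 0 < l^-1 by rewrite invr_gt0.
  by have := kernel_scale q alpha_gt0 li0 r0 (ltW r1); rewrite invrK mul1r.
apply: (@le_trans _ _ (kernel alpha q (rho * l) l)).
  rewrite H mulrC ler_wpM2r ?kernel_ge0//.
  rewrite -exprVn -powR_mulrn ?invr_ge0 ?(ltW l0)//.
  by rewrite ler_powR// invf_ge1.
have rl : rho * l <= l by rewrite ler_piMl ?(ltW l0) ?(ltW r1).
apply: kernel_mono => //; first by rewrite mulr_gt0.
by rewrite lerD2r invpowR_le.
Qed.

Lemma kernel_corner_gt0 rho : 0 < rho -> rho < 1 -> 0 < kernel alpha q rho 1.
Proof.
move=> r0 r1; rewrite powR_gt0// subr_gt0 ltf_pV2 ?posrE ?powR_gt0//.
by rewrite gt0_ltr_powR ?nnegrE ?ltW.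
Qed.

(** The box k, of side m k = delta / 2 ^ (k + 1), has area (m k) ^ 2, and
   f >= K / (m k) ^ 2 there: each of the infinitely many disjoint boxes
   contributes at least K. *)
Lemma integral_dyadic_boxes (f : R * R -> R) (c delta K : R) (D : set (R * R)) :
  measurable D -> measurable_fun setT f -> (forall z, 0 <= f z) ->
  0 < delta -> 0 < K ->
  `[c, c + delta[%classic `*` `]c - delta, c]%classic `<=` D ->
  (forall m t s, 0 < m -> 2 * m <= delta -> c + m <= t -> t < c + 2 * m ->
     c - 2 * m < s -> s <= c - m -> K / m ^+ 2 <= f (t, s)) ->
  (\int[mu2]_(z in D) (f z)%:E = +oo)%E.
Proof.
move=> mD mf f0 d0 K0 subD fK; apply/eqyP => B B0.
pose m k : R := delta / 2 ^+ k.+1.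
have m0 k : 0 < m k by rewrite divr_gt0// exprn_gt0.
have mdouble k : 2 * m k = delta / 2 ^+ k.
  by rewrite /m exprS; field; rewrite expf_neq0.
have m2 k : 2 * m k <= delta.
  rewrite mdouble ler_piMr ?(ltW d0)//.
  by rewrite invf_le1 ?exprn_gt0// exprn_ege1// ler1n.
have mlt j k : (j < k)%N -> 2 * m k <= m j.
  move=> jk; rewrite mdouble /m ler_wpM2l ?(ltW d0)//.
  by rewrite lef_pV2 ?posrE ?exprn_gt0// ler_weXn2l// ler1n.
pose box k : set (R * R) := `[c + m k, c + 2 * m k[%classic `*`
  `]c - 2 * m k, c - m k]%classic.
have mbox k : measurable (box k) by apply: measurableX; exact: measurable_itv.
have boxP j k z : box j z -> box k z -> j = k.
  case: z => t s; rewrite /box/= !in_itv/= => -[/andP[j1 j2] _] [/andP[k1 k2] _].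
  by case: (ltngtP j k) => [/mlt h|/mlt h|//]; exfalso; lra.
(* With N boxes the integral is at least N * K, which exceeds B. *)
pose N := (Num.truncn (B / K)).+1.
pose g z := \sum_(k < N) K / m k ^+ 2 * \1_(box k) z.
have gf z : g z <= f z.
  rewrite /g; have [[k kz]|nz] := pselect (exists k : 'I_N, box k z); last first.
    rewrite big1// => k _; rewrite indicE memNset ?mulr0// => kz.
    by apply: nz; exists k.
  rewrite (bigD1 k)//= big1 => [|j jk]; last first.
    rewrite indicE memNset ?mulr0// => jz.
    by move: jk; rewrite -val_eqE/= (boxP _ _ _ jz kz) eqxx.
  rewrite addr0 indicE mem_set// mulr1.
  move: kz; case: z => t s; rewrite /box/= !in_itv/= => -[/andP[? ?] /andP[? ?]].
  exact: fK.
apply: (@le_trans _ _ (\int[mu2]_(z in D) (g z)%:E)%E); last first.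
  apply: ge0_le_integral => //.
  - move=> z _; rewrite lee_fin; apply: sumr_ge0 => k _.
    by rewrite mulr_ge0// divr_ge0 ?sqr_ge0// ltW.
  - apply: measurable_funTS; apply/measurable_EFinP; apply: measurable_sum => k.
    by apply: measurable_funM => //; apply: measurable_indic; exact: mbox.
  - by apply: measurable_funTS; apply/measurable_EFinP.
  - by move=> z _; rewrite lee_fin.
under eq_integral do rewrite /g -sumEFin.
rewrite ge0_integral_sum//; last 2 first.
- move=> k; apply/measurable_EFinP.
  by apply: measurable_funM => //; apply: measurable_indic; exact: mbox.
- by move=> k z _; rewrite lee_fin mulr_ge0// divr_ge0 ?sqr_ge0// ltW.
rewrite (eq_bigr (fun _ => K%:E)) => [|k _]; last first.
  under eq_integral do rewrite EFinM.
  rewrite ge0_integralZl_EFin//; last 2 first.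
  - by apply/measurable_EFinP; apply: measurable_indic; exact: mbox.
  - by rewrite divr_ge0 ?sqr_ge0// ltW.
  rewrite integral_indic//; last exact: mbox.
  rewrite setIidl.
    have E : (mu2 (box k) = (m k ^+ 2)%:E)%E.
      pose I : set R := `[c + m k, c + 2 * m k[%classic.
      pose J : set R := `]c - 2 * m k, c - m k]%classic.
      have mk := m0 k.
      have EI : mu I = (m k)%:E.
        rewrite lebesgue_measure_itv/= lte_fin ifT; last by lra.
        by rewrite -EFinB; congr EFin; lra.
      have EJ : mu J = (m k)%:E.
        rewrite lebesgue_measure_itv/= lte_fin ifT; last by lra.
        by rewrite -EFinB; congr EFin; lra.
      transitivity (mu I * mu J)%E.
        by apply: product_measure1E; exact: measurable_itv.
      by rewrite EI EJ -EFinM expr2.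
    transitivity ((K / m k ^+ 2)%:E * mu2 (box k))%E; first by [].
    by rewrite E -EFinM divfK// expf_neq0// gt_eqF.
  move=> z kz; apply: subD; move: kz; case: z => t s; have := m2 k; have := m0 k.
  by rewrite /box/= !in_itv/= => ? ? [/andP[? ?] /andP[? ?]]; split;
    apply/andP; split; lra.
rewrite sumEFin lee_fin sumr_const card_ord -mulr_natl -ler_pdivrMr//.
by rewrite ltW// truncnS_gt.
Qed.

(** A closed polygon has a corner, and near it the density is not integrable. *)
Lemma polygon_energy_pinfty n (p : R -> 'rV[R]_d) (a : nat -> R) :
  simple_closed_curve p -> arc_length_parametrized p ->
  equilateral_parameters n p a -> energy alpha q p = +oo%E.
Proof.
move=> pc pa eqa; have [par _] := eqa; have [_ inc a0 a1 _] := par.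
have [pp cp pinj] := pc.
have [i [ilt vw]] := polygon_corner pc pa eqa.
set v := direction p a i in vw; set w := direction p a i.+1 in vw.
have v1 : enorm v = 1 by exact: (direction_unit pa eqa (ltnW ilt)).
have w1 : enorm w = 1 by exact: (direction_unit pa eqa ilt).
pose c := a i.+1.
have n0 : (0 < n)%N by exact: leq_trans ilt.
have c0 : 0 < c.
  rewrite (le_lt_trans a0)// (lt_le_trans (inc 0%N))//.
  exact: polygon_parameters_mono par _.
have c1 : c < 1.
  rewrite (le_lt_trans _ a1)// (polygon_parameters_mono par)//.
  by rewrite -ltnS prednK.
have ain := inc i; have ain1 := inc i.+1.
(* Within delta of the corner only the two edges at the corner are met, and the
   parameters stay in [0, 1] with arcs below one half. *)
pose delta := Num.min (Num.min (c - a i) (a i.+2 - c)) (Num.min c (1 - c) / 2).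
have d0 : 0 < delta.
  by rewrite !lt_min !subr_gt0 ain ain1 divr_gt0// lt_min c0 subr_gt0.
have [d1 d2] : delta <= c - a i /\ delta <= a i.+2 - c.
  by split; rewrite !ge_min lexx ?orbT.
have [d3 d4] : delta <= c / 2 /\ delta <= (1 - c) / 2.
  by split; rewrite ge_min; apply/orP; right; rewrite ler_pM2r// ge_min lexx ?orbT.
have vw2 := enormD_unit_lt2 v1 w1 vw; have vw0 := enorm_ge0 (v + w).
pose rho := 1 - (2 - enorm (v + w)) / 4.
have r0 : 0 < rho by rewrite /rho; lra.
have r1 : rho < 1 by rewrite /rho; lra.
have k0 := kernel_corner_gt0 r0 r1.
(* In the box of side m the arcs are at most 4 m; hence the constant 16. *)
rewrite (energyE true true)// (@integral_dyadic_boxes _ c delta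
   (kernel alpha q rho 1 / 16)).
- by rewrite gt0_muley// lte_fin invr_gt0.
- exact: measurable_square.
- exact: measurable_energy_density.
- by move=> z; exact: energy_density_ge0.
- exact: d0.
- by rewrite divr_gt0.
- move=> [t s]; rewrite /square /unit_itv/= !in_itv/=.
  by move=> [/andP[? ?] /andP[? ?]]; split; apply/andP; split; lra.
move=> m t s m0 md mt tm sm ms; rewrite energy_densityE/=.
have cd : circle_dist s t = t - s.
  by rewrite (@circle_dist_half _ s t 0) ?addr0//; apply/andP; split; lra.
have pst : p t - p s = (t - c) *: w + (c - s) *: v.
  have h1 : p t - p c = (t - c) *: w.
    by apply: polygon_affine par _ _ _ _; rewrite -/c; lra.
  have h2 : p c - p s = (c - s) *: v.
    by apply: polygon_affine par _ _ _ _; rewrite -/c; lra.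
  by rewrite -h1 -h2 subrKA.
have chord : enorm (p t - p s) <= rho * (t - s).
  have -> : t - s = (t - c) + (c - s) by lra.
  by rewrite pst; apply: (@corner_chord _ _ m) => //; apply/andP; split; lra.
have chord0 : 0 < enorm (p t - p s).
  rewrite enorm_gt0// subr_eq0; apply/negP => /eqP/pinj ts.
  suff : t = s by lra.
  by apply: ts; rewrite inE/= in_itv/=; apply/andP; split; lra.
rewrite cd (le_trans _ (kernel_corner_ge r0 r1 chord0 _ _ chord))//; [|lra|lra].
rewrite -mulrA ler_wpM2l ?(ltW k0)// -invfM lef_pV2 ?posrE.
- by rewrite -[16]/((4 ^ 2)%:R) natrX -exprMn ler_sqr ?nnegrE; lra.
- by rewrite mulr_gt0// exprn_gt0.
- by rewrite exprn_gt0//; lra.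
Qed.

End PolygonEnergy.

(** * Continuously differentiable curves at small scales *)

Section NearLinear.
Context {R : realType} {d : nat}.
Variable g : R -> 'rV[R]_d.
Hypotheses (g_periodic : periodic g 1) (g_C1 : C1 g).

Let tau : R -> 'rV[R]_d := derive1 g.

Let tau_periodic x : tau (x + 1) = tau x.
Proof.
have E : (fun h : R => h^-1 *: (g (h *: (1 : R) + (x + 1)) - g (x + 1))) =
         (fun h : R => h^-1 *: (g (h *: (1 : R) + x) - g x)).
  by apply/funext => h; rewrite g_periodic addrA g_periodic.
rewrite /tau !derive1E /derive.
exact: (congr1 (fun F => lim (F @ (0 : R)^')) E).
Qed.

Lemma C1_coord_derive i (x : R) :
  is_derive x 1 (fun x : R => g x ord0 i) (derive1 g x ord0 i).
Proof.
have [dg _] := g_C1; have dgi := (derivable_mxP g x 1).1 (dg x) ord0 i.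
by split => //; rewrite derive1E (derive_mx (dg x)) mxE.
Qed.

Lemma C1_unif_continuous (e : R) : 0 < e -> exists2 delta : R, 0 < delta &
  forall x y : R, `|y - x| <= delta -> `|derive1 g y - derive1 g x| <= e.
Proof.
move=> e0; have e2 : 0 < e / 2 by rewrite divr_gt0.
have [_ ctau] := g_C1.
pose P (delta x : R) := forall y, `|y - x| <= delta -> `|tau y - tau x| <= e.
have /compact_near_coveringP cov := @segment_compact R 0 1.
have : \forall delta \near (0:R)^'+, `[0, 1]%classic `<=` P delta.
  apply: cov => x _; have /cvgrPdist_le /(_ _ e2) := ctau x.
  move=> /nbhs_normP[eta /= eta0 H].
  have eta2 : 0 < eta / 2 by rewrite divr_gt0.
  exists (ball x (eta / 2), [set delta : R | delta < eta / 2]) => /=.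
    split; first exact: nbhsx_ballx.
    exact: nbhs_right_lt.
  move=> [x' delta] [/= xx' de] y yx'.
  have h1 := H x'; have h2 := H y.
  rewrite -(subrKA (tau x)) (le_trans (ler_normD _ _))// (splitr e) lerD//.
    rewrite distrC h2//= -[X in `|X|](subrKA x') (le_lt_trans (ler_normD _ _))//.
    rewrite (splitr eta) ltr_leD//.
    by rewrite distrC (le_trans yx')// ltW.
  by rewrite h1//= (lt_trans xx')// ltr_pdivrMr// ltr_pMr// ltr1n.
move=> Pnear.
have [delta [d0 Pd]] : exists delta : R, 0 < delta /\ `[0, 1]%classic `<=` P delta.
  have : \forall delta \near (0 : R)^'+, 0 < delta /\ `[0, 1]%classic `<=` P delta.
    by apply: filterI => //; exact: nbhs_right_gt.
  by move=> /filter_ex[delta H]; exists delta.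
exists delta => // x y xy.
pose k := - Num.floor x.
rewrite -/tau -(periodicz k x tau_periodic) -(periodicz k y tau_periodic).
apply: Pd; last by rewrite (_ : _ - _ = y - x)//; lra.
by rewrite /= in_itv/= /k intrN; have /andP[-> /ltW ->] := floor_fract01 x.
Qed.

(** At a small scale the curve is close to its tangent lines, in the sense of
   the mean value theorem applied to each coordinate. *)
Lemma C1_near_linear (e : R) : 0 < e -> exists2 delta : R, 0 < delta &
  forall x y z : R, `|y - x| <= delta -> `|z - x| <= delta -> y <= z ->
  enorm (g z - g y - (z - y) *: derive1 g x) <= e * (z - y).
Proof.
move=> e0; have e1 : 0 < e / d.+1%:R by rewrite divr_gt0.
have [delta d0 H] := C1_unif_continuous e1; exists delta => // x y z yx zx yz.
have zy0 : 0 <= z - y by rewrite subr_ge0.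
rewrite (@le_trans _ _ (d%:R * (e / d.+1%:R * (z - y))))//; last first.
  rewrite mulrA ler_wpM2r// mulrCA ler_piMr ?(ltW e0)//.
  by rewrite ler_pdivrMr// mul1r ler_nat.
apply: enorm_le_coord => i.
have di u := C1_coord_derive i u.
have gi_cont : {within `[y, z], continuous (fun x : R => g x ord0 i)}.
  apply: continuous_subspaceT => u.
  apply/differentiable_continuous/derivable1_diffP.
  by have [] := di u.
have [xi] := MVT_segment yz (fun u _ => di u) gi_cont.
rewrite in_itv/= => /andP[yxi xiz] E.
rewrite !mxE -/tau E [X in _ - X]mulrC -mulrBl normrM (ger0_norm zy0).
rewrite ler_wpM2r//.
have -> : tau xi ord0 i - tau x ord0 i = (tau xi - tau x) ord0 i by rewrite !mxE.
rewrite (le_trans (normr_coord _ _))//; apply: H.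
by move: yx zx; rewrite !ler_norml; lra.
Qed.

Hypothesis g_arc : arc_length_parametrized g.

(** Near x the chords are those of the tangent line up to a factor close to 1;
   they are at most the arcs, and at every scale they must add up to them. *)
Lemma arc_length_derive1 x : enorm (derive1 g x) = 1.
Proof.
wlog x01 : x / 0 <= x < 1.
  move=> H; rewrite -[derive1 g x](periodicz (- Num.floor x) x tau_periodic).
  by rewrite H// intrN floor_fract01.
have /andP[x0 x1] := x01.
apply/eqP; rewrite eq_le; apply/andP; split; apply/ler_addgt0Pr => e e0.
  have [delta d0 H] := C1_near_linear e0.
  pose h := Num.min delta (1 - x).
  have h0 : 0 < h by rewrite lt_min d0 subr_gt0.
  have [hd h1] : h <= delta /\ h <= 1 - x by rewrite !ge_min !lexx orbT.
  have xhx : x + h - x = h by rewrite addrAC subrr add0r.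
  have L := H x x (x + h); rewrite subrr normr0 xhx (gtr0_norm h0) in L.
  have {}L := L (ltW d0) hd _.
  have {}L : enorm (g (x + h) - g x - h *: g^`()%classic x) <= e * h.
    by apply: L; rewrite lerDl ltW.
  have A : enorm (g (x + h) - g x) <= h.
    by rewrite (le_trans (arc_length_lipschitz g_arc x0 _ _))//; lra.
  have : enorm (h *: g^`()%classic x) <= h + e * h.
    rewrite -[X in enorm X](subKr (g (x + h) - g x)) (le_trans (enormD _ _))//.
    by rewrite enormN lerD.
  by rewrite enormZ (gtr0_norm h0) -[X in _ <= X + _]mulr1 (mulrC e) -mulrDr ler_pM2l.
have [delta d0 H] := C1_near_linear e0.
pose y := x + Num.min delta (1 - x).
have h0 : 0 < Num.min delta (1 - x) by rewrite lt_min d0 subr_gt0.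
have [hd h1] : Num.min delta (1 - x) <= delta /\ Num.min delta (1 - x) <= 1 - x.
  by rewrite !ge_min !lexx orbT.
have xy : x < y by rewrite ltrDl.
apply: (arc_length_speed_ge1 g_arc x0 xy) => [|u v xu uv vy].
  by rewrite /y; lra.
have L : enorm (g v - g u - (v - u) *: g^`()%classic x) <= e * (v - u).
  by apply: H => //; rewrite ger0_norm; move: vy; rewrite /y; lra.
rewrite -[X in enorm X](subrK ((v - u) *: g^`()%classic x)).
rewrite (le_trans (enormD _ _))// enormZ ger0_norm ?subr_ge0//.
rewrite [leRHS](_ : _ = e * (v - u) + (v - u) * enorm (g^`()%classic x)).
  by rewrite lerD2r.
by ring.
Qed.

Lemma C1_chord_ge (e : R) : 0 < e -> exists2 delta : R, 0 < delta &
  forall y z : R, y <= z -> z <= y + delta ->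
  (1 - e) * (z - y) <= enorm (g z - g y).
Proof.
move=> /C1_near_linear[delta d0 H]; exists delta => // y z yz zd.
have zy0 : 0 <= z - y by rewrite subr_ge0.
have := H y y z; rewrite subrr normr0 ger0_norm//.
move=> /(_ (ltW d0) _ yz) L; have {}L := L _.
have {}L : enorm (g z - g y - (z - y) *: g^`()%classic y) <= e * (z - y).
  by apply: L; lra.
have := enorm_sub_le ((z - y) *: g^`()%classic y) (g z - g y).
by rewrite enormZ arc_length_derive1 ger0_norm// mulr1 [leRHS]enorm_distC; lra.
Qed.

(** Up to an error of one sixth, the chords A from x to y and B from y to z are
   multiples of the tangent vector at x. Writing b / a for the ratio of the arcs,
   A + B = (1 + b / a) A + (B - (b / a) A), where the last term has norm at most
   b / 3 and |A| >= 5 a / 6; so the chord grows by at least b / 2. *)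
Lemma C1_chord_slope : exists2 delta : R, 0 < delta &
  forall x y z : R, x <= y -> y <= z -> z <= x + delta ->
  (z - y) / 2 <= enorm (g z - g x) - enorm (g y - g x).
Proof.
have e0 : 0 < 6^-1 :> R by rewrite invr_gt0.
have [delta d0 H] := C1_near_linear e0; exists delta => // x y z xy yz zx.
have t1 := arc_length_derive1 x; set t := derive1 g x in t1 H.
pose a := y - x; pose b := z - y.
have a0 : 0 <= a by rewrite subr_ge0.
have b0 : 0 <= b by rewrite subr_ge0.
have LA : enorm (g y - g x - a *: t) <= 6^-1 * a.
  by apply: H => //; rewrite ?subrr ?normr0 ?(ltW d0)// ger0_norm; lra.
have LB : enorm (g z - g y - b *: t) <= 6^-1 * b.
  by apply: H => //; rewrite ger0_norm; lra.
have [a00|an0] := eqVneq a 0.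
  have yx : y = x by apply/eqP; rewrite -subr_eq0 -/a a00.
  have := enorm_sub_le (b *: t) (g z - g y).
  rewrite enormZ t1 ger0_norm// mulr1 [leRHS]enorm_distC yx subrr enorm0 subr0.
  by move: LB; rewrite /b yx; lra.
have ap : 0 < a by rewrite lt_neqAle eq_sym an0.
pose A := g y - g x; pose B := g z - g y.
have AB : g z - g x = (1 + b / a) *: A + (B - (b / a) *: A).
  by rewrite scalerDl scale1r [RHS]addrACA addrN addr0 /A /B addrC subrKA.
have ba0 : 0 <= b / a by rewrite divr_ge0.
have D : enorm (B - (b / a) *: A) <= 3^-1 * b.
  have -> : B - (b / a) *: A = (B - b *: t) - (b / a) *: (A - a *: t).
    apply/rowP => i; rewrite !mxE; field; exact/eqP/eqP.
  rewrite (le_trans (enormD _ _))// enormN enormZ (ger0_norm ba0).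
  have : b / a * enorm (A - a *: t) <= b / a * (6^-1 * a) by rewrite ler_wpM2l.
  rewrite mulrCA divfK//; move: LB; rewrite -/B; lra.
have nA : (1 - 6^-1) * a <= enorm A.
  have := enorm_sub_le (a *: t) A; rewrite enormZ t1 ger0_norm// mulr1.
  by rewrite enorm_distC; move: LA; rewrite -/A; lra.
have L1 := enorm_sub_le ((1 + b / a) *: A) (- (B - (b / a) *: A)).
rewrite opprK -AB enormN enormZ ger0_norm ?addr_ge0// mulrDl mul1r in L1.
have L2 : b / a * ((1 - 6^-1) * a) <= b / a * enorm A by rewrite ler_wpM2l.
have E : b / a * ((1 - 6^-1) * a) = (1 - 6^-1) * b by field.
by rewrite E in L2; rewrite -/A -/b; lra.
Qed.

Hypothesis g_inj : forall s t, 0 <= s < 1 -> 0 <= t < 1 -> g s = g t -> s = t.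

(** Near the diagonal the chord is at least half of the arc, because the curve
   is almost straight; away from it the chord has a positive minimum, by
   compactness. *)
Lemma C1_bilipschitz : exists2 kappa : R, 0 < kappa &
  forall s t : R, kappa * circle_dist s t <= enorm (g t - g s).
Proof.
have lip s t := arc_length_circle s t g_arc g_periodic.
have h0 : 0 < 2^-1 :> R by rewrite invr_gt0.
have [delta d0 ch] := C1_chord_ge h0.
have near_diag s t : circle_dist s t < delta ->
    circle_dist s t / 2 <= enorm (g t - g s).
  wlog [k kst] : s t / exists k, 0 <= t - s + k%:~R <= 2^-1.
    move=> H; have [|] := circle_arc s t; first exact: H.
    by rewrite circle_distC enorm_distC; exact: H.
  rewrite (circle_dist_half kst) => ltd.
  have /andP[l0 _] := kst.
  rewrite -(periodicz k t g_periodic).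
  have := ch s (t + k%:~R); rewrite (_ : t + k%:~R - s = t - s + k%:~R); last by lra.
  by rewrite mulrC (_ : 1 - 2^-1 = 2^-1 :> R) //; [apply; lra|lra].
pose P (kappa : R) (z : R * R) :=
  kappa * circle_dist z.1 z.2 <= enorm (g z.2 - g z.1).
have cpt : compact (`[0, 1]%classic `*` `[0, 1]%classic : set (R * R)).
  by apply: compact_setX; exact: segment_compact.
have /compact_near_coveringP cov := cpt.
have : \forall kappa \near (0 : R)^'+,
    `[0, 1]%classic `*` `[0, 1]%classic `<=` P kappa.
  apply: cov => -[s t] _.
  pose c := circle_dist s t.
  have [cd|cd] := ltP c (delta / 2).
    have d4 : 0 < delta / 4 by rewrite divr_gt0.
    exists (ball s (delta / 4) `*` ball t (delta / 4),
        [set kappa : R | kappa < 2^-1]) => /=.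
      split; last exact: nbhs_right_lt.
      by exists (ball s (delta / 4), ball t (delta / 4)) => //=; split;
        exact: nbhsx_ballx.
    move=> [[s' t'] kappa] [[/= ss' tt'] kl]; rewrite /P/=.
    rewrite (le_trans _ (near_diag s' t' _))//.
      by rewrite mulrC ler_wpM2l ?circle_dist_ge0// ltW.
    have := circle_dist_triangle s' t' s t.
    move: ss' tt'; rewrite /ball/= (distrC s) (distrC t) -/c; lra.
  have c0 : 0 < c by rewrite (lt_le_trans _ cd)// divr_gt0.
  have gst : 0 < enorm (g t - g s).
    rewrite enorm_gt0// subr_eq0; apply: contraTneq c0 => gts.
    have fts : t - (Num.floor t)%:~R = s - (Num.floor s)%:~R.
      apply: (g_inj (floor_fract01 t) (floor_fract01 s)).
      have gfract u : g (u - (Num.floor u)%:~R) = g u by rewrite -intrN periodicz.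
      by rewrite !gfract.
    rewrite -leNgt (le_trans (circle_dist_le (Num.floor s - Num.floor t) _ _))//.
    have E : t - s + ((Num.floor s)%:~R - (Num.floor t)%:~R) = 0 by lra.
    by rewrite intrB E normr0.
  pose m := enorm (g t - g s); have m4 : 0 < m / 4 by rewrite divr_gt0.
  exists (ball s (m / 4) `*` ball t (m / 4), [set kappa : R | kappa < m]) => /=.
    split; last exact: nbhs_right_lt.
    by exists (ball s (m / 4), ball t (m / 4)) => //=; split;
      exact: nbhsx_ballx.
  move=> [[s' t'] kappa] [[/= ss' tt'] kl]; rewrite /P/=.
  apply: (@le_trans _ _ (m / 2)).
    have := circle_dist_le_half s' t'; have := circle_dist_ge0 s' t'.
    move=> cd0 cd1; rewrite (@le_trans _ _ (m * circle_dist s' t'))//.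
      by rewrite ler_wpM2r// ltW.
    by rewrite ler_wpM2l// ltW.
  have lip1 u v : enorm (g v - g u) <= `|v - u|.
    exact: le_trans (lip u v) (circle_dist_le_norm u v).
  have := enorm_sub_le (g t - g s) (g t' - g s'); rewrite -/m.
  have -> : g t - g s - (g t' - g s') = (g t - g t') + (g s' - g s).
    by apply/rowP => i; rewrite !mxE; lra.
  have := enormD (g t - g t') (g s' - g s).
  have := lip1 t' t; have := lip1 s s'.
  move: ss' tt'; rewrite /ball/= (distrC s s'); lra.
move=> Pnear.
have [kappa [k0 Pk]] : exists kappa : R, 0 < kappa /\
    `[0, 1]%classic `*` `[0, 1]%classic `<=` P kappa.
  have : \forall kappa \near (0 : R)^'+, 0 < kappa /\
      `[0, 1]%classic `*` `[0, 1]%classic `<=` P kappa.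
    by apply: filterI => //; exact: nbhs_right_gt.
  by move=> /filter_ex[kappa H]; exists kappa.
exists kappa => // s t.
rewrite -(periodicz (- Num.floor s) s g_periodic).
rewrite -(periodicz (- Num.floor t) t g_periodic).
rewrite -(circle_dist_shiftl s t (- Num.floor s)).
rewrite -(circle_dist_shiftr _ t (- Num.floor t)).
apply: (Pk (_, _)); split; rewrite /= in_itv/= intrN.
  by have /andP[-> /ltW ->] := floor_fract01 s.
by have /andP[-> /ltW ->] := floor_fract01 t.
Qed.

End NearLinear.

(** * Equilateral polygons inscribed in a curve *)

Lemma lipschitz_within_continuous {R : realType} (f : R -> R) (c a b : R) :
  0 <= c -> (forall x y, a <= x <= b -> a <= y <= b ->
    `|f x - f y| <= c * `|x - y|) -> {within `[a, b], continuous f}.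
Proof.
move=> c0 lip; apply/subspace_continuousP => x /=; rewrite in_itv/= => xab.
apply/cvgrPdist_le => e e0.
have ec : 0 < e / (c + 1) by rewrite divr_gt0// ltr_wpDl.
rewrite near_withinE; apply: filterS (nbhsx_ballx x _ ec) => y xy /=.
rewrite in_itv/= => yab; rewrite (le_trans (lip _ _ xab yab))//.
have c1 : 0 < c + 1 by rewrite ltr_wpDl.
rewrite (@le_trans _ _ ((c + 1) * `|x - y|))//.
  by rewrite ler_wpM2r// lerDl.
by rewrite mulrC -ler_pdivlMr// ltW.
Qed.

Section Compass.
Context {R : realType} {d : nat}.
Variables (g : R -> 'rV[R]_d) (delta : R).
Hypotheses (g_periodic : periodic g 1) (delta_gt0 : 0 < delta).
Hypothesis g_lip : forall x y, enorm (g y - g x) <= `|y - x|.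
Hypothesis g_slope : forall x y z, x <= y -> y <= z -> z <= x + delta ->
  (z - y) / 2 <= enorm (g z - g x) - enorm (g y - g x).

Let compass_set r x : set R :=
  [set z | x <= z <= x + delta /\ enorm (g z - g x) = r].

(** The point after x at distance r, within delta: the step of a pair of
   compasses of opening r walking along the curve. *)
Definition compass r x : R := xget x (compass_set r x).

Lemma compassP r x : 0 <= r -> r <= delta / 2 ->
  [/\ x <= compass r x, compass r x <= x + delta &
      enorm (g (compass r x) - g x) = r].
Proof.
move=> r0 rd.
suff [] : compass_set r x (compass r x) by move=> /andP[].
apply: xgetPex.
have xd : x <= x + delta by rewrite lerDl ltW.
have cF : {within `[x, x + delta], continuous (fun z => enorm (g z - g x))}.
  apply: (lipschitz_within_continuous (c := 1)) => // y z _ _.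
  rewrite (le_trans (enorm_sub_abs _ _))// opprB addrA subrK mul1r.
  by rewrite enorm_distC distrC g_lip.
have [|z] := IVT xd cF (v := r).
  have := g_slope (lexx x) xd (lexx _); rewrite subrr enorm0 subr0 => h.
  rewrite ge_min r0/= le_max; apply/orP; right.
  by rewrite (le_trans rd)// (le_trans _ h)// addrAC subrr add0r.
by rewrite in_itv/= => xz zr; exists z.
Qed.

(** The distance from x is strictly increasing along [x, x + delta]. *)
Lemma compass_unique r x z : 0 <= r -> r <= delta / 2 ->
  x <= z -> z <= x + delta -> enorm (g z - g x) = r -> compass r x = z.
Proof.
move=> r0 rd xz zd zr; have [xS Sd Sr] := compassP x r0 rd.
have [Sz|zS] := leP (compass r x) z.
  by have := g_slope xS Sz zd; rewrite zr Sr; lra.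
by have := g_slope xz (ltW zS) Sd; rewrite zr Sr; lra.
Qed.

Lemma compass_shift r x : 0 <= r -> r <= delta / 2 ->
  compass r (x + 1) = compass r x + 1.
Proof.
move=> r0 rd; have [xS Sd Sr] := compassP x r0 rd.
by apply: compass_unique => //; [lra|lra|rewrite !g_periodic].
Qed.

Lemma compass_gap r x : 0 <= r -> r <= delta / 2 ->
  r <= compass r x - x <= 2 * r.
Proof.
move=> r0 rd; have [xS Sd Sr] := compassP x r0 rd.
have := g_slope (lexx x) xS Sd; rewrite subrr enorm0 subr0 Sr => h.
have := g_lip x (compass r x); rewrite Sr ger0_norm ?subr_ge0// => h'.
by apply/andP; split; lra.
Qed.

(** The distance from x' changes by at most |x - x'| when measured from x, and it
   grows at least at half the speed of the arc: an error in the distance moves the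
   end point by at most twice as much. *)
Lemma compass_lipschitz r x r' x' : 0 <= r -> r <= delta / 2 ->
  0 <= r' -> r' <= delta / 2 ->
  `|compass r x - compass r' x'| <= 2 * `|r - r'| + 3 * `|x - x'|.
Proof.
move=> r0 rd r0' rd'.
wlog le : r x r' x' r0 rd r0' rd' / compass r x <= compass r' x'.
  move=> H; have [le|/ltW le] := leP (compass r x) (compass r' x'); first exact: H.
  by rewrite distrC (distrC r) (distrC x); exact: H.
have [xS Sd Sr] := compassP x r0 rd; have [xS' Sd' Sr'] := compassP x' r0' rd'.
set z := compass r x in xS Sd Sr le *; set z' := compass r' x' in xS' Sd' Sr' le *.
rewrite distrC ger0_norm ?subr_ge0//.
have nx := normr_ge0 (x - x'); have nr := normr_ge0 (r - r').
have r1 : r' <= r + `|r - r'| by have := ler_norm (r' - r); rewrite distrC; lra.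
have x1 : x' <= x + `|x - x'| by have := ler_norm (x' - x); rewrite distrC; lra.
have [xz|zx] := leP x' z.
  have := g_slope xz le Sd'; rewrite Sr'.
  have := enorm_distD (g x') (g z) (g x); have := g_lip x x'; rewrite (distrC x').
  by rewrite Sr; lra.
have := g_slope (lexx x') xS' Sd'; rewrite subrr enorm0 subr0 Sr'.
have := g_lip x z; rewrite Sr ger0_norm ?subr_ge0//.
by lra.
Qed.

Let walk r i : R := iter i (compass r) 0.

Let walk_lipschitz i : exists2 C : R, 0 <= C & forall r r', 0 <= r ->
  r <= delta / 2 -> 0 <= r' -> r' <= delta / 2 ->
  `|walk r i - walk r' i| <= C * `|r - r'|.
Proof.
elim: i => [|i [C C0 IH]].
  by exists 0 => // r r' _ _ _ _; rewrite subrr normr0 mul0r.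
exists (2 + 3 * C) => [|r r' r0 rd r0' rd']; first by lra.
rewrite (le_trans (compass_lipschitz (walk r i) (walk r' i) r0 rd r0' rd'))//.
by have := IH r r' r0 rd r0' rd'; lra.
Qed.

(** The compasses return exactly to the starting point after n steps, for an
   opening between 1 / (2 n) and 1 / n: with the former they do not complete
   the turn, and with the latter they do. *)
Lemma inscribed_equilateral n : (0 < n)%N -> n%:R^-1 <= delta / 2 ->
  exists r (t : nat -> R),
  [/\ 0 < r, r <= n%:R^-1, t 0%N = 0 /\ (forall i, t (i + n)%N = t i + 1),
      forall i, r <= t i.+1 - t i <= 2 * r &
      forall i, enorm (g (t i.+1) - g (t i)) = r].
Proof.
move=> n0 nd; have nR : 0 < n%:R :> R by rewrite ltr0n.
pose a : R := n%:R^-1 / 2; pose b : R := n%:R^-1.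
have b0 : 0 < b by rewrite invr_gt0.
have ab : a <= b by rewrite /a ler_pdivrMr// ler_peMr ?(ltW b0)// ler1n.
have a0 : 0 < a by rewrite divr_gt0.
have gap r i : 0 <= r -> r <= delta / 2 ->
    i%:R * r <= walk r i <= i%:R * (2 * r).
  move=> r0 rd; elim: i => [|i /andP[h1 h2]]; first by rewrite !mul0r lexx.
  have /andP[h3 h4] := compass_gap (walk r i) r0 rd.
  by rewrite -natr1 !mulrDl !mul1r; rewrite [walk r i.+1]/=; apply/andP; split; lra.
have [C C0 L] := walk_lipschitz n.
have cw : {within `[a, b], continuous (fun r => walk r n)}.
  apply: (lipschitz_within_continuous C0) => x y /andP[ax xb] /andP[ay yb].
  by apply: L; rewrite ?(le_trans (ltW a0))// (le_trans _ nd).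
have [|r] := IVT ab cw (v := 1).
  have /andP[_ wa] := gap a n (ltW a0) (le_trans ab nd).
  have /andP[wb _] := gap b n (ltW b0) nd.
  have E : n%:R * (2 * a) = n%:R / n%:R by rewrite /a; field; rewrite gt_eqF.
  rewrite E in wa.
  rewrite ge_min le_max; apply/andP; split; apply/orP; [left|right].
    by rewrite (le_trans wa)// divff// gt_eqF.
  by rewrite (le_trans _ wb)// divff// gt_eqF.
rewrite in_itv/= => /andP[ar rb] wr.
have r0 : 0 < r by exact: lt_le_trans ar.
have rd : r <= delta / 2 by exact: le_trans nd.
exists r, (walk r); split => //.
- split=> // i; elim: i => [|i IH]; first by rewrite add0n wr add0r.
  by rewrite addSn /= -/(walk r _) IH compass_shift// ltW.
- by move=> i; apply: compass_gap => //; exact: ltW.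
- by move=> i; have [_ _] := compassP (walk r i) (ltW r0) rd.
Qed.

End Compass.

(** * Small Lipschitz perturbations are ambient isotopies *)

(* The Banach fixed point theorem needs complete normed modules. *)
HB.instance Definition _ (R : realType) (d : nat) := Complete.on 'rV[R]_d.

Section LipschitzPerturbation.
Context {R : realType} {d : nat}.
Local Notation V := 'rV[R]_d.
Implicit Types (A B C : set V) (W h : V -> V).

Lemma lipschitz_continuous (U U' : normedModType R) (f : U -> U') (c : R) :
  0 <= c -> (forall x y, `|f x - f y| <= c * `|x - y|) -> continuous f.
Proof.
move=> c0 lip x; apply/cvgrPdist_le => e e0.
have c1 : 0 < c + 1 by rewrite ltr_wpDl.
have ec : 0 < e / (c + 1) by rewrite divr_gt0.
apply: filterS (nbhsx_ballx x _ ec) => y xy.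
rewrite (le_trans (lip _ _))// (@le_trans _ _ ((c + 1) * `|x - y|))//.
  by rewrite ler_wpM2r// lerDl.
rewrite mulrC -ler_pdivlMr// ltW//.
by move: xy; rewrite -ball_normE.
Qed.

(** A perturbation of the identity by a contraction is invertible: solving
   x + W x = y means finding a fixed point of y - W. *)
Lemma homeomorphism_addW W (c : R) : 0 <= c -> c < 1 ->
  (forall x y, `|W x - W y| <= c * `|x - y|) ->
  homeomorphism (fun x => x + W x).
Proof.
move=> c0 c1 lip.
have expand x y : (1 - c) * `|x - y| <= `|(x + W x) - (y + W y)|.
  rewrite opprD addrACA mulrBl mul1r lerBlDr.
  rewrite -[X in `|X| <= _](addrK (W x - W y)) (le_trans (ler_normB _ _))//.
  by rewrite lerD2l.
have inj x y : x + W x = y + W y -> x = y.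
  move=> E; apply/eqP; rewrite -subr_eq0 -normr_le0.
  have := expand x y; rewrite E subrr normr0 pmulr_rle0// subr_gt0//.
have surj y : exists x, x + W x = y.
  pose F : {fun [set: V] >-> [set: V]} := totalfun (fun x => y - W x).
  have cF : is_contraction F.
    exists (NngNum c0); split => // -[u v] _ /=.
    by rewrite /totalfun_ opprB addrC subrKA distrC lip.
  have [x _ E] := banach_fixed_point cF closedT (ex_intro _ 0 I).
  by exists x; rewrite {1}E /= /totalfun_ subrK.
split.
  apply: (@lipschitz_continuous _ _ _ (1 + c)) => [|x y]; first by rewrite addr_ge0.
  rewrite opprD addrACA (le_trans (ler_normD _ _))// mulrDl mul1r lerD2l.
  exact: lip.
have [h' h'K] := choice surj; exists h'; split=> [|x|y]; last exact: h'K.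
  apply: (@lipschitz_continuous _ _ _ (1 - c)^-1) => [|x y].
    by rewrite invr_ge0 subr_ge0 ltW.
  by rewrite -ler_pdivrMl ?invr_gt0 ?subr_gt0// invrK -{2}(h'K x) -{2}(h'K y).
by apply: inj; rewrite h'K.
Qed.

Lemma ambient_isotopic_addW W (c : R) A : 0 <= c -> c < 1 ->
  (forall x y, `|W x - W y| <= c * `|x - y|) ->
  ambient_isotopic A [set x + W x | x in A].
Proof.
move=> c0 c1 lip; exists (fun t x => x + t *: W x); split.
- apply: continuous_subspaceT => z.
  have cW : continuous W by exact: lipschitz_continuous lip.
  apply: cvgD; first exact: cvg_snd.
  apply: cvgZ; first exact: cvg_fst.
  apply: (@cvg_comp _ _ _ snd W _ (nbhs z.2)); first exact: cvg_snd.
  exact: cW.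
- move=> t t0 t1; apply: (@homeomorphism_addW _ c) => // x y.
  rewrite -scalerBr normrZ ger0_norm// (le_trans _ (lip x y))//.
  by rewrite ler_piMl.
- by apply/funext => x; rewrite scale0r addr0.
- by apply: eq_imagel => x _; rewrite scale1r.
Qed.

Lemma homeomorphism_comp h1 h2 :
  homeomorphism h1 -> homeomorphism h2 -> homeomorphism (fun x => h2 (h1 x)).
Proof.
move=> [c1 [k1 [ck1 h1K k1K]]] [c2 [k2 [ck2 h2K k2K]]]; split.
  by move=> x; apply: continuous_comp; [exact: c1|exact: c2].
exists (k1 \o k2); split.
- by move=> x; apply: continuous_comp; [exact: ck2|exact: ck1].
- by move=> x /=; rewrite h2K h1K.
- by move=> x /=; rewrite k1K k2K.
Qed.

(** The two isotopies run simultaneously: composing them at each time avoids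
   gluing them one after the other. *)
Lemma ambient_isotopic_trans A B C :
  ambient_isotopic A B -> ambient_isotopic B C -> ambient_isotopic A C.
Proof.
move=> [H [cH hH H0 H1]] [H' [cH' hH' H'0 H'1]].
exists (fun t x => H' t (H t x)); split.
- pose D := `[0, 1]%classic `*` [set: V] : set (R * V).
  pose phi (z : R * V) := (z.1, H z.1 z.2).
  apply/subspace_continuousP => z Dz.
  have Dphi w : D w -> D (phi w) by case: w => t x [].
  apply: (@cvg_comp _ _ _ phi (fun w => H' w.1 w.2) _ (within D (nbhs (phi z)))).
    have phiz : phi w @[w --> within D (nbhs z)] --> phi z.
      apply: (@cvg_pair _ _ _ _ (nbhs z.1) (nbhs (H z.1 z.2))).
        by apply: cvg_within_filter; exact: cvg_fst.
      by move/subspace_continuousP : cH; apply.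
    move=> S; rewrite /within/= => nS.
    have := phiz _ nS; rewrite /= /nbhs/= /within/=.
    by apply: filterS => w Sw Dw; apply: Sw => //; exact: Dphi.
  by move/subspace_continuousP : cH'; apply; exact: Dphi.
- by move=> t t0 t1; apply: homeomorphism_comp; [exact: hH|exact: hH'].
- by rewrite H0 H'0.
- by rewrite -H'1 -H1 image_comp.
Qed.

(** McShane's extension: the infimum of the cones of slope c above the points of
   the graph. *)
Lemma lipschitz_extension (T : Type) (t0 : T) (gam : T -> V) (f : T -> R) (c : R) :
  0 <= c -> (forall s t, `|f t - f s| <= c * `|gam t - gam s|) ->
  exists F : V -> R, (forall t, F (gam t) = f t) /\
    forall x y, `|F x - F y| <= c * `|x - y|.
Proof.
move=> c0 lip; pose S x := [set f t + c * `|x - gam t| | t in [set: T]].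
have S_inf x : has_inf (S x).
  split; first by exists (f t0 + c * `|x - gam t0|), t0.
  exists (f t0 - c * `|x - gam t0|) => _ [t _ <-].
  have := lip t t0; rewrite ler_norml => /andP[_ h].
  have : c * `|gam t0 - gam t| <= c * `|x - gam t0| + c * `|x - gam t|.
    rewrite -mulrDr ler_wpM2l// -(subrKA x) (le_trans (ler_normD _ _))//.
    by rewrite distrC.
  lra.
have S_le x t : inf (S x) <= f t + c * `|x - gam t|.
  by apply: ge_inf; [exact: (S_inf x).2|exists t].
have S_ge x m : (forall t, m <= f t + c * `|x - gam t|) -> m <= inf (S x).
  by move=> mS; apply: lb_le_inf; [exact: (S_inf x).1|move=> _ [t _ <-]].
exists (fun x => inf (S x)); split.
  move=> t; apply/eqP; rewrite eq_le; apply/andP; split.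
    by have := S_le (gam t) t; rewrite subrr normr0 mulr0 addr0.
  by apply: S_ge => s; have := lip s t; rewrite ler_norml => /andP[_]; lra.
have H x y : inf (S x) <= inf (S y) + c * `|x - y|.
  rewrite -lerBlDr; apply: S_ge => t; rewrite lerBlDr (le_trans (S_le x t))//.
  rewrite -addrA lerD2l -mulrDr ler_wpM2l// -(subrKA y) addrC.
  by rewrite (le_trans (ler_normD _ _)).
by move=> x y; have := H x y; have := H y x; rewrite (distrC y) ler_norml; lra.
Qed.

(** If the difference of two closed curves is Lipschitz with a small constant
   with respect to the chords of the first one, then it extends to a contraction
   W of the whole space, and id + t W moves the first curve to the second. *)
Lemma ambient_isotopic_perturbation (g p : R -> V) (c : R) :
  0 <= c -> c < 1 ->
  (forall s t, `|(p t - g t) - (p s - g s)| <= c * `|g t - g s|) ->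
  ambient_isotopic (range g) (range p).
Proof.
move=> c0 c1 lip.
have ext (i : 'I_d) : exists F : V -> R,
    (forall t, F (g t) = (p t - g t) ord0 i) /\
    forall x y, `|F x - F y| <= c * `|x - y|.
  apply: (lipschitz_extension 0 c0) => s t.
  rewrite (le_trans _ (lip s t))// (le_trans _ (normr_coord _ i))//.
  by rewrite !mxE.
have [F FP] := choice ext.
pose W x : V := \row_i F i x.
have Wg t : g t + W (g t) = p t.
  by apply/rowP => i; rewrite !mxE (FP i).1 !mxE addrC subrK.
rewrite (_ : range p = [set x + W x | x in range g]).
  apply: (ambient_isotopic_addW _ c0 c1) => x y.
  rewrite [leLHS]/Num.Def.normr/= mx_normrE; apply/bigmax_leP => /=; split.
    by rewrite mulr_ge0.
  by move=> [i j] _ /=; rewrite !mxE (FP j).2.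
by rewrite image_comp; apply: eq_imagel => t _ /=; rewrite Wg.
Qed.

End LipschitzPerturbation.

(** * Weak derivatives of piecewise smooth functions *)

Section PiecewiseIntegral.
Context {R : realType}.
Local Notation mu := (@lebesgue_measure R).
Implicit Types (G : R -> R) (f : nat -> R -> R) (x : nat -> R).

Lemma integrable_itv_co_cc (a b : R) (f : R -> \bar R) :
  mu.-integrable `[a, b[ f -> mu.-integrable `[a, b] f.
Proof.
move=> /integrableP[mf If]; have mf' := (emeasurable_fun_itv_bndo_bndcP _ _ _).1 mf.
apply/integrableP; split => //.
rewrite -integral_itv_bndo_bndc//; exact: measurableT_comp mf.
Qed.

Lemma continuous_integrable_itv (a b : R) (f : R -> R) b0 b1 : continuous f ->
  mu.-integrable [set` Interval (BSide b0 a) (BSide b1 b)] (EFin \o f).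
Proof.
move=> cf; have H : mu.-integrable `[a, b] (EFin \o f).
  apply: continuous_compact_integrable; first exact: segment_compact.
  exact: continuous_subspaceT.
apply: integrableS H => //.
by apply: subset_itv; rewrite bnd_simp//; case: b0 b1 => [] [].
Qed.

(** On each piece the function agrees with a continuous function except possibly
   at the right end, which does not affect the integral. *)
Lemma piecewise_continuous_integral n x f G :
  (forall i j, (i <= j)%N -> x i <= x j) ->
  (forall k, continuous (f k)) ->
  (forall k t, (k < n)%N -> cell x k t -> G t = f k t) ->
  mu.-integrable `[x 0%N, x n] (EFin \o G) /\
  \int[mu]_(t in `[x 0%N, x n]) G t =
    \sum_(k < n) \int[mu]_(t in `[x k, x k.+1]) f k t.
Proof.
move=> mono cf Gf; pose D : set R := `[x 0%N, x n[%classic.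
have mD : measurable D by exact: measurable_itv.
have mc k : measurable (cell x k) by exact: measurable_itv.
pose p k := (EFin \o f k) \_ (cell x k).
have fc k : mu.-integrable (cell x k) (EFin \o f k).
  exact: continuous_integrable_itv.
have ip k : mu.-integrable D (p k).
  have H := (@integrable_mkcond _ _ _ mu _ (EFin \o f k) (mc k)).1 (fc k).
  by apply: integrableS H.
have Gp : {in D, EFin \o G =1 fun t => \sum_(k <- index_enum 'I_n) p k t}%E.
  move=> t; rewrite inE /D/= in_itv/= => /andP[x0t txn].
  have [j ltj jt] := cell_exists x0t txn.
  rewrite (bigD1_seq (Ordinal ltj)) ?mem_index_enum ?index_enum_uniq//= big1.
    by rewrite adde0 /p patchE mem_set//= (Gf _ _ ltj jt).
  move=> k; rewrite -val_eqE/= => kj; rewrite /p patchE memNset// => kt.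
  by move: kj; rewrite (cell_unique mono kt jt) eqxx.
have iG : mu.-integrable D (EFin \o G).
  have Gp' : {in D, (fun t => \sum_(k <- index_enum 'I_n) p k t)%E =1 EFin \o G}.
    by move=> t tD; rewrite Gp.
  have isum : mu.-integrable D (fun t => \sum_(k <- index_enum 'I_n) p k t)%E.
    by apply: integrable_sum => // k _; exact: ip.
  exact: (@eq_integrable _ _ _ mu D mD _ _ Gp' isum).
split; first exact: integrable_itv_co_cc.
rewrite -Rintegral_itv_bndo_bndc//.
apply: EFin_inj; rewrite /Rintegral fineK; last exact: integrable_fin_num.
have E : (\int[mu]_(t in D) (G t)%:E = \sum_(k <- index_enum 'I_n) \int[mu]_(t in D) p k t)%E.
  transitivity (\int[mu]_(t in D) (\sum_(k <- index_enum 'I_n) p k t))%E.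
    by apply: eq_integral => t tD; exact: Gp.
  by rewrite integral_sum// => k; exact: ip.
rewrite -sumEFin [LHS]E; apply: eq_bigr => k _.
rewrite -/D /p -integral_mkcondr setIidr; last first.
  move=> t; rewrite /D /cell /= !in_itv/= => /andP[h1 h2].
  by rewrite (le_trans (mono 0%N k _) h1)//= (lt_le_trans h2)// mono.
transitivity ((\int[mu]_(t in cell x k) f k t)%R)%:E.
  rewrite /Rintegral fineK//; apply: integrable_fin_num => //.
  exact: measurable_itv.
by congr EFin; apply: Rintegral_itv_bndo_bndc; exact: fc.
Qed.

End PiecewiseIntegral.

Section WeakDerivative.
Context {R : realType} {d : nat}.
Local Notation mu := (@lebesgue_measure R).

(** Integration by parts on each piece; the boundary terms telescope, since the
   function is continuous, and the two remaining ones agree by periodicity. *)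
Lemma weak_derivative_piecewise n (u v : R -> 'rV[R]_d) (w w' : nat -> R -> 'rV[R]_d)
    (x : nat -> R) :
  x 0%N = 0 -> x n = 1 -> (forall k, x k < x k.+1) -> u 1 = u 0 ->
  (forall k i (t : R), is_derive t 1 (fun t : R => w k t ord0 i) (w' k t ord0 i)) ->
  (forall k i, continuous (fun t : R => w' k t ord0 i)) ->
  (forall k t, (k < n)%N -> x k <= t <= x k.+1 -> u t = w k t) ->
  (forall k t, (k < n)%N -> cell x k t -> v t = w' k t) ->
  weak_derivative u v.
Proof.
move=> x0 xn xlt u10 dw cw' uw vw' i.
have mono j k : (j <= k)%N -> x j <= x k.
  move=> jk; rewrite -(subnK jk); elim: (k - j)%N => [//|m IH].
  by rewrite addSn (le_trans IH)// ltW.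
have cw k : continuous (fun t : R => w k t ord0 i).
  move=> t; apply/differentiable_continuous/derivable1_diffP.
  by have [] := dw k i t.
have uw_cell k t : (k < n)%N -> cell x k t -> u t ord0 i = w k t ord0 i.
  move=> kn; rewrite /cell/= in_itv/= => /andP[h1 h2].
  by rewrite (uw k t kn)// h1 ltW.
have vw_cell k t : (k < n)%N -> cell x k t -> v t ord0 i = w' k t ord0 i.
  by move=> kn kt; rewrite (vw' k t kn kt).
split.
- rewrite -x0 -xn.
  exact: (piecewise_continuous_integral mono cw uw_cell).1.
- rewrite -x0 -xn.
  exact: (piecewise_continuous_integral mono (fun k => cw' k i) vw_cell).1.
move=> phi [pphi dphi].
have dphi0 t : derivable phi t 1 by exact: (dphi 0%N t).
have cphi : continuous phi.
  by move=> t; apply/differentiable_continuous/derivable1_diffP.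
have cphi' : continuous (derive1 phi).
  move=> t; apply/differentiable_continuous/derivable1_diffP.
  exact: (dphi 1%N t).
pose f k t := w k t ord0 i * derive1 phi t.
pose h k t := w' k t ord0 i * phi t.
have cf k : continuous (f k) by move=> t; apply: continuousM; [exact: cw|exact: cphi'].
have ch k : continuous (h k) by move=> t; apply: continuousM; [exact: cw'|exact: cphi].
have fu k t : (k < n)%N -> cell x k t -> u t ord0 i * derive1 phi t = f k t.
  by move=> kn kt; rewrite (uw_cell k t kn kt).
have hv k t : (k < n)%N -> cell x k t -> v t ord0 i * phi t = h k t.
  by move=> kn kt; rewrite (vw_cell k t kn kt).
have := (piecewise_continuous_integral mono cf fu).2.
have := (piecewise_continuous_integral mono ch hv).2.
rewrite x0 xn => -> ->.
have LR (F F' : R -> R) a b : (forall t : R, is_derive t 1 F (F' t)) ->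
    derivable_oo_LRcontinuous F a b.
  move=> dF; have cF : continuous F.
    by move=> t; apply/differentiable_continuous/derivable1_diffP; have [] := dF t.
  split.
  - by move=> t _; have [] := dF t.
  - exact/cvg_at_right_filter/cF.
  - exact/cvg_at_left_filter/cF.
have parts k : (k < n)%N -> \int[mu]_(t in `[x k, x k.+1]) f k t =
    (u (x k.+1) ord0 i * phi (x k.+1) - u (x k) ord0 i * phi (x k))
    - \int[mu]_(t in `[x k, x k.+1]) h k t.
  move=> kn.
  rewrite (uw k (x k) kn) ?lexx ?(ltW (xlt k))//.
  rewrite (uw k (x k.+1) kn) ?lexx ?(ltW (xlt k))//.
  apply: (@Rintegration_by_parts R (fun t => w k t ord0 i) phi
    (fun t => w' k t ord0 i) (derive1 phi)) => //.
  - exact/continuous_subspaceT/cw'.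
  - exact: LR (dw k i).
  - by move=> t _; rewrite derive1E; have [_ ->] := dw k i t.
  - exact/continuous_subspaceT.
  - by apply: (LR _ (derive1 phi)) => t; split => //; rewrite derive1E.
rewrite (eq_bigr (fun k : 'I_n => (u (x k.+1) ord0 i * phi (x k.+1)
    - u (x k) ord0 i * phi (x k)) - \int[mu]_(t in `[x k, x k.+1]) h k t));
  last by move=> k _; exact: parts.
rewrite big_split/= sumrN.
rewrite -(big_mkord xpredT (fun k => u (x k.+1) ord0 i * phi (x k.+1)
    - u (x k) ord0 i * phi (x k))) telescope_sumr// x0 xn u10.
by rewrite -{1}(add0r (1 : R)) pphi subrr add0r.
Qed.

Lemma curve_Lnorm_oo_le (u : R -> 'rV[R]_d) (e : R) : 0 <= e ->
  (forall t, 0 <= t <= 1 -> enorm (u t) <= e) -> (curve_Lnorm +oo u <= e%:E)%E.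
Proof.
move=> e0 ue; rewrite /curve_Lnorm unlock /Lnorm.
case: ifPn => _; last by rewrite lee_fin.
apply/ess_supP; apply: nearW => t /=; rewrite patchE; case: ifPn => [|_].
  by rewrite inE/= in_itv/= => t01; rewrite lee_fin ger0_norm ?enorm_ge0// ue.
by rewrite abse0 lee_fin.
Qed.

Lemma W1oo_norm_le (u v : R -> 'rV[R]_d) (e : R) : 0 <= e ->
  weak_derivative u v ->
  (forall t, 0 <= t <= 1 -> enorm (u t) <= e) ->
  (forall t, 0 <= t <= 1 -> enorm (v t) <= e) ->
  (W1oo_norm u <= (2 * e)%:E)%E.
Proof.
move=> e0 uv ue ve.
apply: (@le_trans _ _ (curve_Lnorm +oo u + curve_Lnorm +oo v)%E).
  by apply: ereal_inf_lbound; exists v.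
by rewrite mulr_natl mulr2n EFinD leeD// curve_Lnorm_oo_le.
Qed.

End WeakDerivative.

(** * Inscribed polygons approximate the curve *)

Section Interpolation.
Context {R : realType} {d : nat}.

(** The formula is evaluated at the fractional part of x; the pieces fit together
   at the integers because P n = P 0. *)
Lemma closed_interpolation n (P : nat -> 'rV[R]_d) : (0 < n)%N ->
  P n = P 0%N ->
  exists2 p : R -> 'rV[R]_d, periodic p 1 &
  forall i x, (i < n)%N -> i%:R / n%:R <= x -> x <= i.+1%:R / n%:R ->
    p x = P i + (n%:R * x - i%:R) *: (P i.+1 - P i).
Proof.
move=> n0 Pn; have nR : 0 < n%:R :> R by rewrite ltr0n.
pose y (x : R) := n%:R * (x - (Num.floor x)%:~R).
pose k x := Num.truncn (y x).
pose p x := P (k x) + (y x - (k x)%:R) *: (P (k x).+1 - P (k x)).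
have y1 x : y (x + 1) = y x.
  by rewrite /y floorDrz ?int_num1// floor1 intrD opprD addrACA subrr addr0.
have p1 : periodic p 1 by move=> x; rewrite /p /k y1.
have yE x : 0 <= x -> x < 1 -> y x = n%:R * x.
  move=> x0 x1; have -> : y x = n%:R * (x - 0%:~R).
    by rewrite /y; congr (_ * (_ - _%:~R)); apply: floor_def; rewrite x0/= add0r.
  by rewrite subr0.
exists p => // i x lti ix xi; rewrite ler_pdivrMr// in ix.
move: xi; rewrite le_eqVlt => /orP[/eqP xE|xi]; last first.
  have xi' := xi; rewrite ltr_pdivlMr// in xi'.
  have x0 : 0 <= x by rewrite -(pmulr_lge0 _ nR) (le_trans _ ix).
  have x1 : x < 1.
    by rewrite (lt_le_trans xi)// ler_pdivrMr// mul1r ler_nat.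
  have kE : k x = i.
    rewrite /k yE//; apply: truncn_def; rewrite mulrC ix/=.
    by rewrite xi'.
  by rewrite /p kE yE.
have nx : n%:R * x = i.+1%:R by rewrite xE mulrC divfK// gt_eqF.
have -> : n%:R * x - i%:R = 1 by rewrite nx -natr1 addrC addKr.
rewrite scale1r addrC subrK.
have [in1|] := ltnP i.+1 n.
  have x0 : 0 <= x by rewrite xE divr_ge0.
  have x1 : x < 1 by rewrite xE ltr_pdivrMr// mul1r ltr_nat.
  have kE : k x = i.+1.
    by rewrite /k yE// nx; apply: truncn_def; rewrite lexx ltr_nat/=.
  by rewrite /p kE yE// nx subrr scale0r addr0.
move=> nin; have inE : i.+1 = n by apply/eqP; rewrite eqn_leq lti.
have x1 : x = 1 by rewrite xE inE divff// gt_eqF.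
have k0 : k 0 = 0%N by rewrite /k yE// mulr0 truncn0.
by rewrite x1 -(add0r 1) p1 /p k0 yE// mulr0 subrr scale0r addr0 inE Pn.
Qed.

Lemma lipschitz_pieces n (f : R -> 'rV[R]_d) c : (0 < n)%N -> 0 <= c ->
  (forall i x y, (i < n)%N -> i%:R / n%:R <= x -> x <= y ->
     y <= i.+1%:R / n%:R -> enorm (f y - f x) <= c * (y - x)) ->
  forall x y, 0 <= x -> x <= y -> y <= 1 -> enorm (f y - f x) <= c * (y - x).
Proof.
move=> n0 c0 loc; have nR : 0 < n%:R :> R by rewrite ltr0n.
have H m : (m <= n)%N -> forall x y, 0 <= x -> x <= y -> y <= m%:R / n%:R ->
    enorm (f y - f x) <= c * (y - x).
  elim: m => [|m IH] mn x y x0 xy ym.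
    rewrite mul0r in ym; have -> : y = x by lra.
    by rewrite !subrr enorm0 mulr0.
  have [ym'|my] := leP y (m%:R / n%:R); first exact: IH (ltnW mn) _ _ x0 xy ym'.
  have [mx|xm] := leP (m%:R / n%:R) x; first exact: (loc m).
  rewrite (le_trans (enorm_distD (f (m%:R / n%:R)) _ _))//.
  have := loc m _ _ mn (lexx _) (ltW my) ym.
  have := IH (ltnW mn) _ _ x0 (ltW xm) (lexx _).
  lra.
move=> x y x0 xy y1; apply: (H n) => //.
by rewrite divff// gt_eqF.
Qed.

End Interpolation.

Lemma is_derive_affine {R : realType} (a b k n x : R) :
  is_derive x 1 (fun x : R => a + (n * x - k) * b) (n * b).
Proof.
rewrite (_ : (fun x : R => a + (n * x - k) * b) =
    (fun x : R => (n * b) *: x) + cst (a - k * b)); last first.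
  by apply/funext => y /=; rewrite fctE /= /GRing.scale/=; ring.
rewrite -[X in is_derive _ _ _ X]addr0; apply: is_deriveD.
by rewrite -[X in is_derive _ _ _ X]mulr1; apply: is_deriveZ.
Qed.

Section InscribedPolygon.
Context {R : realType} {d : nat}.
Variable g : R -> 'rV[R]_d.
Hypotheses (g_closed : simple_closed_curve g) (g_arc : arc_length_parametrized g)
  (g_C1 : C1 g).

(** The polygon with vertices g (t i) has n edges of length r; it is rescaled
   to length 1. *)
Definition vertex (n : nat) (r : R) (t : nat -> R) i : 'rV[R]_d :=
  (n%:R * r)^-1 *: g (t i).

(** The polygon p has its vertices at the parameters i / n. Before rescaling they
   are the points g (t i) of the curve, and consecutive ones are at distance r.
   The bound by 2 r on the gaps expresses that the chords are comparable with the
   arcs. *)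
Record inscribed (n : nat) (r : R) (t : nat -> R) (p : R -> 'rV[R]_d) : Prop :=
  Inscribed {
  inscribed_n_gt0 : (0 < n)%N;
  inscribed_r_gt0 : 0 < r;
  inscribed_r_le : r <= n%:R^-1;
  inscribed_t0 : t 0%N = 0;
  inscribed_shift : forall i, t (i + n)%N = t i + 1;
  inscribed_gap : forall i, r <= t i.+1 - t i <= 2 * r;
  inscribed_chord : forall i, enorm (g (t i.+1) - g (t i)) = r;
  inscribed_periodic : periodic p 1;
  inscribed_affine : forall i x, (i < n)%N ->
    i%:R / n%:R <= x -> x <= i.+1%:R / n%:R ->
    p x = vertex n r t i + (n%:R * x - i%:R) *: (vertex n r t i.+1 - vertex n r t i)
}.

Let g_periodic : periodic g 1. Proof. by case: g_closed. Qed.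

Let g_lip x y : enorm (g y - g x) <= `|y - x|.
Proof.
exact: le_trans (arc_length_circle _ _ g_arc g_periodic) (circle_dist_le_norm _ _).
Qed.

Lemma exists_inscribed : exists N, forall n, (N <= n)%N ->
  exists r t p, inscribed n r t p.
Proof.
have [delta d0 slope] := C1_chord_slope g_periodic g_C1 g_arc.
have d2 : 0 < delta / 2 by rewrite divr_gt0.
exists (Num.truncn (delta / 2)^-1).+1 => n Nn.
have n0 : (0 < n)%N by exact: leq_trans Nn.
have nR : 0 < n%:R :> R by rewrite ltr0n.
have nd : n%:R^-1 <= delta / 2.
  rewrite invf_ple ?posrE// ltW// (lt_le_trans (truncnS_gt _))// ler_nat//.
have [r [t [r0 rn [t0 tn] gap chord]]] :=
  inscribed_equilateral g_periodic d0 g_lip slope n0 nd.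
have [|p pp aff] := @closed_interpolation R d n (vertex n r t) n0.
  by rewrite /vertex -(add0n n) tn g_periodic.
by exists r, t, p.
Qed.

Lemma C1_tangents_close (e : R) : 0 < e -> exists2 delta : R, 0 < delta &
  forall x y : R, `|y - x| <= delta -> enorm (derive1 g y - derive1 g x) <= e.
Proof.
move=> e0; have e1 : 0 < e / d.+1%:R by rewrite divr_gt0.
have [delta d0 H] := C1_unif_continuous g_periodic g_C1 e1; exists delta => // x y xy.
rewrite (le_trans (enorm_le_normr _))// (@le_trans _ _ (d.+1%:R * (e / d.+1%:R)))//.
  by rewrite ler_pM// ?ler_nat// H.
by rewrite mulrC divfK// pnatr_eq0.
Qed.

Section Fixed.
Variables (n : nat) (r : R) (t : nat -> R) (p : R -> 'rV[R]_d).
Hypothesis ins : inscribed n r t p.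

Let n0 := inscribed_n_gt0 ins.
Let nR : 0 < n%:R :> R. Proof. by rewrite ltr0n. Qed.
Let r0 := inscribed_r_gt0 ins.

Definition edge_direction i : 'rV[R]_d := r^-1 *: (g (t i.+1) - g (t i)).

Lemma edge_direction_unit i : enorm (edge_direction i) = 1.
Proof.
by rewrite enormZ (inscribed_chord ins) gtr0_norm ?invr_gt0// mulVf// gt_eqF.
Qed.

Lemma inscribed_increment i x y : (i < n)%N -> i%:R / n%:R <= x -> x <= y ->
  y <= i.+1%:R / n%:R -> p y - p x = (y - x) *: edge_direction i.
Proof.
move=> lti ix xy yi.
rewrite !(inscribed_affine ins lti)//; try by [exact: le_trans yi|exact: le_trans xy].
rewrite opprD addrACA subrr add0r -scalerBl /vertex -scalerBr !scalerA.
rewrite opprD addrACA addrN addr0 -mulrBr; congr (_ *: _).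
by field; rewrite gt_eqF//= pnatr_eq0 -lt0n.
Qed.

Lemma inscribed_lipschitz x y : enorm (p y - p x) <= circle_dist x y.
Proof.
rewrite -[leRHS]mul1r; apply: lipschitz_circle => //.
  exact: inscribed_periodic ins.
apply: (lipschitz_pieces n0) => // i u v lti iu uv vi.
by rewrite (inscribed_increment lti)// enormZ edge_direction_unit mulr1 mul1r
  ger0_norm ?subr_ge0.
Qed.

Lemma inscribed_arc_length : arc_length_parametrized p.
Proof.
apply: (arc_length_piecewise n0) => [x y|i x y lti ix xy yi].
  exact: le_trans (inscribed_lipschitz x y) (circle_dist_le_norm _ _).
by rewrite (inscribed_increment lti)// enormZ edge_direction_unit mulr1
  ger0_norm ?subr_ge0.
Qed.

Lemma inscribed_continuous : continuous p.
Proof.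
apply: (enorm_lipschitz_continuous (c := 1)) => x y; rewrite mul1r.
exact: le_trans (inscribed_lipschitz x y) (circle_dist_le_norm _ _).
Qed.

Lemma inscribed_vertex i : p (i%:R / n%:R) = vertex n r t i.
Proof.
have H j : (j < n)%N -> p (j%:R / n%:R) = vertex n r t j.
  move=> ltj; rewrite (inscribed_affine ins ltj) ?lexx//; last first.
    by rewrite ler_pM2r ?invr_gt0// ler_nat.
  by rewrite mulrC divfK ?gt_eqF// subrr scale0r addr0.
rewrite (divn_eq i n); elim: (i %/ n)%N => [|k IH].
  by rewrite mul0n add0n H// ltn_mod.
rewrite mulSn -addnA addnC natrD mulrDl divff ?gt_eqF//.
by rewrite (inscribed_periodic ins) IH /vertex (inscribed_shift ins) g_periodic.
Qed.

Lemma inscribed_equilateral_parameters :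
  equilateral_parameters n p (fun i => i%:R / n%:R).
Proof.
have edge i : vertex n r t i.+1 - vertex n r t i =
    n%:R^-1 *: edge_direction i.
  rewrite /vertex -scalerBr scalerA; congr (_ *: _).
  by field; rewrite gt_eqF//= pnatr_eq0 -lt0n.
split; last first.
  by move=> i j; rewrite /edge_length !inscribed_vertex !edge !(enormZ n%:R^-1)
    !edge_direction_unit.
split.
- by move=> i; rewrite natrD mulrDl divff// gt_eqF.
- by move=> i; rewrite ltr_pM2r ?invr_gt0// ltr_nat.
- by rewrite mul0r.
- by rewrite ltr_pdivrMr// mul1r ltr_nat prednK.
move=> i x x0 x1; rewrite !inscribed_vertex.
have E : (1 - x) * (i%:R / n%:R) + x * (i.+1%:R / n%:R) = (i%:R + x) / n%:R.
  by rewrite -natr1; field; rewrite gt_eqF.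
rewrite E {E}; have H j : (j < n)%N ->
    p ((j%:R + x) / n%:R) = (1 - x) *: vertex n r t j + x *: vertex n r t j.+1.
  move=> ltj; rewrite (inscribed_affine ins ltj).
  - rewrite mulrC divfK ?gt_eqF// (_ : j%:R + x - j%:R = x); last by lra.
    by rewrite scalerBr scalerBl scale1r addrA addrAC.
  - by rewrite ler_pM2r ?invr_gt0// lerDl.
  - by rewrite ler_pM2r ?invr_gt0// -natr1 lerD2l.
rewrite (divn_eq i n); elim: (i %/ n)%N => [|k IH].
  by rewrite mul0n add0n H// ltn_mod.
rewrite mulSn -addnA addnC natrD addrAC mulrDl divff ?gt_eqF//.
rewrite (inscribed_periodic ins) IH /vertex -[(_ + n)%N.+1]addSn !(inscribed_shift ins).
by rewrite !g_periodic.
Qed.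

(** If the chords are almost as long as the arcs, then i * r is both at most t i
   and almost t i; for i = n this says that the polygon has length almost 1, and
   division by n * r compares t i with i / n. *)
Lemma inscribed_parameters (e : R) : 0 < e -> e <= 2^-1 ->
  (forall i, (1 - e) * (t i.+1 - t i) <= r) ->
  [/\ 1 - e <= n%:R * r, n%:R * r <= 1 &
      forall i, (i <= n)%N -> `|t i - i%:R / n%:R| <= 2 * e].
Proof.
move=> e0 e1 gap.
have B i : i%:R * r <= t i /\ (1 - e) * t i <= i%:R * r.
  elim: i => [|i [h1 h2]]; first by rewrite (inscribed_t0 ins) mul0r mulr0.
  have /andP[h3 _] := inscribed_gap ins i; have h4 := gap i.
  by rewrite -natr1 mulrDl mul1r; split; lra.
have tn : t n = 1 by have := inscribed_shift ins 0; rewrite add0n (inscribed_t0 ins) add0r.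
have nr : 1 - e <= n%:R * r by have [_] := B n; rewrite tn mulr1.
have nr1 : n%:R * r <= 1 by have [] := B n; rewrite tn.
split => // i ltin; have [h1 h2] := B i.
have i1 : i%:R / n%:R <= 1 :> R by rewrite ler_pdivrMr// mul1r ler_nat.
have i0 : 0 <= i%:R / n%:R :> R by rewrite divr_ge0.
have E : i%:R * r = (i%:R / n%:R) * (n%:R * r) by field; rewrite gt_eqF.
rewrite E in h1 h2; set a := i%:R / n%:R in i0 i1 h1 h2 *.
set b := n%:R * r in nr nr1 h1 h2.
have h3 : a * (1 - e) <= a * b by rewrite ler_wpM2l.
have h4 : a * b <= a by rewrite ler_piMr.
have h5 : a * e <= e by rewrite ler_piMl// ltW.
have h6 : t i <= 2 * a.
  have h7 : 2^-1 * t i <= (1 - e) * t i.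
    rewrite ler_wpM2r//; last by lra.
    by rewrite (le_trans _ h1)// mulr_ge0//; lra.
  lra.
have h8 : e * t i <= e * 2.
  by rewrite ler_pM2l// (le_trans h6)//; lra.
by rewrite ler_norml; apply/andP; split; lra.
Qed.

End Fixed.

(** The edge i is a chord of the curve from t i, hence almost parallel to the
   tangent there, and the parameters in [i / n, (i + 1) / n] are close to t i. *)
Lemma inscribed_direction_close (e : R) : 0 < e -> e <= 2^-1 ->
  exists N, forall n r t p, inscribed n r t p -> (N <= n)%N ->
  [/\ 1 - e <= n%:R * r, n%:R * r <= 1,
      (forall i, (1 - e) * (t i.+1 - t i) <= r),
      (forall i, (i <= n)%N -> `|t i - i%:R / n%:R| <= e) &
      forall i x, (i < n)%N -> i%:R / n%:R <= x -> x <= i.+1%:R / n%:R ->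
        enorm (edge_direction r t i - derive1 g x) <= e].
Proof.
move=> e0 e1; have e8 : 0 < e / 8 by rewrite divr_gt0.
have e78 : 3 / 4 * e + e / 8 <= e by lra.
have [dl dl0 lin] := C1_near_linear g_periodic g_C1 e8.
have [dt dt0 tan] := C1_tangents_close e8.
pose e2 := Num.min (e / 4) (Num.min dl dt / 4).
have e20 : 0 < e2 by rewrite lt_min !divr_gt0// lt_min dl0.
have [e2e [e2l e2t]] : e2 <= e / 4 /\ e2 <= dl / 4 /\ e2 <= dt / 4.
  split; first by rewrite ge_min lexx.
  split; rewrite ge_min; apply/orP; right; rewrite ler_pM2r ?invr_gt0//;
    by rewrite ge_min lexx ?orbT.
have [dc dc0 ch] := C1_chord_ge g_periodic g_C1 g_arc e20.
pose m := Num.min dc (Num.min dl dt) / 2.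
have m0 : 0 < m by rewrite divr_gt0// !lt_min dc0 dl0.
have [mc [ml mt]] : m <= dc / 2 /\ m <= dl / 2 /\ m <= dt / 2.
  by rewrite /m !ler_pM2r ?invr_gt0// !ge_min !lexx ?orbT.
have [N _ HN] := near_inv_lt (divr_gt0 m0 (ltr0n R 2)).
exists N => n r t p ins Nn.
have n0 := inscribed_n_gt0 ins; have nR : 0 < n%:R :> R by rewrite ltr0n.
have r0 := inscribed_r_gt0 ins; have rn := inscribed_r_le ins.
have nm : n%:R^-1 < m / 2 by exact: HN.
have gap i : 0 <= t i.+1 - t i /\ t i.+1 - t i <= m.
  by have /andP[] := inscribed_gap ins i; lra.
have chord i : (1 - e2) * (t i.+1 - t i) <= r.
  rewrite -(inscribed_chord ins i); have [h1 h2] := gap i.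
  by apply: ch; lra.
have [||P1 P2 P3] := @inscribed_parameters n r t p ins e2 _ _ chord; [lra|lra|].
split => //.
- lra.
- move=> i; rewrite (le_trans _ (chord i))// ler_wpM2r ?(gap i).1//; lra.
- by move=> i lein; rewrite (le_trans (P3 i lein))//; lra.
move=> i x lti ix xi.
have xt : `|t i - x| <= dt.
  have := P3 i (ltnW lti); have xi' : x <= i%:R / n%:R + n%:R^-1.
    by rewrite -[X in _ + X]mul1r -mulrDl natr1.
  by rewrite !ler_norml; lra.
have [h1 h2] := gap i; set G := t i.+1 - t i in h1 h2.
have L : enorm (g (t i.+1) - g (t i) - G *: derive1 g (t i)) <= e / 8 * G.
  have ti : t i <= t i.+1 by rewrite -subr_ge0.
  apply: lin => //; first by rewrite subrr normr0 ltW.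
  by rewrite -/G ger0_norm//; lra.
have gr : G <= 2 * r.
  have := chord i; rewrite -/G.
  have : e2 * G <= 2^-1 * G by rewrite ler_wpM2r//; lra.
  lra.
have Gr : `|G - r| <= e2 * (2 * r).
  have := chord i; rewrite -/G; have /andP[rG _] := inscribed_gap ins i; rewrite -/G in rG.
  have : e2 * G <= e2 * (2 * r) by rewrite ler_pM2l.
  by rewrite ger0_norm; lra.
have D : enorm (edge_direction r t i - derive1 g (t i)) <= 3 / 4 * e.
  have -> : edge_direction r t i - derive1 g (t i) =
      r^-1 *: ((g (t i.+1) - g (t i) - G *: derive1 g (t i))
               + (G - r) *: derive1 g (t i)).
    by apply/rowP => j; rewrite /edge_direction !mxE; field; rewrite gt_eqF.
  rewrite enormZ ger0_norm ?invr_ge0 ?(ltW r0)// ler_pdivrMl//.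
  rewrite (le_trans (enormD _ _))// enormZ (arc_length_derive1 g_periodic g_C1 g_arc) mulr1.
  have h3 : e2 * r <= e / 4 * r by rewrite ler_pM2r.
  have h4 : e * G <= e * (2 * r) by rewrite ler_pM2l.
  lra.
rewrite (le_trans (enorm_distD (derive1 g (t i)) _ _))//.
exact: le_trans (lerD D (tan x (t i) xt)) e78.
Qed.

(** The velocity of p - g is the difference of an edge direction and a tangent,
   which is small; the value at the base point is small since the rescaling
   factor is close to 1. The bound in W^(1, oo) gives the convergence of the
   recovery sequence, and the Lipschitz bound gives its knot class. *)
Lemma inscribed_close (e : R) : 0 < e ->
  exists N, forall n r t p, inscribed n r t p -> (N <= n)%N ->
  (forall x y, enorm ((p y - g y) - (p x - g x)) <= e * circle_dist x y) /\
  (W1oo_norm (p \- g)%R <= e%:E)%E.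
Proof.
move=> e0; pose G0 := 2 * (enorm (g 0) + 1).
have G00 : 2 <= G0 by have := enorm_ge0 (g 0); rewrite /G0; lra.
pose e1 := Num.min 2^-1 (e / (8 * G0)).
have e10 : 0 < e1 by rewrite lt_min invr_gt0 ltr0n/= divr_gt0// mulr_gt0//; lra.
have e1h : e1 <= 2^-1 by rewrite ge_min lexx.
have e1e : e1 * G0 <= e / 8.
  have : e1 <= e / (8 * G0) by rewrite ge_min lexx orbT.
  by rewrite ler_pdivlMr; [lra|rewrite mulr_gt0//; lra].
have e1e' : e1 * 2 <= e / 8 by rewrite (le_trans _ e1e)// ler_pM2l.
have [N1 H1] := inscribed_direction_close e10 e1h.
have [delta d0 lin] := C1_near_linear g_periodic g_C1 e10.
have [N2 _ H2] := near_inv_lt d0.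
exists (maxn N1 N2) => n r t p ins; rewrite geq_max => /andP[N1n N2n].
have n0 := inscribed_n_gt0 ins; have nR : 0 < n%:R :> R by rewrite ltr0n.
have nd : n%:R^-1 < delta by exact: H2.
have [nr nr1 _ _ dir] := H1 n r t p ins N1n.
have lip : forall x y, enorm ((p y - g y) - (p x - g x)) <= (2 * e1) * circle_dist x y.
  apply: (@lipschitz_circle _ _ _ (fun x => p x - g x)).
  - by rewrite mulr_ge0// ltW.
  - by move=> x; rewrite g_periodic (inscribed_periodic ins).
  apply: (lipschitz_pieces n0); first by rewrite mulr_ge0// ltW.
  move=> i x y lti ix xy yi.
  have xi : x <= i.+1%:R / n%:R by exact: le_trans yi.
  have yx : y - x <= delta.
    by move: yi; rewrite -natr1 mulrDl mul1r; lra.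
  have -> : p y - g y - (p x - g x) =
      (y - x) *: (edge_direction r t i - derive1 g x)
      - (g y - g x - (y - x) *: derive1 g x).
    rewrite opprD addrACA (inscribed_increment ins lti)// scalerBr.
    by apply/rowP => j; rewrite !mxE; ring.
  rewrite (le_trans (enormD _ _))// enormN enormZ ger0_norm ?subr_ge0//.
  have := lin x x y; rewrite subrr normr0 ger0_norm ?subr_ge0//.
  move=> /(_ (ltW d0) yx xy).
  have : (y - x) * enorm (edge_direction r t i - derive1 g x) <= (y - x) * e1.
    by rewrite ler_wpM2l ?subr_ge0// dir.
  lra.
split.
  move=> x y; rewrite (le_trans (lip x y))// ler_wpM2r ?circle_dist_ge0//.
  by lra.
have p0 : enorm (p 0 - g 0) <= e / 4.
  have -> : p 0 - g 0 = ((n%:R * r)^-1 - 1) *: g 0.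
    have -> : (0 : R) = 0%:R / n%:R by rewrite mul0r.
    by rewrite (inscribed_vertex ins) /vertex (inscribed_t0 ins) mul0r scalerBl scale1r.
  have L0 : 0 < n%:R * r by lra.
  have L1 : 0 <= (n%:R * r)^-1 - 1 by rewrite subr_ge0 invf_ge1.
  have L2 : (n%:R * r)^-1 <= 1 + 2 * e1.
    rewrite -[leLHS]mul1r ler_pdivrMr//.
    have : (1 + 2 * e1) * (1 - e1) <= (1 + 2 * e1) * (n%:R * r).
      by rewrite ler_wpM2l//; lra.
    have : e1 * e1 <= e1 * 2^-1 by rewrite ler_pM2l.
    lra.
  rewrite enormZ (ger0_norm L1).
  have : ((n%:R * r)^-1 - 1) * enorm (g 0) <= 2 * e1 * enorm (g 0).
    by rewrite ler_wpM2r ?enorm_ge0//; lra.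
  have : e1 * G0 = 2 * e1 * enorm (g 0) + 2 * e1 by rewrite /G0; ring.
  lra.
have u_le x : enorm (p x - g x) <= e / 2.
  rewrite -[X in enorm X](subrK (p 0 - g 0)) (le_trans (enormD _ _))//.
  have := lip 0 x; have := circle_dist_le_half 0 x.
  have : e1 * circle_dist 0 x <= e1 * 2^-1 by rewrite ler_pM2l// circle_dist_le_half.
  lra.
(* The derivative of p - g off the vertices; at x = 1 the integer part of n * x
   would be n, which is the index of no edge. *)
pose v x := if x < 1 then edge_direction r t (Num.truncn (n%:R * x)) - derive1 g x
  else 0.
have vE i x : (i < n)%N -> cell (fun i => i%:R / n%:R) i x ->
    v x = edge_direction r t i - derive1 g x.
  move=> lti; rewrite /cell /= in_itv/= => /andP[ix xi]; rewrite /v ifT; last first.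
    by rewrite (lt_le_trans xi)// ler_pdivrMr// mul1r ler_nat.
  have -> // : Num.truncn (n%:R * x) = i.
  rewrite ler_pdivrMr// in ix; rewrite ltr_pdivlMr// in xi.
  by apply: truncn_def; rewrite mulrC ix.
rewrite (_ : e = 2 * (e / 2)); last by rewrite mulrC divfK.
apply: (@W1oo_norm_le _ _ _ v); first by rewrite divr_ge0// ltW.
- pose P := vertex n r t.
  apply: (@weak_derivative_piecewise _ _ n _ _
    (fun k x => P k + (n%:R * x - k%:R) *: (P k.+1 - P k) - g x)
    (fun k x => edge_direction r t k - derive1 g x) (fun k => k%:R / n%:R)).
  + by rewrite mul0r.
  + by rewrite divff// gt_eqF.
  + by move=> k; rewrite ltr_pM2r ?invr_gt0// ltr_nat.
  + by rewrite /= -(add0r 1) (inscribed_periodic ins) g_periodic.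
  + move=> k i x.
    have -> : (edge_direction r t k - derive1 g x) ord0 i =
        n%:R * (P k.+1 - P k) ord0 i - derive1 g x ord0 i.
      rewrite /P /vertex -scalerBr /edge_direction; rewrite !mxE; congr (_ - _).
      by field; rewrite !gt_eqF// (inscribed_r_gt0 ins).
    rewrite (_ : (fun _ => _) = (fun x => P k ord0 i
        + (n%:R * x - k%:R) * (P k.+1 - P k) ord0 i) - (fun x => g x ord0 i)).
      by apply: is_deriveB; [exact: is_derive_affine|exact: C1_coord_derive].
    by apply/funext => y; rewrite fctE !mxE.
  + move=> k i; have [_ ctau] := g_C1.
    rewrite (_ : (fun _ => _) =
        (fun x => edge_direction r t k ord0 i - derive1 g x ord0 i)); last first.
      by apply/funext => y; rewrite !mxE.
    move=> y; apply: cvgB; first exact: cvg_cst.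
    exact: continuous_coord.
  + move=> k x ltk /andP[kx xk].
    by rewrite /= (inscribed_affine ins ltk).
  + exact: vE.
- by move=> x _; exact: u_le.
move=> x /andP[x0 x1]; have [x1'|x1'] := ltP x 1; last first.
  by rewrite /v ltNge x1'/= enorm0 divr_ge0// ltW.
have [i lti ix] : exists2 i, (i < n)%N & cell (fun i => i%:R / n%:R) i x.
  by apply: cell_exists; [rewrite mul0r|rewrite divff// gt_eqF].
rewrite (vE i x lti ix); move: ix; rewrite /cell /= in_itv/= => /andP[ix xi].
by rewrite (le_trans (dir i x lti ix (ltW xi)))//; lra.
Qed.

End InscribedPolygon.

(** * Inscribed polygons in the knot class and their discrete energies *)

Section InscribedClass.
Context {R : realType} {d : nat}.
Variable g : R -> 'rV[R]_d.
Hypotheses (g_closed : simple_closed_curve g) (g_arc : arc_length_parametrized g)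
  (g_C1 : C1 g).

Let g_periodic : periodic g 1. Proof. by case: g_closed. Qed.

Lemma simple_closed_inj s t : 0 <= s < 1 -> 0 <= t < 1 -> g s = g t -> s = t.
Proof.
move=> s01 t01; have [_ _ inj] := g_closed.
by apply: inj; rewrite inE/= in_itv/=.
Qed.

Lemma simple_closed_bilipschitz : exists2 kappa : R, 0 < kappa &
  forall s t : R, kappa * circle_dist s t <= enorm (g t - g s).
Proof. exact: C1_bilipschitz g_periodic g_C1 g_arc simple_closed_inj. Qed.

(** Chords and arcs of g are comparable, so a difference p - g that is Lipschitz
   with a small constant along arcs is also so along chords. This gives the
   isotopy from g to p; it also keeps p injective. *)
Lemma inscribed_polygons (K : set (R -> 'rV[R]_d)) : tame_knot_class K -> K g ->
  exists N, forall n r t p, inscribed g n r t p -> (N <= n)%N -> polygons K n p.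
Proof.
move=> [q [_ _ ->]] [_ iso_qg].
have [kappa k0 bil] := simple_closed_bilipschitz.
(* The sup norm and the Euclidean norm differ by a factor of at most d + 1. *)
pose e := kappa / (2 * d.+1%:R).
have e0 : 0 < e by rewrite divr_gt0// mulr_gt0.
have ek : e <= kappa / 2.
  by rewrite /e invfM mulrA ler_piMr ?divr_ge0 ?(ltW k0)// invf_le1// ler1n.
have [N HN] := inscribed_close g_closed g_arc g_C1 e0.
exists N => n r t p ins Nn; have [lip _] := HN n r t p ins Nn.
have iso_gp : ambient_isotopic (range g) (range p).
  apply: (@ambient_isotopic_perturbation _ _ _ _ 2^-1) => // [|s t'].
    by rewrite invf_lt1// ltr1n.
  rewrite (le_trans (normr_le_enorm _))// (le_trans (lip s t'))//.
  have := enorm_le_normr (g t' - g s); have := bil s t'.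
  set N1 := `|g t' - g s|; set N2 := enorm _; set cd := circle_dist _ _ => h1 h2.
  have N10 : 0 <= N1 by exact: normr_ge0.
  rewrite /e mulrAC ler_pdivrMr ?mulr_gt0// (le_trans h1)// (le_trans h2)//.
  rewrite (_ : 2^-1 * N1 * (2 * d.+1%:R) = d.+1%:R * N1); last by field.
  by rewrite ler_wpM2r// ler_nat.
have close s t' : enorm (g t' - g s) <= enorm (p t' - p s) + e * circle_dist s t'.
  have h1 := lip s t'; have h2 := enorm_sub_le (g t' - g s) (p t' - p s).
  have E : enorm (g t' - g s - (p t' - p s)) = enorm (p t' - g t' - (p s - g s)).
    by rewrite -enormN; congr enorm; apply/rowP => j; rewrite !mxE; lra.
  by rewrite E in h2; lra.
have p_closed : simple_closed_curve p.
  split; [exact: inscribed_periodic ins|exact: inscribed_continuous ins|].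
  move=> s t'; rewrite !inE/= !in_itv/= => s01 t01 pst.
  apply: simple_closed_inj => //; apply/eqP; rewrite eq_sym -subr_eq0.
  have := close s t'; rewrite pst subrr enorm0 add0r => h1; have h2 := bil s t'.
  have h3 : e * circle_dist s t' <= kappa / 2 * circle_dist s t'.
    by rewrite ler_wpM2r ?circle_dist_ge0.
  by apply/eqP/enorm_eq0/eqP; rewrite eq_le enorm_ge0 andbT; lra.
split; last first.
  by exists (fun i => i%:R / n%:R); exact: inscribed_equilateral_parameters ins.
split => //; first exact: inscribed_arc_length ins.
by split => //; exact: ambient_isotopic_trans iso_gp.
Qed.

Section Fixed.
Variables (n : nat) (r : R) (t : nat -> R) (p : R -> 'rV[R]_d).
Hypothesis ins : inscribed g n r t p.

Let n0 := inscribed_n_gt0 ins.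
Let nR : 0 < n%:R :> R. Proof. by rewrite ltr0n. Qed.
Let r0 := inscribed_r_gt0 ins.

Lemma inscribed_increasing i j : (i <= j)%N -> (j - i)%:R * r <= t j - t i.
Proof.
move=> ij; rewrite -{2}(subnK ij); elim: (j - i)%N => [|m IH].
  by rewrite mul0r add0n subrr.
have /andP[h _] := inscribed_gap ins (m + i).
by rewrite addSn -natr1 mulrDl mul1r; lra.
Qed.

Lemma inscribed_mono i j : (i <= j)%N -> t i <= t j.
Proof.
move=> ij; rewrite -subr_ge0 (le_trans _ (inscribed_increasing ij))//.
by rewrite mulr_ge0// ltW.
Qed.

Lemma inscribed_tn : t n = 1.
Proof. by have := inscribed_shift ins 0; rewrite add0n (inscribed_t0 ins) add0r. Qed.

Lemma inscribed_t01 i : (i < n)%N -> 0 <= t i < 1.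
Proof.
move=> lti; rewrite -{1}(inscribed_t0 ins) inscribed_mono//=.
have /andP[h _] := inscribed_gap ins i; have := r0.
by have := inscribed_mono (lti : (i.+1 <= n)%N); rewrite inscribed_tn; lra.
Qed.

(** The arcs between consecutive vertices have length at least r, so an arc with
   m steps has length at least m * r. *)
Lemma inscribed_circle_dist i j :
  n%:R * r * circle_dist (i%:R / n%:R) (j%:R / n%:R) <= circle_dist (t i) (t j).
Proof.
apply: le_circle_dist => k.
have L0 : 0 <= n%:R * r by rewrite mulr_ge0 ?ltW.
rewrite (le_trans (ler_wpM2l L0 (circle_dist_le k _ _)))//.
have shift i' m : t (i' + m * n)%N = t i' + m%:R.
  elim: m => [|m IH]; first by rewrite mul0n addn0 addr0.
  by rewrite mulSn addnCA addnC (inscribed_shift ins) IH -natr1 addrA.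
have dist a b : r * `|a%:R - b%:R| <= `|t a - t b|.
  wlog ba : a b / (b <= a)%N.
    by move=> H; have [/H//|/ltnW/H] := leqP b a; rewrite distrC (distrC (t b)).
  have := inscribed_increasing ba; rewrite natrB// => h.
  rewrite !ger0_norm ?subr_ge0 ?ler_nat ?inscribed_mono//.
  by rewrite mulrC.
have E (x : R) : n%:R * r * `|x| = r * `|n%:R * x|.
  by rewrite normrM (gtr0_norm nR) mulrCA mulrA.
(* The lift by k turns is made by m * n further steps of the point j or i. *)
rewrite E; case: k => m.
  have := dist (j + m * n)%N i; rewrite shift addrAC; apply: le_trans.
  rewrite ler_wpM2l ?(ltW r0)// le_eqVlt; apply/orP; left; apply/eqP.
  congr `|_|; rewrite natrD natrM; field.
  by rewrite gt_eqF.
have := dist j (i + m.+1 * n)%N; rewrite shift opprD addrA NegzE intrN.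
apply: le_trans; rewrite ler_wpM2l ?(ltW r0)// le_eqVlt; apply/orP; left.
apply/eqP; congr `|_|; rewrite natrD natrM -[m.+1%:~R]/(m.+1%:R); field.
by rewrite gt_eqF.
Qed.

Variables (alpha q : R).
Hypotheses (alpha_gt0 : 0 < alpha) (q_ge1 : 1 <= q) (alq_ge2 : 2 <= alpha * q).

Let vertices_distinct i j : (i < n)%N -> (j < n)%N -> i != j ->
  0 < enorm (g (t j) - g (t i)).
Proof.
move=> lti ltj ij; rewrite enorm_gt0// subr_eq0; apply: contra_neqN ij => /eqP E.
have tij := simple_closed_inj (inscribed_t01 ltj) (inscribed_t01 lti) E.
have strict a b : (a < b)%N -> t a < t b.
  move=> ab; have /andP[h _] := inscribed_gap ins a.
  by have := inscribed_mono ab; have := r0; lra.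
by have [/strict|/strict|//] := ltngtP i j; rewrite tij ltxx.
Qed.

(** Each term of the discrete energy is at most the term of a Riemann sum of the
   energy of the curve: the chords are the same up to scaling, the arcs of the
   polygon are shorter, and the scaling factor n r <= 1 enters with the exponent
   alpha * q - 2 >= 0. *)
Lemma inscribed_energy_density_le i j : (i < n)%N -> (j < n)%N -> i != j ->
  energy_density alpha q p (i%:R / n%:R) (j%:R / n%:R) * n%:R^-1 * n%:R^-1 <=
  energy_density alpha q g (t i) (t j) * r * r.
Proof.
move=> lti ltj ij; pose L := n%:R * r.
have L0 : 0 < L by rewrite mulr_gt0.
have L1 : L <= 1.
  by rewrite /L mulrC -ler_pdivlMr// mul1r; exact: inscribed_r_le ins.
pose c := enorm (g (t j) - g (t i)).
have c0 : 0 < c by exact: vertices_distinct.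
have cl : c <= circle_dist (t i) (t j) by exact: arc_length_circle.
have pc : enorm (p (j%:R / n%:R) - p (i%:R / n%:R)) = c / L.
  rewrite !(inscribed_vertex g_closed ins) /vertex -scalerBr enormZ.
  by rewrite ger0_norm ?invr_ge0 ?ltW// mulrC.
have arcp : c / L <= circle_dist (i%:R / n%:R) (j%:R / n%:R).
  by rewrite -pc; exact: inscribed_lipschitz ins _ _.
have D : energy_density alpha q p (i%:R / n%:R) (j%:R / n%:R) <=
    L ^+ 2 * energy_density alpha q g (t i) (t j).
  rewrite !energy_densityE pc -/c.
  have cL : 0 < c / L by rewrite divr_gt0.
  apply: (@le_trans _ _ (kernel alpha q (c / L) (circle_dist (t i) (t j) / L))).
    apply: kernel_mono => //; rewrite lerD2l lerN2 invpowR_le//.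
      exact: lt_le_trans arcp.
    by rewrite ler_pdivlMr// mulrC inscribed_circle_dist.
  rewrite kernel_scale// ler_wpM2r ?kernel_ge0//.
  by rewrite -powR_mulrn ?(ltW L0)// ger_powR// L0 L1.
rewrite -!mulrA (le_trans (ler_wpM2r _ D)) ?mulr_ge0 ?invr_ge0//.
rewrite mulrAC le_eqVlt; apply/orP; left; apply/eqP; rewrite mulrC.
by congr (_ * _); rewrite /L; field; rewrite gt_eqF.
Qed.

Lemma inscribed_energy_le K : polygons K n p ->
  (discrete_energy K alpha q n p <= (alpha^-1 * \sum_(i < n) \sum_(j < n)
     energy_density alpha q g (t i) (t j) * r * r)%:E)%E.
Proof.
move=> Kp.
rewrite (discrete_energyE alpha q Kp (inscribed_equilateral_parameters g_closed ins)).
rewrite lee_fin ler_wpM2l ?invr_ge0 ?(ltW alpha_gt0)//.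
apply: ler_sum => i _; rewrite [leRHS](bigD1 i)//= ler_wpDl//.
  by rewrite energy_density_diag// !mul0r.
apply: ler_sum => j ji; apply: inscribed_energy_density_le => //.
by rewrite eq_sym.
Qed.

End Fixed.
End InscribedClass.

(** * The upper bound *)

Lemma sum_shift_period (R : nmodType) n (F : nat -> nat -> R) :
  (forall j, (j < n)%N -> F n j = F 0%N j) ->
  \sum_(i < n) \sum_(j < n) F i.+1 j = \sum_(i < n) \sum_(j < n) F i j.
Proof.
case: n F => [|n] F wrap; first by rewrite !big_ord0.
rewrite big_ord_recr [RHS]big_ord_recl/= addrC; congr (_ + _).
by apply: eq_bigr => j _; exact: wrap.
Qed.

Lemma sum_shift_period_sym (R : nmodType) n (F : nat -> nat -> R) :
  (forall j, (j < n)%N -> F n j = F 0%N j) ->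
  \sum_(i < n) \sum_(j < n) (F i.+1 j + F j.+1 i) =
  \sum_(i < n) \sum_(j < n) (F i j + F j i).
Proof.
move=> wrap; have sym (G : nat -> nat -> R) :
    \sum_(i < n) \sum_(j < n) (G i j + G j i) =
    \sum_(i < n) \sum_(j < n) G i j + \sum_(i < n) \sum_(j < n) G i j.
  rewrite [X in _ = _ + X]exchange_big -big_split/=.
  by apply: eq_bigr => i _; rewrite -big_split.
by rewrite (sym (fun i j => F i.+1 j)) (sym F) (sum_shift_period wrap).
Qed.

Section UpperBound.
Context {R : realType} {d : nat}.
Local Notation mu := (@lebesgue_measure R).
Local Notation mu2 := (mu \x mu)%E.
Variable g : R -> 'rV[R]_d.
Hypotheses (g_closed : simple_closed_curve g) (g_arc : arc_length_parametrized g).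
Variables (alpha q : R).
Hypotheses (alpha_gt0 : 0 < alpha) (q_ge1 : 1 <= q) (alq_ge2 : 2 <= alpha * q).

Let g_periodic : periodic g 1. Proof. by case: g_closed. Qed.

Let g_lip x y : enorm (g y - g x) <= circle_dist x y.
Proof. exact: arc_length_circle. Qed.

Let g_lip_line x y : enorm (g y - g x) <= `|y - x|.
Proof. exact: le_trans (g_lip x y) (circle_dist_le_norm x y). Qed.

Local Notation dens := (energy_density alpha q g).

(** For points of [0, 1], v is ahead of u if the arc from u forward to v is at
   most half of the circle. In the second case this arc passes through the base
   point and has length v - u + 1. *)
Definition ahead (u v : R) : bool := (0 <= v - u <= 2^-1) || (v - u <= - 2^-1).

(** Splitting the density by orientation makes it possible to shorten the arc
   from u to v consistently, moving u forward and v backward. *)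
Definition fwd u v : R := if ahead u v then dens u v else 0.

Let fwd_ge0 u v : 0 <= fwd u v.
Proof. by rewrite /fwd; case: ifP => _//; exact: energy_density_ge0. Qed.

Let densC u v : dens u v = dens v u.
Proof. exact: energy_densityC. Qed.

Let dens_le_fwd u v : 0 <= u < 1 -> 0 <= v < 1 -> dens u v <= fwd u v + fwd v u.
Proof.
move=> u01 v01.
have A : ahead u v || ahead v u.
  by rewrite /ahead; have [?|?] := lerP 0 (v - u); have [?|?] := lerP `|v - u| 2^-1; lra.
have [auv|nauv] := boolP (ahead u v).
  have E : fwd u v = dens u v by rewrite /fwd auv.
  by rewrite -E lerDl fwd_ge0.
have avu : ahead v u by rewrite (negbTE nauv) in A.
have E : fwd v u = dens u v by rewrite /fwd avu densC.
by rewrite -E lerDr fwd_ge0.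
Qed.

Let fwd_wrap v : 0 <= v < 1 -> fwd 1 v = fwd 0 v.
Proof.
move=> v01; have E : ahead 1 v = ahead 0 v by rewrite /ahead; apply/idP/idP; lra.
have g10 : g 1 = g 0 by rewrite -{1}(add0r 1) g_periodic.
have cd10 : circle_dist 1 v = circle_dist 0 v.
  by rewrite -(circle_dist_shiftl 0 v 1) add0r.
have D : dens 1 v = dens 0 v by rewrite !energy_densityE g10 cd10.
by rewrite /fwd E D.
Qed.

(** Only antipodal pairs are counted in both orientations; they form a null
   set. *)
Let ahead_antisym u v : 0 <= u < 1 -> 0 <= v < 1 -> u != v -> `|v - u| != 2^-1 ->
  ahead v u = ~~ ahead u v.
Proof.
move=> u01 v01 uv d12.
have d1 : v - u != 2^-1 by apply: contra_neq d12 => ->; rewrite ger0_norm.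
have d2 : v - u != - 2^-1 by apply: contra_neq d12 => ->; rewrite normrN ger0_norm.
rewrite /ahead.
have [h|h|h] := ltgtP u v; last by rewrite h eqxx in uv.
  have [k|k|k] := ltgtP (v - u) 2^-1; last by rewrite k eqxx in d1.
    by apply/idP/idP; lra.
  by apply/idP/idP; lra.
have [k|k|k] := ltgtP (v - u) (- 2^-1); last by rewrite k eqxx in d2.
  by apply/idP/idP; lra.
by apply/idP/idP; lra.
Qed.

(** ** Domination *)

Variable kappa : R.
Hypotheses (kappa_gt0 : 0 < kappa)
  (bil : forall s t, kappa * circle_dist s t <= enorm (g t - g s)).

(** The constants of the domination: C is the constant of kernel_prolong for
   h <= 4 l <= (4 / kappa) c, and M bounds the density at pairs whose arc exceeds
   1 / 10, for which the chord exceeds kappa / 10. *)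
Let C := ((1 + 4 / kappa) `^ (alpha + 1)) `^ q.
Let M := (kappa / 10) `^ (- (alpha * q)).

(** The arc from u to v is contained in the arc from x to y, which is at most five
   times as long. If the latter is at most half of the circle, then its density
   dominates; otherwise the former has length at least 1 / 10. *)
Let dens_prolong u v x y (k : int) : 0 < v - u + k%:~R -> v - u + k%:~R <= 2^-1 ->
  x <= u -> v <= y -> (u - x) + (y - v) <= 4 * (v - u + k%:~R) ->
  dens u v <= C * dens x y + M.
Proof.
move=> l0 l1 xu vy; set l := v - u + k%:~R in l0 l1 *.
set h := (u - x) + (y - v) => h4.
have h0 : 0 <= h by rewrite addr_ge0 ?subr_ge0.
have cduv : circle_dist u v = l.
  by apply: circle_dist_half; rewrite -/l (ltW l0).
pose c := enorm (g v - g u).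
have kl : kappa * l <= c by rewrite -cduv bil.
have c0 : 0 < c by rewrite (lt_le_trans _ kl)// mulr_gt0.
have cl : c <= l by rewrite -cduv g_lip.
have C0 : 0 <= C by exact: powR_ge0.
have M0 : 0 <= M by exact: powR_ge0.
rewrite energy_densityE cduv -/c.
have [lh|lh] := leP (l + h) 2^-1.
  have cdxy : circle_dist x y = l + h.
    have -> : l + h = y - x + k%:~R by rewrite /l /h; lra.
    apply: circle_dist_half.
    have -> : y - x + k%:~R = l + h by rewrite /l /h; lra.
    by rewrite lh andbT addr_ge0// ltW.
  rewrite (@le_trans _ _ (C * dens x y))//; last by rewrite lerDl.
  rewrite energy_densityE cdxy; apply: kernel_prolong => //.
  - have : l <= c / kappa by rewrite ler_pdivlMr// mulrC.
    have -> : 4 / kappa * c = 4 * (c / kappa) by rewrite mulrAC mulrA.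
    lra.
  - rewrite (lt_le_trans _ (bil x y))// mulr_gt0// cdxy; lra.
  rewrite (le_trans (enorm_distD (g v) _ _))//.
  have := enorm_distD (g u) (g v) (g x).
  have := g_lip_line v y; rewrite ger0_norm ?subr_ge0//.
  have := g_lip_line x u; rewrite ger0_norm ?subr_ge0//.
  by rewrite -/c /h; lra.
rewrite (@le_trans _ _ M)//; last first.
  by rewrite lerDr mulr_ge0// energy_density_ge0.
rewrite (le_trans (kernel_le alpha_gt0 q_ge1 c0 cl))// /M !powRN.
have aq0 : 0 <= alpha * q by rewrite (le_trans _ alq_ge2).
have k10 : 0 < kappa / 10 by rewrite divr_gt0.
rewrite lef_pV2 ?posrE ?powR_gt0//.
rewrite ge0_ler_powR ?nnegrE ?(ltW c0) ?(ltW k10)// (le_trans _ kl)// ler_pM2l//.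
lra.
Qed.

Section FixedPolygon.
Variables (n : nat) (r : R) (t : nat -> R) (p : R -> 'rV[R]_d).
Hypothesis ins : inscribed g n r t p.

Let n0 := inscribed_n_gt0 ins.
Let r0 := inscribed_r_gt0 ins.
Let mono := inscribed_mono ins.
Let t01 := inscribed_t01 ins.

(** For x in the cell i and y in the cell j, the arc from t i.+1 forward to t j is
   contained in the arc from x to y, and likewise in the other orientation. This
   is the reason for not taking the density at the vertices t i and t j
   themselves, which the density at (x, y) need not dominate; by periodicity the
   shift of an index leaves the sum over all cells unchanged. *)
Definition cell_density i j := fwd (t i.+1) (t j) + fwd (t j.+1) (t i).

Let cell01 i x : (i < n)%N -> cell t i x -> 0 <= x < 1.
Proof.
move=> lti; rewrite /cell /= in_itv/= => /andP[ix xi].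
have /andP[h _] := t01 lti.
have := mono lti; rewrite (inscribed_tn ins) => h1.
by rewrite (le_trans h)//= (lt_le_trans xi).
Qed.

(** The prolongation at both ends is at most 2 r each, and the arc from t i.+1 to
   t j is either trivial or at least r long. *)
Let fwd_le i j x y : (i < n)%N -> (j < n)%N -> cell t i x -> cell t j y ->
  fwd (t i.+1) (t j) <= C * dens x y + M.
Proof.
move=> lti ltj ix jy; rewrite /fwd.
have pos : 0 <= C * dens x y + M.
  by rewrite addr_ge0 ?powR_ge0// mulr_ge0 ?powR_ge0.
case: ifP => // aij.
have [xi0 xi1] : x <= t i.+1 /\ t i.+1 - x <= 2 * r.
  move: ix; rewrite /cell /= in_itv/= => /andP[h1 h2].
  by have /andP[_ h] := inscribed_gap ins i; split; [exact: ltW|lra].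
have [yj0 yj1] : t j <= y /\ y - t j <= 2 * r.
  move: jy; rewrite /cell /= in_itv/= => /andP[h1 h2].
  by have /andP[_ h] := inscribed_gap ins j; split => //; lra.
have ti1 : t i.+1 <= 1 by have := mono lti; rewrite (inscribed_tn ins).
have /andP[tj0 tj1] := t01 ltj.
have ti0 : 0 <= t i.+1 by have := mono (leq0n i.+1); rewrite (inscribed_t0 ins).
have [k [k0 [k1 kE]]] : exists k : nat, [/\ 0 <= t j - t i.+1 + k%:R,
    t j - t i.+1 + k%:R <= 2^-1 & t j + k%:R = t (j + k * n)%N].
  move: aij; rewrite /ahead => /orP[/andP[h1 h2]|h].
    by exists 0%N; rewrite addr0 mul0n addn0 addr0; split.
  exists 1%N; rewrite mul1n (inscribed_shift ins); split => //; lra.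
have [eq|neq] := eqVneq (t j - t i.+1 + k%:R) 0.
  have tij : t i.+1 = t j + k%:R by lra.
  have -> : dens (t i.+1) (t j) = 0.
    rewrite energy_densityE -(@energy_density_diag R d alpha q q_ge1 g (t j)).
    rewrite energy_densityE tij.
    by rewrite (periodicz k%:Z (t j) g_periodic) (circle_dist_shiftl (t j) _ k%:Z).
  exact: pos.
have l0 : 0 < t j - t i.+1 + k%:R by rewrite lt_neqAle eq_sym neq.
have lr : r <= t j - t i.+1 + k%:R.
  have idx : (i.+1 < j + k * n)%N.
    rewrite ltnNge; apply/negP => /mono; rewrite -kE; lra.
  have /andP[h _] := inscribed_gap ins i.+1.
  by have := mono idx; rewrite -kE; lra.
by apply: (@dens_prolong _ _ _ _ k%:Z) => //; rewrite -[k%:Z%:~R]/(k%:R); lra.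
Qed.

Lemma cell_density_ge0 i j : 0 <= cell_density i j.
Proof. by rewrite addr_ge0. Qed.

Lemma step_cell_density_le z :
  step n t cell_density z <= 2 * (C * dens z.2 z.1 + M).
Proof.
have pos : 0 <= C * dens z.2 z.1 + M.
  by rewrite addr_ge0 ?powR_ge0// mulr_ge0 ?powR_ge0.
have [[i [j [lti ltj iz jz]]]|->] := step_cases n t cell_density z; last first.
  by rewrite mulr_ge0.
rewrite (stepE _ mono lti ltj iz jz) /cell_density mulr_natl mulr2n lerD//.
  by rewrite densC; exact: fwd_le.
exact: fwd_le.
Qed.

Let sum_cell_density : \sum_(i < n) \sum_(j < n) cell_density i j =
  \sum_(i < n) \sum_(j < n) (fwd (t i) (t j) + fwd (t j) (t i)).
Proof.
apply: (@sum_shift_period_sym _ n (fun i j => fwd (t i) (t j))) => j ltj.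
by rewrite (inscribed_tn ins) (inscribed_t0 ins) fwd_wrap// t01.
Qed.

(** The cells have sides of length at least r, and shifting an index in
   cell_density does not change the sum. *)
Lemma riemann_sum_le :
  ((\sum_(i < n) \sum_(j < n) dens (t i) (t j) * r * r)%:E <=
   \int[mu2]_(z in square true true) (step n t cell_density z)%:E)%E.
Proof.
rewrite integral_step; first last.
- move=> i j lti ltj [x y] [/= xi yj]; split; rewrite /unit_itv/= in_itv/=.
    exact: cell01 xi.
  exact: cell01 yj.
- exact: cell_density_ge0.
- by move=> i; exact: mono.
- exact: measurable_square.
rewrite lee_fin.
have S (F : nat -> nat -> R) : \sum_(i < n) \sum_(j < n) F i j * r * r =
    (\sum_(i < n) \sum_(j < n) F i j) * (r * r).
  rewrite mulr_suml; apply: eq_bigr => i _.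
  by rewrite mulr_suml; apply: eq_bigr => j _; rewrite mulrA.
apply: (@le_trans _ _ (\sum_(i < n) \sum_(j < n) cell_density i j * r * r)).
  rewrite (S (fun i j => dens (t i) (t j))) (S cell_density).
  apply: ler_wpM2r; first by rewrite mulr_ge0 ?(ltW r0).
  rewrite sum_cell_density.
  apply: ler_sum => i _; apply: ler_sum => j _.
  by apply: dens_le_fwd; exact: t01.
apply: ler_sum => i _; apply: ler_sum => j _; rewrite -!mulrA.
apply: ler_wpM2l; first exact: cell_density_ge0.
have /andP[hi _] := inscribed_gap ins i; have /andP[hj _] := inscribed_gap ins j.
by apply: ler_pM; [exact: (ltW r0)|exact: (ltW r0)|exact: hi|exact: hj].
Qed.

End FixedPolygon.

(** ** Convergence *)

Variables (N0 : nat) (r : nat -> R) (t : nat -> nat -> R) (p : nat -> R -> 'rV[R]_d).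
Hypothesis ins : forall n, (N0 <= n)%N -> inscribed g n (r n) (t n) (p n).

(** Near two points that are neither equal nor antipodal it does not change which
   one is ahead, and the density is continuous. *)
Let fwd_cvg (x y : R) (a b : nat -> R) : 0 <= x < 1 -> 0 <= y < 1 -> x != y ->
  `|y - x| != 2^-1 -> a n @[n --> \oo] --> x -> b n @[n --> \oo] --> y ->
  fwd (a n) (b n) @[n --> \oo] --> fwd x y.
Proof.
move=> x01 y01 xy d12 ax bY.
have near_eq e : 0 < e -> \forall n \near \oo, `|x - a n| <= e /\ `|y - b n| <= e.
  move=> e0; apply: filterI; first by move/cvgrPdist_le : ax; apply.
  by move/cvgrPdist_le : bY; apply.
have d1 : y - x != 2^-1 by apply: contra_neq d12 => ->; rewrite ger0_norm.
have d2 : y - x != - 2^-1 by apply: contra_neq d12 => ->; rewrite normrN ger0_norm.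
have d0 : y - x != 0 by rewrite subr_eq0 eq_sym.
pose m := Num.min `|y - x| (Num.min `|y - x - 2^-1| `|y - x + 2^-1|).
have m0 : 0 < m by rewrite !lt_min !normr_gt0 d0 subr_eq0 d1/= addr_eq0 d2.
have [m1 [m2 m3]] : m <= `|y - x| /\ m <= `|y - x - 2^-1| /\ m <= `|y - x + 2^-1|.
  by rewrite /m !ge_min !lexx !orbT.
have m4 : 0 < m / 4 by rewrite divr_gt0.
have same : \forall n \near \oo, ahead (a n) (b n) = ahead x y.
  apply: filterS (near_eq _ m4) => n []; rewrite !ler_norml /ahead => h1 h2.
  move: m1 m2 m3; rewrite !ler_normr => /orP[m1|m1] /orP[m2|m2] /orP[m3|m3];
    by apply/idP/idP; lra.
have [axy|naxy] := boolP (ahead x y); last first.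
  have -> : fwd x y = 0 by rewrite /fwd (negbTE naxy).
  apply: cvg_near_cst; apply: filterS same => n E.
  by rewrite /fwd E (negbTE naxy).
have E : fwd x y = dens x y by rewrite /fwd axy.
rewrite {}E; suff : dens (a n) (b n) @[n --> \oo] --> dens x y.
  apply: cvg_trans; apply: near_eq_cvg; apply: filterS same => n E.
  by rewrite /fwd E axy.
have gxy : 0 < enorm (g y - g x).
  rewrite enorm_gt0// subr_eq0; apply: contra_neqN xy => /eqP gyx.
  by apply: simple_closed_inj g_closed _ _ _ _ _ => //.
have cvgc : enorm (g (b n) - g (a n)) @[n --> \oo] --> enorm (g y - g x).
  apply/cvgrPdist_le => e e0; have e2 : 0 < e / 2 by rewrite divr_gt0.
  apply: filterS (near_eq _ e2) => n [xa yb].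
  rewrite (le_trans (enorm_sub_abs _ _))//.
  have -> : g y - g x - (g (b n) - g (a n)) = (g y - g (b n)) + (g (a n) - g x).
    by apply/rowP => i; rewrite !mxE; lra.
  have h1 := g_lip_line (b n) y; have h2 := g_lip_line x (a n).
  rewrite distrC in h2; rewrite (le_trans (enormD _ _))// (splitr e).
  by apply: lerD; [exact: le_trans yb|exact: le_trans xa].
have cvgl : circle_dist (a n) (b n) @[n --> \oo] --> circle_dist x y.
  apply/cvgrPdist_le => e e0; have e2 : 0 < e / 2 by rewrite divr_gt0.
  apply: filterS (near_eq _ e2) => n [xa yb].
  have h1 := circle_dist_triangle x y (a n) (b n).
  have h2 := circle_dist_triangle (a n) (b n) x y.
  by rewrite ler_norml; move: h1 h2; rewrite (distrC (a n)) (distrC (b n)); lra.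
apply: (cvg_kernel alpha_gt0 q_ge1 _ gxy (g_lip _ _) _ cvgc cvgl).
have /cvgrPdist_lt /(_ _ gxy) := cvgc.
apply: filterS => n; rewrite ltr_norml => h; apply/andP; split; last exact: g_lip.
lra.
Qed.

Let f n (z : R * R) := if (N0 <= n)%N then step n (t n) (cell_density (t n)) z else 0.

Let H := square true true : set (R * R).

(** Off the diagonal both orientations converge and add up to the density. On the
   diagonal the two points lie in the same cell, and a short arc has its beginning
   not ahead of its end. *)
Let f_cvg z : H z -> `|z.2 - z.1| != 2^-1 -> f n z @[n --> \oo] --> dens z.2 z.1.
Proof.
case: z => x y [/=]; rewrite /unit_itv/= !in_itv/= => x01 y01 d12.
have grid u : 0 <= u < 1 -> exists i : nat -> nat,
    [/\ forall n, (N0 <= n)%N -> (i n < n)%N /\ cell (t n) (i n) u,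
        t n (i n) @[n --> \oo] --> u &
        t n (i n).+1 @[n --> \oo] --> u].
  move=> /andP[u0 u1].
  have /choice[i iP] n : exists i, (N0 <= n)%N -> (i < n)%N /\ cell (t n) i u.
    have [Nn|] := leqP N0 n; last by exists 0%N.
    have [||i lti ui] := @cell_exists R (t n) n u.
    - by rewrite (inscribed_t0 (ins Nn)).
    - by rewrite (inscribed_tn (ins Nn)).
    by exists i.
  have close : forall e, 0 < e -> \forall n \near \oo,
      `|u - t n (i n)| <= e /\ `|u - t n (i n).+1| <= e.
    move=> e e0; have e2 : 0 < e / 2 by rewrite divr_gt0.
    near=> n; have Nn : (N0 <= n)%N by near: n; exact: nbhs_infty_ge.
    have ne : n%:R^-1 < e / 2 by near: n; exact: near_inv_lt.
    have [_] := iP n Nn; rewrite /cell /= in_itv/= => /andP[h1 h2].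
    have /andP[_ h3] := inscribed_gap (ins Nn) (i n).
    have h4 := inscribed_r_le (ins Nn).
    by split; rewrite ler_norml; lra.
  exists i; split => //; apply/cvgrPdist_le => e e0.
    by apply: filterS (close e e0) => n [].
  by apply: filterS (close e e0) => n [].
have [i [iP i0 i1]] := grid x x01; have [j [jP j0 j1]] := grid y y01.
suff : fwd (t n (i n).+1) (t n (j n)) + fwd (t n (j n).+1) (t n (i n))
    @[n --> \oo] --> dens x y.
  rewrite densC; apply: cvg_trans; apply: near_eq_cvg; near=> n.
  have Nn : (N0 <= n)%N by near: n; exact: nbhs_infty_ge.
  have [ltin xi] := iP n Nn; have [ltjn yj] := jP n Nn.
  by rewrite /f Nn (@stepE R n (t n) _ (i n) (j n) (x, y) (inscribed_mono (ins Nn)) ltin ltjn xi yj).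
have [xy|xy] := eqVneq x y.
  rewrite -xy energy_density_diag//; apply: cvg_near_cst; near=> n.
  have Nn : (N0 <= n)%N by near: n; exact: nbhs_infty_ge.
  have n4 : n%:R^-1 < 4^-1 :> R by near: n; apply: near_inv_lt; rewrite invr_gt0.
  have [_ xi] := iP n Nn; have [_ yj] := jP n Nn; rewrite -xy in yj.
  rewrite (cell_unique (inscribed_mono (ins Nn)) yj xi).
  have /andP[h1 h2] := inscribed_gap (ins Nn) (i n).
  have h3 := inscribed_r_le (ins Nn); have h4 := inscribed_r_gt0 (ins Nn).
  have na : ahead (t n (i n).+1) (t n (i n)) = false.
    by rewrite /ahead; apply/negP => /orP[/andP[? ?]|?]; lra.
  by rewrite /fwd na addr0.
have d12' : `|x - y| != 2^-1 by rewrite distrC.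
have yx : y != x by rewrite eq_sym.
have -> : dens x y = fwd x y + fwd y x.
  rewrite /fwd (ahead_antisym x01 y01 xy d12).
  by case: (ahead x y) => /=; rewrite ?addr0 ?add0r// densC.
by apply: cvgD; apply: fwd_cvg.
Unshelve. all: by end_near. Qed.

Lemma antipodal_null : mu2.-negligible [set z : R * R | `|z.2 - z.1| = 2^-1].
Proof.
have mN : measurable [set z : R * R | `|z.2 - z.1| = 2^-1].
  have mf : measurable_fun setT (fun z : R * R => `|z.2 - z.1|).
    apply: (measurableT_comp (@normr_measurable R setT)).
    exact: (measurable_funB measurable_snd measurable_fst).
  rewrite -[X in measurable X]setTI.
  exact: (mf measurableT [set 2^-1] (measurable_set1 _)).
exists [set z : R * R | `|z.2 - z.1| = 2^-1]; split => //.
rewrite /= /product_measure1 integral0_eq// => x _ /=.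
apply: countable_lebesgue_measure0.
apply: (@sub_countable _ _ _ [set x - 2^-1; x + 2^-1]).
  apply: subset_card_le => y; rewrite /xsection/= inE/= => /eqP.
  rewrite eqr_norml => /andP[/orP[/eqP h|/eqP h] _]; [right|left] => /=; lra.
by apply: finite_set_countable; exact: finite_set2.
Qed.

Hypothesis finite_energy : (energy alpha q g < +oo)%E.

(** Dominated convergence: the domination by a multiple of the density plus a
   constant is integrable as the energy is finite. *)
Lemma step_integral_cvg :
  (\int[mu2]_(z in H) (f n z)%:E)%E @[n --> \oo] -->
  (\int[mu2]_(z in H) (dens z.2 z.1)%:E)%E.
Proof.
have cg : continuous g.
  by case: g_closed.
have mH : measurable H by exact: measurable_square.
pose G z := (2 * (C * dens z.2 z.1 + M)).
have mdens : measurable_fun setT (fun z : R * R => dens z.2 z.1).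
  exact: measurable_energy_density.
have f0 n z : 0 <= f n z.
  rewrite /f; case: ifP => // _; apply: step_ge0 => i j; exact: cell_density_ge0.
have C0 : 0 <= C by exact: powR_ge0.
have M0 : 0 <= M by exact: powR_ge0.
have [] := @dominated_convergence _ _ _ mu2 H mH (fun n z => (f n z)%:E)
  (fun z => (dens z.2 z.1)%:E) (fun z => (G z)%:E).
- move=> n; apply: measurable_funTS; apply/measurable_EFinP; rewrite /f.
  by case: (N0 <= n)%N; [exact: measurable_step|exact: measurable_cst].
- by apply: measurable_funTS; apply/measurable_EFinP.
- have [N [mN N0' sub]] := antipodal_null.
  exists N; split => // z /= nz; apply: sub; apply: contrapT => /= d12; apply: nz => Hz.
  apply: cvg_EFin; first by apply: nearW.
  by apply: f_cvg => //; apply/eqP.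
- have mI : measurable (unit_itv true true : set R) by exact: measurable_itv.
  have dens_int : mu2.-integrable H (fun z => (dens z.2 z.1)%:E).
    apply/integrableP; split.
      by apply: measurable_funTS; apply/measurable_EFinP.
    under eq_integral do rewrite gee0_abs ?lee_fin ?energy_density_ge0//.
    rewrite ltey; apply/negP => /eqP E; move: finite_energy.
    by rewrite (energyE true true)// E gt0_muley ?lte_fin ?invr_gt0// ltxx.
  have cst_int : mu2.-integrable H (fun=> M%:E).
    apply/integrableP; split => //.
    have E1 : mu (unit_itv true true) = 1%E.
      by rewrite lebesgue_measure_itv/= lte_fin ltr01 oppr0 adde0.
    have E : mu2 H = 1%E.
      transitivity (mu (unit_itv true true) * mu (unit_itv true true))%E.
        exact: product_measure1E.
      by rewrite E1 mule1.
    rewrite integral_cst// (_ : _ * _ = `|M%:E| * 1)%E; last by congr (_ * _)%E.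
    by rewrite mule1 ltry.
  have Cdens_int := @integrableZl _ _ _ mu2 H mH C _ dens_int.
  have sum_int := @integrableD _ _ _ mu2 H mH _ _ Cdens_int cst_int.
  have dbl_int := @integrableZl _ _ _ mu2 H mH 2 _ sum_int.
  apply: (@eq_integrable _ _ _ mu2 H mH _ _ _ dbl_int) => z _.
  exact: erefl.
- apply: nearW => z n Hz; rewrite lee_fin ger0_norm// /f.
  case: ifP => [Nn|_]; first exact: step_cell_density_le (ins Nn) z.
  by rewrite /G mulr_ge0// addr_ge0// mulr_ge0// energy_density_ge0.
by [].
Qed.

(** The discrete energy is at most alpha^-1 times the integral of f n, which tends
   to the energy. *)
Lemma limsup_energy K N1 : (forall n, (N1 <= n)%N -> polygons K n (p n)) ->
  (limn_esup (fun n => discrete_energy K alpha q n (p n)) <= energy alpha q g)%E.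
Proof.
move=> Kp; have cg : continuous g by case: g_closed.
rewrite (energyE true true)//.
apply: (@limn_esup_le_near R _
  (fun n => alpha^-1%:E * \int[mu2]_(z in H) (f n z)%:E)%E); last first.
  apply: cvgeZl => //; exact: step_integral_cvg.
near=> n.
have Nn : (N0 <= n)%N by near: n; exists N0.
have Kn : polygons K n (p n) by apply: Kp; near: n; exists N1.
apply: (le_trans (inscribed_energy_le g_closed g_arc (ins Nn) alpha_gt0 q_ge1
  alq_ge2 Kn)).
rewrite EFinM; apply: lee_wpmul2l; first by rewrite lee_fin invr_ge0 ltW.
rewrite (_ : (fun z => (f n z)%:E) = fun z => (step n (t n) (cell_density (t n)) z)%:E).
  exact: riemann_sum_le (ins Nn).
by apply/funext => z; rewrite /f Nn.
Unshelve. all: end_near. Qed.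

End UpperBound.

(** * Gamma-convergence *)

Section Convergence.
Context {R : realType} {d : nat} {K : set (R -> 'rV[R]_d)}.
Variable dX : curve_space K -> curve_space K -> R.

Lemma curve_space_unit (f : curve_space K) : unit_curves K (val f).
Proof. by have := valP f; rewrite inE => -[[]|[n _ []]]. Qed.

Lemma curve_space_periodic (f : curve_space K) : periodic (val f) 1.
Proof. by have [[]] := curve_space_unit f. Qed.

Lemma curve_space_lipschitz (f : curve_space K) x y :
  enorm (val f y - val f x) <= `|y - x|.
Proof.
have [_ arcf _] := curve_space_unit f.
exact: le_trans (arc_length_circle x y arcf (curve_space_periodic f))
                (circle_dist_le_norm x y).
Qed.

(** Curves parametrized by arc length are uniformly Lipschitz, which turns
    convergence in mean into pointwise convergence. *)
Lemma dist_cvg_pointwise c1 (x : curve_space K) (x_ : nat -> curve_space K) t :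
  0 < c1 ->
  (forall f g : curve_space K,
     (c1%:E * curve_Lnorm 1 (val f \- val g)%R <= (dX f g)%:E)%E) ->
  dX (x_ n) x @[n --> \oo] --> (0 : R) -> 0 < t < 1 ->
  enorm (val (x_ n) t - val x t) @[n --> \oo] --> (0 : R).
Proof.
move=> c0 lower cvgx /andP[t0 t1]; apply/cvgrPdist_lt => e e0.
pose delta := Num.min (1 - t) (e / 4).
have delta0 : 0 < delta by rewrite lt_min subr_gt0 t1 divr_gt0.
have delta1 : t + delta <= 1 by rewrite -lerBrDl ge_min lexx.
have delta2 : 4 * delta <= e.
  by rewrite mulrC -ler_pdivlMr// ge_min lexx orbT.
have eta0 : 0 < c1 * (e / 2 * delta) by rewrite !mulr_gt0.
have /cvgrPdist_lt/(_ _ eta0) := cvgx; apply: filterS => n.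
rewrite sub0r normrN => small.
rewrite sub0r normrN ger0_norm ?enorm_ge0//.
apply: (@enorm_lt_Lnorm1 _ _ (val (x_ n) \- val x)%R t e delta) => //.
- exact: ltW.
- move=> a b /=.
  have regroup (X Y A B : 'rV[R]_d) : X - Y - (A - B) = (X - A) - (Y - B).
    by rewrite !opprB [B - A]addrC addrACA [- Y + B]addrC.
  rewrite regroup.
  rewrite (le_trans (enormD _ _))// enormN mulrDl mul1r lerD//;
    exact: curve_space_lipschitz.
- rewrite -(@lte_pmul2l _ c1%:E)// -EFinM.
  by rewrite (le_lt_trans (lower _ _))// lte_fin (le_lt_trans (ler_norm _)).
Qed.

End Convergence.

Theorem theorem1p2 (R : realType) (d : nat) (alpha q : R)
    (alpha_gt0 : 0 < alpha) (q_ge1 : 1 <= q)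
    (alq_ge2 : 2 <= alpha * q) (alq_lt : alpha * q < 2 * q + 1)
    (K : set (R -> 'rV[R]_d)) (K_tame : tame_knot_class K)
    (dX : curve_space K -> curve_space K -> R) (dX_metric : is_metric dX)
    (c1 c2 : R) (c1_gt0 : 0 < c1) (c2_gt0 : 0 < c2)
    (dX_lower : forall f g : curve_space K,
       (c1%:E * curve_Lnorm 1 (val f \- val g)%R <= (dX f g)%:E)%E)
    (dX_upper : forall f g : curve_space K,
       ((dX f g)%:E <= c2%:E * W1oo_norm (val f \- val g)%R)%E) :
  gamma_converges dX
    (fun (n : nat) (f : curve_space K) => discrete_energy K alpha q n (val f))
    (fun f : curve_space K => energy alpha q (val f)).
Proof.
move=> x; have [x_closed x_arc Kx] := curve_space_unit x.
split=> [x_ cvgx|].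
  apply: liminf_energy => // t t01.
  exact: dist_cvg_pointwise c1_gt0 dX_lower cvgx t01.
have [E|/eqP Efin] := eqVneq (energy alpha q (val x)) +oo%E.
  (* The upper limit is at most +oo, so the constant sequence will do. *)
  exists (fun=> x); last by rewrite E leey.
  have [_ dX0 _ _] := dX_metric.
  by rewrite (_ : dX x x = 0); [exact: cvg_cst|apply/dX0].
have x_C1 : C1 (val x).
  have := valP x; rewrite inE => -[[]//|[n _ [_ [a eqa]]]].
  by case: Efin; exact: polygon_energy_pinfty eqa.
have finite_energy : (energy alpha q (val x) < +oo)%E by rewrite ltey; apply/eqP.
have [kappa kappa0 bil] := simple_closed_bilipschitz x_closed x_arc x_C1.
have [N0 ex] := exists_inscribed x_closed x_arc x_C1.
have [N1 inK] := inscribed_polygons x_closed x_arc x_C1 K_tame Kx.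
pose N := maxn N0 N1.
have /choice[z zP] : forall n, exists z : R * (nat -> R) * curve_space K,
    (N <= n)%N ->
    inscribed (val x) n z.1.1 z.1.2 (val z.2) /\ polygons K n (val z.2).
  move=> n; have [|_] := leqP N n; last by exists (0, (fun=> 0), x).
  rewrite geq_max => /andP[/ex[r [t [p ins]]] N1n].
  have Kp : polygons K n p by exact: inK ins N1n.
  have Xp : p \in curve_space K by rewrite inE; right; exists n.
  by exists (r, t, exist _ p Xp).
exists (fun n => (z n).2); last first.
  exact: (limsup_energy x_closed x_arc alpha_gt0 q_ge1 alq_ge2 kappa0 bil
    (fun n Nn => (zP n Nn).1) finite_energy (fun n Nn => (zP n Nn).2)).
apply/cvgrPdist_le => e e0.
have ec0 : 0 < e / c2 by rewrite divr_gt0.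
have [N2 close] := inscribed_close x_closed x_arc x_C1 ec0.
near=> n.
have [ins _] : inscribed (val x) n (z n).1.1 (z n).1.2 (val (z n).2) /\
    polygons K n (val (z n).2).
  by apply: zP; near: n; exists N.
have N2n : (N2 <= n)%N by near: n; exists N2.
have [_ W] := close n _ _ _ ins N2n.
have [dX_ge0 _ _ _] := dX_metric.
rewrite sub0r normrN ger0_norm// -lee_fin (le_trans (dX_upper _ _))//.
rewrite -[leRHS](_ : c2%:E * (e / c2)%:E = e%:E)%E.
  by apply: lee_wpmul2l => //; rewrite lee_fin ltW.
by rewrite -EFinM mulrC divfK// gt_eqF.
Unshelve. all: end_near. Qed.
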